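(* Let $q\ge 3$ be an integer. Then there is an absolute constant $C>0$ such that $$\sum_{\substack{\chi \bmod q\\ \chi \neq \chi_0 \\ \chi(-1)=1}} \frac{1}{|L(1,\chi)|^{2}}= \frac{\zeta(2)}{2\zeta(4)}\prod_{p \mid q} \left( 1+\frac{1}{p^2}\right)^{-1} \varphi(q) + O\left(\exp \left( C\frac{\log q}{\log\log q}\right) \right) +\delta_1\cdot O\left( \left(1-\beta_1\right)^{-1}\left( (\log q)^2+ (1-\beta_1)^{-1}\right)\right),$$ where $\beta_1$ denotes the exceptional zero for the modulus $q$, and $\delta_1=1$ if $\beta_1$ exists, $\delta_1=0$ otherwise (in which case the last term is absent). The implied constants and $C$ are independent of $q$.
   Context: The sum runs over the Dirichlet characters $\chi$ modulo $q$ (primitive or not) that are nonprincipal and even; $\chi_0$ is the principal character modulo $q$. $L(s,\chi)$ is the Dirichlet $L$-function of the character $\chi$ modulo $q$, i.e. the analytic continuation of $\sum_{n\ge1}\chi(n)n^{-s}$; $\varphi$ is Euler's function, $\zeta$ the Riemann zeta-function, and $p$ runs over primes. Exceptional zero: fix an effectively computable constant $c_0>0$ with the following (known) property: for every $q\ge 2$, the product $\prod_{\chi \bmod q}L(s,\chi)$ has at most one zero in the region $\sigma\ge 1-\frac{c_0}{\log (q(|t|+1))}$ ($s=\sigma+it$), and such a zero, if it exists, is real and simple and corresponds to a nonprincipal real character $\chi_1$ modulo $q$. This zero, if it exists, is called the exceptional zero (for the modulus $q$) and denoted $\beta_1$. *)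

(* Defs.v *)
From HB Require Import structures.
From mathcomp Require Import all_boot all_order all_fingroup all_algebra.
From mathcomp Require Import cyclic.
From mathcomp Require Import all_classical all_reals all_analysis.
From mathcomp Require Import complex.

Set Implicit Arguments.
Unset Strict Implicit.
Unset Printing Implicit Defensive.

Import Order.TTheory GRing.Theory Num.Theory numFieldNormedType.Exports.

Local Open Scope classical_set_scope.
Local Open Scope ring_scope.
Local Open Scope complex_scope.

(* The regular alias [R[i]^o] carries the normed topology of the complex field;
   [derivable F s 1] over it is complex differentiability at [s]. *)
Notation cplx R := (R[i]^o)%type.

(* k ^ s = exp (s log k), meaningful for k > 0. *)
Definition nat_cpow (R : realType) (k : nat) (s : cplx R) : cplx R :=
  let l := ln (k%:R : R) in
  (expR (complex.Re s * l))%:C *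
  (cos (complex.Im s * l) +i* sin (complex.Im s * l)).

(* The modulus q is always at least 2 below, so that ['Z_q] is Z/qZ. *)
Definition dirichlet_char (R : realType) (q : nat) : set {ffun 'Z_q -> cplx R} :=
  [set chi | [/\ chi 1 = 1,
                 forall a b, chi (a * b) = chi a * chi b &
                 forall a, (chi a != 0) = (a \is a GRing.unit)]].

(* Since there are finitely many characters, the sums and products over them
   are not the trivial ones that [\sum_(x \in A)] yields on infinite supports. *)
Lemma finite_dirichlet_char (R : realType) (q : nat) :
  finite_set (@dirichlet_char R q).
Proof.
pose G := [set: {unit 'Z_q}]%G; pose m := #|G|.
pose p : {poly R[i]} := 'X * ('X^m - 1).
have m_gt0 : (0 < m)%N by exact: (cardG_gt0 G).
have p_neq0 : p != 0.
  by rewrite mulf_neq0 ?polyX_eq0// -size_poly_eq0 size_XnsubC.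
have [rs p_rs] := closed_field_poly_normal p.
have rootE z : root p z -> z \in rs.
  by rewrite p_rs rootZ ?lead_coef_eq0// root_prod_XsubC.
pose f (g : {ffun 'Z_q -> seq_sub rs}) : {ffun 'Z_q -> cplx R} :=
  [ffun a => val (g a)].
apply: (@sub_finite_set _ _ (range f)); last first.
  by apply: finite_image; exact: finite_finset.
move=> chi [chi1 chiM chi_unit].
have chi_rs a : chi a \in rs.
  apply: rootE; rewrite /root !hornerE mulf_eq0 subr_eq0.
  have [->//|] := eqVneq (chi a) 0; rewrite chi_unit => a_unit.
  have chiX k : chi (a ^+ k) = chi a ^+ k.
    by elim: k => [|k IHk]; rewrite ?expr0// !exprS chiM IHk.
  apply/eqP; rewrite /= -chiX.
  have := @expg_cardG _ G (FinRing.unit 'Z_q a_unit) (finset.in_setT _).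
  by move/(congr1 val); rewrite FinRing.val_unitX/= => ->.
exists [ffun a => SeqSub (chi_rs a)] => //.
by apply/ffunP => a; rewrite !ffunE.
Qed.

Definition principal_char (R : realType) (q : nat) : {ffun 'Z_q -> cplx R} :=
  [ffun a => (a \is a GRing.unit)%:R].

Definition real_char (R : realType) (q : nat) (chi : {ffun 'Z_q -> cplx R}) :=
  forall a, complex.Im (chi a) = 0.

Definition even_nonprincipal_char (R : realType) (q : nat) :
    set {ffun 'Z_q -> cplx R} :=
  [set chi | [/\ dirichlet_char chi, chi <> principal_char R q &
                 chi (- 1) = 1]].

(* The continuation is entire, except that for the principal character it is
   only holomorphic off s = 1, where its value is not determined. *)
Definition is_dirichletL (R : realType) (q : nat)
    (chi : {ffun 'Z_q -> cplx R}) (F : cplx R -> cplx R) : Prop :=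
  (forall s : cplx R, (chi = principal_char R q -> s <> 1) ->
     derivable F s 1) /\
  (forall s : cplx R, 1 < complex.Re s ->
     (\sum_(1 <= n < N) chi n%:R * nat_cpow n (- s)) @[N --> \oo] --> F s).

Definition dirichletL (R : realType) (q : nat)
    (chi : {ffun 'Z_q -> cplx R}) : cplx R -> cplx R :=
  xget (fun=> 0) [set F | is_dirichletL chi F].

Definition dirichletL_prod (R : realType) (q : nat) (s : cplx R) : cplx R :=
  \big[*%R/1]_(chi \in @dirichlet_char R q) dirichletL chi s.

(* The point s = 1 is excluded because the product has its pole there. *)
Definition dirichletL_prod_zero (R : realType) (q : nat) (s : cplx R) : Prop :=
  s <> 1 /\ dirichletL_prod q s = 0.

Definition zero_region (R : realType) (c0 : R) (q : nat) (s : cplx R) : Prop :=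
  1 - c0 / ln (q%:R * (`|complex.Im s| + 1)) <= complex.Re s.

Definition exceptional_zero_const (R : realType) (c0 : R) : Prop :=
  forall q : nat, (2 <= q)%N ->
  (forall s s' : cplx R,
     zero_region c0 q s -> dirichletL_prod_zero q s ->
     zero_region c0 q s' -> dirichletL_prod_zero q s' -> s = s') /\
  (forall s : cplx R,
     zero_region c0 q s -> dirichletL_prod_zero q s ->
     [/\ complex.Im s = 0,
         derive1 (@dirichletL_prod R q) s <> 0 &
         exists chi1 : {ffun 'Z_q -> cplx R},
           [/\ dirichlet_char chi1, chi1 <> principal_char R q,
               real_char chi1 & dirichletL chi1 s = 0]]).

Definition exceptional_zero (R : realType) (c0 : R) (q : nat) (beta : R) :=
  zero_region c0 q beta%:C /\ dirichletL_prod_zero q (beta%:C : cplx R).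

Definition exceptional_delta (R : realType) (c0 : R) (q : nat) : R :=
  (`[< exists beta : R, exceptional_zero c0 q beta >])%:R.

(* The Riemann zeta-function at an integer k >= 2. *)
Definition zeta_nat (R : realType) (k : nat) : R :=
  limn (fun N => \sum_(1 <= n < N) (n%:R ^- k : R)).

(* Main.v *)
Require Import Defs.
From HB Require Import structures.
From mathcomp Require Import all_boot all_order all_fingroup all_algebra.
From mathcomp Require Import cyclic separable cyclotomic mxrepresentation.
From mathcomp Require Import all_classical all_reals all_analysis.
From mathcomp Require Import complex.
From mathcomp Require Import ring lra.

(** Every [1 / L(1, chi)] is a conditionally convergent Moebius series
    [sum of mu(n) chi(n) / n]. With an absolutely convergent series in its place, orthogonality
    of the even characters would give the mean square at once: the diagonal [m = n] yields
    [phi(q) / 2] times the sum of [mu(n) ^ 2 / n ^ 2] over [n] prime to [q], which is the main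
    term ([mu2_zterm_clim]), and the other pairs with [m = n] or [m = - n] modulo [q]
    contribute little, being sparse. The proof inserts a smooth weight of effective length
    [exp (O((log q) ^ 2))], which costs only powers of [log q].

    Write [l = log q] and let [r] be a small multiple of [1 / l]. If [L(s, chi)] has no zero
    in the disc of radius [r] about [1 + r / 400], a Borel-Caratheodory argument
    ([zero_free_lower]) bounds [1 / L] there by a polynomial in [q] and [l]. Hence [1 / L(1, chi)]
    is given, up to [O(l ^ 2 / q ^ 2)], by the first [O(l)] terms of the Taylor series of [1 / L]
    about [1 + r / 400]. Each Taylor coefficient is an absolutely convergent Dirichlet
    series, and together they form the Moebius series in which [1 / n] is multiplied by a
    partial sum of the Poisson distribution with parameter [(r / 400) log n]
    ([inverse_approx]). This factor lies in [0, 1], is within [2 ^ (- K)] of 1 for small [n],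
    and decays like a small power of [n], so that the sums of the weights are [O(l ^ 2)] and
    the off-diagonal terms of the mean square are [O(l ^ 4)] ([even_mean_square],
    [smoothed_mean_square]). All errors are powers of [l], far below
    [exp (C l / log l)] ([pow4_le_expR]).

    A nonprincipal character with a zero in the disc is exceptional: the zero lies in the
    region of the hypothesis, so it is the exceptional zero [beta], it is simple, and hence
    belongs to one character only, a real one ([disc_zero_exceptional],
    [disc_zero_unique]). Its term is the second error term, and is bounded through
    [L(1, chi) >= c (1 - beta)] ([real_char_lower]), which follows from Estermann's
    comparison of [zeta(s) L(s, chi)] with its Taylor polynomial at [s = 2]
    ([estermann_lower]). That [L] does not vanish at 1 itself is shown by the same
    expansion for real characters and by the 3-4-1 inequality for complex ones
    ([nonprincipal_neq0]).

    The continuations exist because of the hypothesis: were one of the functions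
    [dirichletL chi] not a continuation, it would be identically 0, and so would be the
    product of all of them, against the uniqueness of the exceptional zero
    ([dirichletLP]). Complex analysis is developed from Goursat's theorem on rectangles up to
    Taylor expansion with Cauchy's estimates ([taylor]). *)

Set Implicit Arguments.
Unset Strict Implicit.
Unset Printing Implicit Defensive.

Import Order.TTheory GRing.Theory Num.Theory numFieldNormedType.Exports.

Local Open Scope classical_set_scope.
Local Open Scope ring_scope.

Local Notation Re := complex.Re.
Local Notation Im := complex.Im.

(** * Complex modulus and differentiation *)

Section ComplexModulus.
Variable R : realType.
Local Notation C := R[i].
Implicit Types (z w : C) (x y : R).

Definition cabs z : R := ComplexField.Normc.normc z.

Lemma cabs_norm z : (cabs z)%:C%C = `|z|.
Proof. by rewrite normc_def /cabs; case: z. Qed.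

Lemma cabs0 : cabs 0 = 0. Proof. by rewrite /cabs ComplexField.Normc.normc0. Qed.
Lemma cabs1 : cabs 1 = 1. Proof. by rewrite /cabs ComplexField.Normc.normc1. Qed.
Lemma cabsM z w : cabs (z * w) = cabs z * cabs w.
Proof. by rewrite /cabs ComplexField.Normc.normcM. Qed.
Lemma cabsV z : cabs z^-1 = (cabs z)^-1.
Proof. by rewrite /cabs ComplexField.Normc.normcV. Qed.
Lemma cabsX z n : cabs (z ^+ n) = cabs z ^+ n.
Proof. by elim: n => [|n IH]; rewrite ?expr0 ?cabs1// !exprS cabsM IH. Qed.
Lemma cabs_eq0 z : (cabs z == 0) = (z == 0).
Proof.
by apply/eqP/eqP => [|->]; [exact: ComplexField.Normc.eq0_normc|exact: cabs0].
Qed.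
Lemma cabs_ge0 z : 0 <= cabs z.
Proof. by case: z => a b; rewrite /cabs sqrtr_ge0. Qed.
Lemma cabs_gt0 z : (0 < cabs z) = (z != 0).
Proof. by rewrite lt_def cabs_eq0 cabs_ge0 andbT. Qed.
Lemma cabsD z w : cabs (z + w) <= cabs z + cabs w.
Proof. by move: z w; exact: (@le_normcD R). Qed.
Lemma cabsN z : cabs (- z) = cabs z. Proof. by move: z; exact: (@normcN R). Qed.
Lemma cabsBC z w : cabs (z - w) = cabs (w - z).
Proof. by rewrite -cabsN opprB. Qed.
Lemma cabsB z w : cabs (z - w) <= cabs z + cabs w.
Proof. by rewrite -(cabsN w) cabsD. Qed.
Lemma cabs_real x : cabs x%:C%C = `|x|.
Proof. by rewrite /cabs /= expr0n addr0 sqrtr_sqr. Qed.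
Lemma cabs_nat n : cabs n%:R = n%:R.
Proof.
have -> : (n%:R : C) = (n%:R : R)%:C%C by rewrite rmorph_nat.
by rewrite cabs_real ger0_norm.
Qed.
Lemma cabs_i : cabs 'i%C = 1.
Proof. by rewrite /cabs /= expr0n add0r expr1n sqrtr1. Qed.
Lemma ler_cabsB z w : cabs z - cabs w <= cabs (z - w).
Proof. by rewrite lerBlDr (le_trans _ (cabsD _ _))// subrK. Qed.
Lemma ler_cabsBD z w u : cabs (z - w) <= cabs (z - u) + cabs (u - w).
Proof. by rewrite (le_trans _ (cabsD _ _))// addrA subrK. Qed.

Lemma cabs_sum I (r : seq I) (P : pred I) (f : I -> C) :
  cabs (\sum_(i <- r | P i) f i) <= \sum_(i <- r | P i) cabs (f i).
Proof.
elim/big_rec2: _ => [|i y z _ H]; first by rewrite cabs0.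
by rewrite (le_trans (cabsD _ _))// lerD2l.
Qed.

Lemma cabs_Re z : `|Re z| <= cabs z.
Proof.
case: z => a b; rewrite /cabs /= -sqrtr_sqr ler_sqrt; last first.
  by rewrite addr_ge0 ?sqr_ge0.
by rewrite lerDl sqr_ge0.
Qed.

Lemma cabs_Im z : `|Im z| <= cabs z.
Proof.
case: z => a b; rewrite /cabs /= -sqrtr_sqr ler_sqrt; last first.
  by rewrite addr_ge0 ?sqr_ge0.
by rewrite lerDr sqr_ge0.
Qed.

Lemma cabs_le z : cabs z <= `|Re z| + `|Im z|.
Proof.
rewrite {1}[z]complexE (le_trans (cabsD _ _))// cabsM cabs_i mul1r.
by rewrite !cabs_real.
Qed.

Lemma sqr_cabs z : cabs z ^+ 2 = Re z ^+ 2 + Im z ^+ 2.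
Proof. by case: z => a b; rewrite sqr_sqrtr //= addr_ge0 ?sqr_ge0. Qed.

Lemma ReD z w : Re (z + w) = Re z + Re w. Proof. by case: z w => ? ? []. Qed.
Lemma ImD z w : Im (z + w) = Im z + Im w. Proof. by case: z w => ? ? []. Qed.
Lemma ReN z : Re (- z) = - Re z. Proof. by case: z. Qed.
Lemma ImN z : Im (- z) = - Im z. Proof. by case: z. Qed.
Lemma ReM z w : Re (z * w) = Re z * Re w - Im z * Im w.
Proof. by case: z w => ? ? []. Qed.
Lemma ImM z w : Im (z * w) = Re z * Im w + Im z * Re w.
Proof. by case: z w => ? ? []. Qed.
Lemma ReZ x z : Re (x%:C%C * z) = x * Re z.
Proof. by rewrite ReM /= mul0r subr0. Qed.
Lemma ImZ x z : Im (x%:C%C * z) = x * Im z.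
Proof. by rewrite ImM /= mul0r addr0. Qed.

Lemma Re_sum I (r : seq I) (P : pred I) (f : I -> C) :
  Re (\sum_(i <- r | P i) f i) = \sum_(i <- r | P i) Re (f i).
Proof. by elim/big_rec2: _ => // i y z _ <-; rewrite ReD. Qed.

Lemma Im_sum I (r : seq I) (P : pred I) (f : I -> C) :
  Im (\sum_(i <- r | P i) f i) = \sum_(i <- r | P i) Im (f i).
Proof. by elim/big_rec2: _ => // i y z _ <-; rewrite ImD. Qed.

Lemma complexP z w : Re z = Re w -> Im z = Im w -> z = w.
Proof. by case: z w => ? ? [? ?] /= -> ->. Qed.

Lemma cabs_small0 z : (forall e : R, 0 < e -> cabs z <= e) -> z = 0.
Proof.
move=> H; apply/eqP; rewrite -cabs_eq0 eq_le cabs_ge0 andbT leNgt.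
apply/negP => z0; have := H (cabs z / 2).
by rewrite divr_gt0// => /(_ isT); lra.
Qed.

End ComplexModulus.

Section Derivative.

(** The form with an increment and a linear error, in which all estimates below are carried out. *)
Lemma is_deriveP (K : numFieldType) (f : K^o -> K^o) (x l : K^o) :
  is_derive x 1 f l <->
  forall e : K, 0 < e -> exists2 d : K, 0 < d & 
   forall h : K, `|h| < d -> `|f (x + h) - f x - h * l| <= e * `|h|.
Proof.
split=> [df e e0|H].
  have : (fun h => h^-1 *: (f (h *: (1:K^o) + x) - f x)) @ 0^' --> l.
    have := @ex_derive _ _ _ _ _ _ _ df; rewrite /derivable.
    by rewrite -(@derive_val _ _ _ _ _ _ _ df) /derive.
  move/cvgrPdist_le => /(_ e e0); rewrite /dnbhs /within /=.
  move=> /nbhs_ballP[d /= d0 Hd]; exists d => // h hd.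
  have [->|h0] := eqVneq h 0.
    by rewrite addr0 subrr mul0r subr0 normr0 mulr0.
  have := Hd h; rewrite /ball /= sub0r normrN => /(_ hd h0).
  rewrite /GRing.scale /= mulr1 (addrC h) => A.
  have -> : f (x + h) - f x - h * l = - (h * (l - h^-1 * (f (x + h) - f x))).
    by rewrite mulrBr mulrA mulfV// mul1r opprB.
  by rewrite normrN normrM mulrC ler_wpM2r.
have cv : (fun h => h^-1 *: (f (h *: (1:K^o) + x) - f x)) @ 0^' --> l.
  apply/cvgrPdist_le => e e0; have [d d0 Hd] := H _ e0.
  rewrite /dnbhs /within /=; apply/nbhs_ballP; exists d => // h.
  rewrite /ball /= sub0r normrN => hd h0; have := Hd _ hd.
  rewrite /GRing.scale /= mulr1 (addrC h) => A.
  have -> : l - h^-1 * (f (x + h) - f x) = - (h^-1 * (f (x + h) - f x - h * l)).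
    by rewrite [h^-1 * (_ - h * l)]mulrBr mulrA mulVf// mul1r opprB.
  by rewrite normrN normrM normrV ?unitfE// mulrC ler_pdivrMr ?normr_gt0//.
split; first by apply: (cvgP _ cv).
by apply: cvg_lim cv; exact: norm_hausdorff.
Qed.

Variable R : realType.
Local Notation C := R[i].
Implicit Types (z w l : C) (x y : R) (g : C -> C).

Definition cdiff g z l := @is_derive C C^o C^o z 1 g l.

Lemma cdiffP g z l : cdiff g z l <->
  forall e : R, 0 < e -> exists2 d : R, 0 < d &
  forall h, cabs h < d -> cabs (g (z + h) - g z - h * l) <= e * cabs h.
Proof.
rewrite /cdiff is_deriveP; split=> H e e0.
  have [|d d0 Hd] := H e%:C%C; first by rewrite ltcR.
  have dE : d = (Re d)%:C%C by rewrite RRe_real// ger0_real// ltW.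
  exists (Re d); first by rewrite -ltcR -dE.
  move=> h hd; rewrite -lecR rmorphM/= !cabs_norm; apply: Hd.
  by rewrite dE -cabs_norm ltcR.
have eE : e = (Re e)%:C%C by rewrite RRe_real// ger0_real// ltW.
have [|d d0 Hd] := H (Re e); first by rewrite -ltcR -eE.
exists d%:C%C; first by rewrite ltcR.
move=> h; rewrite -cabs_norm ltcR => /Hd.
by rewrite -lecR rmorphM/= !cabs_norm -eE.
Qed.

Lemma cdiff_derivable g z : @derivable C C^o C^o g z 1 -> exists l, cdiff g z l.
Proof. by move=> H; exists (@derive C C^o C^o g z 1); split. Qed.

Lemma cdiff_eq g z l l' : l = l' -> cdiff g z l -> cdiff g z l'.
Proof. by move=> ->. Qed.

Lemma cdiff_ext f g z l (d : R) : 0 < d ->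
  (forall h, cabs h < d -> f (z + h) = g (z + h)) -> cdiff f z l -> cdiff g z l.
Proof.
move=> d0 fg /cdiffP fl; apply/cdiffP => e e0.
have [d' d'0 H] := fl e e0; exists (Num.min d d'); first by rewrite lt_min d0.
move=> h; rewrite lt_min => /andP[hd hd'].
have := fg 0; rewrite cabs0 addr0 => /(_ d0) <-.
by rewrite -fg// H.
Qed.

Lemma cdiff_cst (c z : C) : cdiff (fun=> c) z 0.
Proof. exact: is_derive_cst. Qed.

Lemma cdiff_id z : cdiff (fun w => w) z 1.
Proof. exact: is_derive_id. Qed.

Lemma cdiffD f g z l m : cdiff f z l -> cdiff g z m ->
  cdiff (fun w => f w + g w) z (l + m).
Proof. by move=> fl gm; exact: is_deriveD. Qed.

Lemma cdiffB f g z l m : cdiff f z l -> cdiff g z m ->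
  cdiff (fun w => f w - g w) z (l - m).
Proof. by move=> fl gm; exact: is_deriveB. Qed.

Lemma cdiffM f g z l m : cdiff f z l -> cdiff g z m ->
  cdiff (fun w => f w * g w) z (f z * m + l * g z).
Proof.
by move=> fl gm; rewrite (mulrC l); exact: (@is_deriveM C C^o f g z 1 l m).
Qed.

Lemma cdiff_shift g c z l : cdiff g (c + z) l -> cdiff (fun w => g (c + w)) z l.
Proof.
move=> /cdiffP gl; apply/cdiffP => e e0; have [d d0 H] := gl e e0.
by exists d => // h hd; rewrite addrA H.
Qed.

Lemma cdiff_cont g z l : cdiff g z l -> forall e : R, 0 < e ->
  exists2 d : R, 0 < d & forall h, cabs h < d -> cabs (g (z + h) - g z) <= e.
Proof.
move=> /cdiffP gl e e0; have [d d0 H] := gl 1 ltr01.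
have m0 : 0 < 1 + cabs l by rewrite ltr_wpDr ?cabs_ge0.
exists (Num.min d (e / (1 + cabs l))).
  by rewrite lt_min d0 divr_gt0.
move=> h; rewrite lt_min => /andP[/H hd]; rewrite ltr_pdivlMr// => he.
have -> : g (z + h) - g z = (g (z + h) - g z - h * l) + h * l by rewrite subrK.
rewrite (le_trans (cabsD _ _))// (le_trans (lerD hd (lexx _)))// cabsM.
by rewrite mul1r -[X in X + _ <= _]mulr1 -mulrDr ltW.
Qed.

Lemma cdiffV g z l : g z != 0 -> cdiff g z l ->
  cdiff (fun w => (g w)^-1) z (- l / g z ^+ 2).
Proof.
move=> gz gl; have := gl => /cdiffP Hl; apply/cdiffP => e e0.
set G := cabs (g z); have G0 : 0 < G by rewrite cabs_gt0.
set L := cabs l.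
have [d1 d10 H1] := cdiff_cont gl (divr_gt0 G0 (ltr0n _ 2)).
have k0 : 0 < e * G ^+ 2 / 4 by rewrite divr_gt0// mulr_gt0// exprn_gt0.
have [d2 d20 H2] := Hl _ k0.
have L10 : 0 < L + 1 by rewrite ltr_wpDl ?cabs_ge0.
have m0 : 0 < e * G ^+ 3 / 4 / (L + 1).
  by rewrite divr_gt0// divr_gt0// mulr_gt0// exprn_gt0.
have [d3 d30 H3] := cdiff_cont gl m0.
exists (Num.min d1 (Num.min d2 d3)); first by rewrite !lt_min d10 d20.
move=> h; rewrite !lt_min => /and3P[/H1 h1 /H2 h2 /H3 h3].
have gh : G / 2 <= cabs (g (z + h)).
  have := ler_cabsB (g z) (g (z + h)); rewrite cabsBC -/G.
  by move: h1; rewrite -/G; lra.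
have gh0 : g (z + h) != 0 by rewrite -cabs_gt0; lra.
set D := g (z + h) - g z in h1 h2 h3.
have -> : (g (z + h))^-1 - (g z)^-1 - h * (- l / g z ^+ 2) =
   (- (D - h * l) * g z + D * (h * l)) / (g z ^+ 2 * g (z + h)).
  by rewrite /D; field; rewrite ?gz ?gh0.
have den : G ^+ 3 / 2 <= cabs (g z ^+ 2 * g (z + h)).
  rewrite cabsM cabsX -/G exprSr -mulrA ler_pM2l ?exprn_gt0//.
have G30 : 0 < G ^+ 3 / 2 by rewrite divr_gt0// exprn_gt0.
rewrite cabsM cabsV ler_pdivrMr; last exact: lt_le_trans den.
suff key : cabs (- (D - h * l) * g z + D * (h * l)) <= e * cabs h * (G ^+ 3 / 2).
  by apply: (le_trans key); rewrite ler_wpM2l// mulr_ge0 ?cabs_ge0// ltW.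
rewrite (le_trans (cabsD _ _))// !cabsM cabsN -/G -/L.
have A : cabs (D - h * l) * G <= e * cabs h * (G ^+ 3 / 4).
  rewrite (le_trans (ler_wpM2r (ltW G0) h2))//.
  by rewrite le_eqVlt; apply/orP; left; apply/eqP; field.
have B : cabs D * (cabs h * L) <= e * cabs h * (G ^+ 3 / 4).
  have L0 : 0 <= L by rewrite cabs_ge0.
  apply: (@le_trans _ _ (e * G ^+ 3 / 4 / (L + 1) * (cabs h * (L + 1)))).
    by rewrite ler_pM// ?mulr_ge0 ?cabs_ge0// ler_wpM2l ?cabs_ge0// lerDl.
  rewrite le_eqVlt; apply/orP; left; apply/eqP; field.
  by rewrite gt_eqF.
by move: A B; lra.
Qed.

Lemma cdiff_div f g z l m : g z != 0 -> cdiff f z l -> cdiff g z m ->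
  cdiff (fun w => f w / g w) z ((l * g z - f z * m) / g z ^+ 2).
Proof.
move=> gz fl gm; apply: cdiff_eq (cdiffM fl (cdiffV gz gm)).
by field.
Qed.

Lemma cdiffX n z : cdiff (fun w => w ^+ n) z (n%:R * z ^+ n.-1).
Proof.
elim: n => [|n IH].
  by rewrite mul0r; apply: (@cdiff_ext (fun=> 1) _ _ _ 1) (cdiff_cst _ _).
apply: (@cdiff_ext (fun w => w * w ^+ n) _ _ _ 1) => // [h _|].
  by rewrite exprS.
apply: cdiff_eq (cdiffM (cdiff_id z) IH).
by case: n {IH} => [|n]; rewrite /= ?expr0; first ring; rewrite exprS -!natr1; ring.
Qed.

(** Complex-valued functions of a real variable are differentiated
    componentwise, because [R[i]] is not a normed module over [R]. *)
Definition rdiff (f : R -> C) (x : R) (l : C) :=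
  is_derive x 1 (fun t => Re (f t) : R) (Re l) /\
  is_derive x 1 (fun t => Im (f t) : R) (Im l).

Lemma rdiffP (f : R -> C) x l :
  (forall e : R, 0 < e -> exists2 d : R, 0 < d & forall h : R, `|h| < d ->
     cabs (f (x + h) - f x - h%:C%C * l) <= e * `|h|) -> rdiff f x l.
Proof.
move=> H; split; apply/is_deriveP => e e0; have [d d0 Hd] := H e e0;
  exists d => // h /Hd; apply: le_trans.
  by rewrite (le_trans _ (cabs_Re _))// !ReD !ReN ReZ.
by rewrite (le_trans _ (cabs_Im _))// !ImD !ImN ImZ.
Qed.

Lemma rdiff_line g p v x l : cdiff g (p + x%:C%C * v) l ->
  rdiff (fun t => g (p + t%:C%C * v)) x (l * v).
Proof.
move=> /cdiffP gl; apply: rdiffP => e e0.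
have c0 : 0 < cabs v + 1 by rewrite ltr_wpDl ?cabs_ge0.
have [d d0 H] := gl (e / (cabs v + 1)) (divr_gt0 e0 c0).
exists (d / (cabs v + 1)); first by rewrite divr_gt0.
move=> h; rewrite ltr_pdivlMr// => hd.
have hv : cabs (h%:C%C * v) <= `|h| * (cabs v + 1).
  by rewrite cabsM cabs_real ler_wpM2l// lerDl.
have := H (h%:C%C * v) (le_lt_trans hv hd).
have -> : p + x%:C%C * v + h%:C%C * v = p + (x + h)%:C%C * v.
  by rewrite rmorphD/= mulrDl addrA.
have -> : h%:C%C * v * l = h%:C%C * (l * v) by ring.
move=> /le_trans; apply.
apply: (le_trans (ler_wpM2l _ hv)); first by rewrite divr_ge0// ltW.
by rewrite mulrCA divfK ?(gt_eqF c0)// mulrC.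
Qed.

Lemma rdiffB f h x l m : rdiff f x l -> rdiff h x m ->
  rdiff (fun t => f t - h t) x (l - m).
Proof.
move=> [f1 f2] [h1 h2]; split.
  have := is_deriveB f1 h1; rewrite -ReN -ReD.
  by congr (is_derive _ _ _ _); apply/funext => t; rewrite /= ReD ReN.
have := is_deriveB f2 h2; rewrite -ImN -ImD.
by congr (is_derive _ _ _ _); apply/funext => t; rewrite /= ImD ImN.
Qed.

Lemma rdiffD f h x l m : rdiff f x l -> rdiff h x m ->
  rdiff (fun t => f t + h t) x (l + m).
Proof.
move=> [f1 f2] [h1 h2]; split.
  have := is_deriveD f1 h1; rewrite -ReD.
  by congr (is_derive _ _ _ _); apply/funext => t; rewrite /= ReD.
have := is_deriveD f2 h2; rewrite -ImD.
by congr (is_derive _ _ _ _); apply/funext => t; rewrite /= ImD.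
Qed.

Lemma rdiffZ c f x l : rdiff f x l -> rdiff (fun t => c * f t) x (c * l).
Proof.
move=> [f1 f2]; split.
  have A := is_deriveB (is_deriveZ (Re c) f1) (is_deriveZ (Im c) f2).
  rewrite ReM; move: A; rewrite /GRing.scale /=.
  by congr (is_derive _ _ _ _); apply/funext => t; rewrite /= ReM.
have A := is_deriveD (is_deriveZ (Re c) f2) (is_deriveZ (Im c) f1).
rewrite ImM; move: A; rewrite /GRing.scale /=.
by congr (is_derive _ _ _ _); apply/funext => t; rewrite /= ImM.
Qed.

Lemma is_derive_continuous (f : R -> R) (x l : R) :
  is_derive x 1 f l -> {for x, continuous f}.
Proof. by case=> H _; apply: differentiable_continuous; apply/derivable1_diffP. Qed.

(** The mean value inequality: rotating by [u] reduces it to a real function, so the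
    vector-valued case needs no mean value equality. *)
Lemma rdiff_Re_le f df (u : C) (a b M : R) : a <= b ->
  (forall x, a <= x <= b -> rdiff f x (df x)) ->
  (forall x, a <= x <= b -> Re (u * df x) <= M) ->
  Re (u * (f b - f a)) <= M * (b - a).
Proof.
move=> ab Hf HM.
have Hd x : a <= x <= b ->
    is_derive x 1 (fun t => Re (u * f t) : R) (Re (u * df x)).
  by move=> /Hf /(rdiffZ u) [].
have [||c] := @MVT_segment R (fun t => Re (u * f t)) (fun t => Re (u * df t)) a b ab.
- by move=> x; rewrite in_itv /= => /andP[ax xb]; apply: Hd; rewrite !ltW.
- apply: continuous_in_subspaceT => x; rewrite inE /= in_itv /= => xab.
  by apply: is_derive_continuous; exact: Hd.
rewrite in_itv /= => cab E.
rewrite mulrBr ReD ReN E ler_wpM2r ?subr_ge0//.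
exact: HM.
Qed.

Lemma rdiff_cabs_le f df (a b M : R) : a <= b ->
  (forall x, a <= x <= b -> rdiff f x (df x)) ->
  (forall x, a <= x <= b -> cabs (df x) <= M) ->
  cabs (f b - f a) <= M * (b - a).
Proof.
move=> ab Hf HM; set D := f b - f a.
have [D0|D0] := eqVneq D 0.
  rewrite D0 cabs0 mulr_ge0 ?subr_ge0//.
  by rewrite (le_trans (cabs_ge0 (df a)))// HM// lexx.
have D1 : cabs D != 0 by rewrite cabs_eq0.
pose u : C := D^*%C / (cabs D)%:C%C.
have cu : cabs u = 1.
  rewrite /u cabsM cabsV cabs_real ger0_norm ?cabs_ge0//.
  have -> : cabs D^*%C = cabs D by rewrite /cabs; case: (D) => p r /=; rewrite sqrrN.
  by rewrite mulfV.
have uD : Re (u * D) = cabs D.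
  have -> : u * D = (cabs D)%:C%C.
    rewrite /u mulrAC (mulrC _ D); apply: (canLR (mulfK _)).

      by rewrite -cabs_eq0 cabs_real normr_eq0.
    rewrite -rmorphM /= -expr2 sqr_cabs; case: (D) => p r /=.
    by apply: complexP => /=; ring.
  by [].
rewrite -uD /D; apply: (rdiff_Re_le ab Hf) => x xab.
rewrite (le_trans (ler_norm _))// (le_trans (cabs_Re _))// cabsM cu mul1r.
exact: HM.
Qed.

(** Antiderivatives differ by a constant, which makes [pint] below independent of the choice. *)
Lemma rdiff_unique_incr f f' df (a b : R) : a <= b ->
  (forall x, a <= x <= b -> rdiff f x (df x)) ->
  (forall x, a <= x <= b -> rdiff f' x (df x)) ->
  f b - f a = f' b - f' a.
Proof.
move=> ab Hf Hf'; apply/eqP; rewrite -subr_eq0 -cabs_eq0 eq_le cabs_ge0 andbT.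
have -> : f b - f a - (f' b - f' a) = (f b - f' b) - (f a - f' a) by ring.
rewrite -(mul0r (b - a)).
apply: (rdiff_cabs_le (f := fun t => f t - f' t) (df := fun=> 0)) => //.
  by move=> x xab; rewrite -(subrr (df x)); apply: rdiffB; [exact: Hf|exact: Hf'].
by move=> x _; rewrite cabs0.
Qed.

End Derivative.

(** * Integrals over segments and rectangles *)

Section SegmentIntegral.
Variable R : realType.
Local Notation C := R[i].
Implicit Types (z w l u : C) (x y a b : R) (g : C -> C) (f : R -> C).

Definition ccont g z := forall e : R, 0 < e ->
  exists2 d : R, 0 < d & forall h, cabs h < d -> cabs (g (z + h) - g z) <= e.

Definition rcont f x := forall e : R, 0 < e ->
  exists2 d : R, 0 < d & forall h : R, `|h| < d -> cabs (f (x + h) - f x) <= e.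

(** The fundamental theorem of calculus, for [f] extended by constants beyond [a] and [b]. *)
Lemma real_primitive (f : R -> R) a b : a <= b ->
  (forall x, a <= x <= b -> forall e : R, 0 < e -> exists2 d : R, 0 < d &
    forall h : R, `|h| < d -> `|f (x + h) - f x| <= e) ->
  exists F : R -> R, forall x, a <= x <= b -> is_derive x 1 F (f x).
Proof.
move=> ab fc.
(* extending f by constants makes the derivative two-sided at the endpoints *)
pose cl x := Num.max a (Num.min x b).
have clI x : a <= cl x <= b by rewrite /cl le_max lexx /= ge_max ab ge_min lexx orbT.
have clE x : a <= x <= b -> cl x = x.
  by move=> /andP[ax xb]; rewrite /cl min_l// max_r.
have clL x y : `|cl x - cl y| <= `|x - y|.
  have n1 := ler_norm (x - y); have := ler_norm (y - x); rewrite distrC => n2.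
  have n0 := normr_ge0 (x - y).
  rewrite /cl ler_norml; apply/andP; split; case: (leP x b) => ?;
    case: (leP y b) => ?; rewrite ?(max_r ab); case: (leP a x) => ?;
    case: (leP a y) => ?; lra.
pose h x := f (cl x).
have hc x : {for x, continuous h}.
  rewrite /continuous_at; apply/cvgrPdist_le => e e0.
  have [d d0 H] := fc _ (clI x) e e0.
  apply/nbhs_ballP; exists d => // y; rewrite /ball /= => xy.
  rewrite distrC /h; have -> : cl y = cl x + (cl y - cl x) by ring.
  by apply: H; apply: le_lt_trans (clL _ _) _; rewrite distrC.
have ih : lebesgue_measure.-integrable `[a - 1, b + 1] (EFin \o h).
  apply: continuous_compact_integrable; first exact: segment_compact.
  by apply: continuous_in_subspaceT => x _; exact: hc.
exists (fun x => \int[lebesgue_measure]_(t in `[a - 1, x]) h t)%R => x xab.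
have [||D1 D2] := @continuous_FTC1_closed R h (a - 1) x (b + 1) _ ih _ (hc x);
  [lra|lra|].
by split=> //; rewrite -derive1E D2 /h clE.
Qed.

Lemma primitive_ex f a b : a <= b -> (forall x, a <= x <= b -> rcont f x) ->
  exists F, forall x, a <= x <= b -> rdiff F x (f x).
Proof.
move=> ab fc.
have [|F1 H1] := @real_primitive (fun t => Re (f t)) a b ab.
  move=> x xab e e0; have [d d0 H] := fc x xab e e0; exists d => // h /H.
  by apply: le_trans; rewrite -ReN -ReD cabs_Re.
have [|F2 H2] := @real_primitive (fun t => Im (f t)) a b ab.
  move=> x xab e e0; have [d d0 H] := fc x xab e e0; exists d => // h /H.
  by apply: le_trans; rewrite -ImN -ImD cabs_Im.
by exists (fun t => F1 t +i* F2 t)%C => x xab; split; [exact: H1|exact: H2].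
Qed.

(** The integral of [f] over the segment from [a] to [b], as the increment of
    an antiderivative. *)
Definition pint f a b : C :=
  let F := xget (fun=> 0) [set F | forall x, a <= x <= b -> rdiff F x (f x)] in
  F b - F a.

Lemma pintE f F a b : a <= b ->
  (forall x, a <= x <= b -> rdiff F x (f x)) -> pint f a b = F b - F a.
Proof.
move=> ab HF; rewrite /pint; case: xgetP => [G _ HG|/(_ F)//].
exact: rdiff_unique_incr ab HG HF.
Qed.

Lemma pint_ext f f' a b : (forall x, a <= x <= b -> f x = f' x) ->
  pint f a b = pint f' a b.
Proof.
move=> E; rewrite /pint.
suff -> : [set F | forall x, a <= x <= b -> rdiff F x (f x)] =
          [set F | forall x, a <= x <= b -> rdiff F x (f' x)] by [].
by apply/seteqP; split=> F H x xab; have := H x xab; rewrite E.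
Qed.

Lemma pint_cat f a b c : a <= c <= b -> (forall x, a <= x <= b -> rcont f x) ->
  pint f a b = pint f a c + pint f c b.
Proof.
move=> /andP[ac cb] fc; have ab := le_trans ac cb.
have [F HF] := primitive_ex ab fc.
rewrite (pintE ab HF) (@pintE _ F a c)// ?(@pintE _ F c b)//.
- by ring.
- by move=> x /andP[cx xb]; apply: HF; rewrite xb (le_trans ac).
by move=> x /andP[ax xc]; apply: HF; rewrite ax (le_trans xc).
Qed.

Lemma pint_le f a b (M : R) : a <= b -> (forall x, a <= x <= b -> rcont f x) ->
  (forall x, a <= x <= b -> cabs (f x) <= M) ->
  cabs (pint f a b) <= M * (b - a).
Proof.
move=> ab fc fM; have [F HF] := primitive_ex ab fc.
by rewrite (pintE ab HF); exact: rdiff_cabs_le HF fM.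
Qed.

Lemma pint_Re_le f a b u (M : R) : a <= b ->
  (forall x, a <= x <= b -> rcont f x) ->
  (forall x, a <= x <= b -> Re (u * f x) <= M) ->
  Re (u * pint f a b) <= M * (b - a).
Proof.
move=> ab fc fM; have [F HF] := primitive_ex ab fc.
by rewrite (pintE ab HF); exact: rdiff_Re_le HF fM.
Qed.

Lemma pintD f f' a b : a <= b -> (forall x, a <= x <= b -> rcont f x) ->
  (forall x, a <= x <= b -> rcont f' x) ->
  pint (fun t => f t + f' t) a b = pint f a b + pint f' a b.
Proof.
move=> ab fc fc'; have [F HF] := primitive_ex ab fc.
have [F' HF'] := primitive_ex ab fc'.
rewrite (pintE ab HF) (pintE ab HF') (@pintE _ (fun t => F t + F' t))//.
  by ring.
by move=> x xab; apply: rdiffD; [exact: HF|exact: HF'].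
Qed.

Lemma pintZ u f a b : a <= b -> (forall x, a <= x <= b -> rcont f x) ->
  pint (fun t => u * f t) a b = u * pint f a b.
Proof.
move=> ab fc; have [F HF] := primitive_ex ab fc.
rewrite (pintE ab HF) (@pintE _ (fun t => u * F t))//; first by ring.
by move=> x xab; apply: rdiffZ; exact: HF.
Qed.

Lemma rcont_bounded f a b : a <= b -> (forall x, a <= x <= b -> rcont f x) ->
  exists M : R, forall x, a <= x <= b -> cabs (f x) <= M.
Proof.
move=> ab fc.
have [|c _ Hc] := @EVT_max R (fun t => cabs (f t)) a b ab.
  apply: continuous_in_subspaceT => x; rewrite inE /= in_itv /= => xab.
  rewrite /continuous_at; apply/cvgrPdist_le => e e0.
  have [d d0 H] := fc _ xab e e0.
  apply/nbhs_ballP; exists d => // y; rewrite /ball /= => xy.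
  have := H (y - x); rewrite distrC => /(_ xy).
  have -> : x + (y - x) = y by ring.
  have := ler_cabsB (f x) (f y); rewrite cabsBC.
  have := ler_cabsB (f y) (f x); rewrite ler_norml => *.
  by apply/andP; split; lra.
by exists (cabs (f c)) => x xab; apply: Hc; rewrite in_itv.
Qed.

End SegmentIntegral.

Section RectangleIntegral.
Variable R : realType.
Local Notation C := R[i].
Implicit Types (z w l u : C) (x y a b : R) (g : C -> C).

Definition cpt x y : C := x%:C%C + y%:C%C * 'i%C.

Lemma cptE z : z = cpt (Re z) (Im z).
Proof. by rewrite /cpt mulrC -complexE. Qed.
Lemma Re_cpt x y : Re (cpt x y) = x.
Proof. by rewrite /cpt ReD ReZ /= mulr0 addr0. Qed.
Lemma Im_cpt x y : Im (cpt x y) = y.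
Proof. by rewrite /cpt ImD ImZ /= mulr1 add0r. Qed.

Lemma ccont_cdiff g z l : cdiff g z l -> ccont g z.
Proof. exact: cdiff_cont. Qed.

Lemma ccontD f g z : ccont f z -> ccont g z -> ccont (fun w => f w + g w) z.
Proof.
move=> fc gc e e0; have e2 : 0 < e / 2 by lra.
have [d1 d10 H1] := fc _ e2; have [d2 d20 H2] := gc _ e2.
exists (Num.min d1 d2) => [|h]; first by rewrite lt_min d10.
rewrite lt_min => /andP[/H1 h1 /H2 h2].
have -> : f (z + h) + g (z + h) - (f z + g z) =
  (f (z + h) - f z) + (g (z + h) - g z) by ring.
by have := cabsD (f (z + h) - f z) (g (z + h) - g z); lra.
Qed.

Lemma ccontZ u g z : ccont g z -> ccont (fun w => u * g w) z.
Proof.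
move=> gc e e0; have c0 : 0 < cabs u + 1 by rewrite ltr_wpDl ?cabs_ge0.
have [d d0 H] := gc _ (divr_gt0 e0 c0); exists d => // h /H.
rewrite ler_pdivlMr// => H1; rewrite -mulrBr cabsM.
apply: le_trans H1; rewrite mulrC ler_wpM2l ?cabs_ge0// lerDl//.
Qed.

Lemma rcont_h g x y : ccont g (cpt x y) -> rcont (fun t => g (cpt t y)) x.
Proof.
move=> gc e e0; have [d d0 H] := gc e e0; exists d => // h hd.
have -> : cpt (x + h) y = cpt x y + h%:C%C by rewrite /cpt rmorphD /=; ring.
by apply: H; rewrite cabs_real.
Qed.

Lemma rcont_v g x y : ccont g (cpt x y) -> rcont (fun t => g (cpt x t)) y.
Proof.
move=> gc e e0; have [d d0 H] := gc e e0; exists d => // h hd.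
have -> : cpt x (y + h) = cpt x y + h%:C%C * 'i%C.
  by rewrite /cpt rmorphD /=; ring.
by apply: H; rewrite cabsM cabs_real cabs_i mulr1.
Qed.

Lemma rdiff_h g x y l : cdiff g (cpt x y) l -> rdiff (fun t => g (cpt t y)) x l.
Proof.
move=> H; have := @rdiff_line R g (y%:C%C * 'i%C) 1 x l; rewrite !mulr1.
rewrite addrC -/(cpt x y) => /(_ H).
by congr (rdiff _ _ _); apply/funext => t; rewrite mulr1 addrC.
Qed.

Lemma rdiff_v g x y l :
  cdiff g (cpt x y) l -> rdiff (fun t => g (cpt x t)) y (l * 'i%C).
Proof. exact: rdiff_line. Qed.

(** The integral along the boundary of the rectangle, counterclockwise. *)
Definition Rect g x1 x2 y1 y2 : C :=
  pint (fun t => g (cpt t y1)) x1 x2 + 'i%C * pint (fun t => g (cpt x2 t)) y1 y2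
  - pint (fun t => g (cpt t y2)) x1 x2 - 'i%C * pint (fun t => g (cpt x1 t)) y1 y2.

Definition on_rect (P : C -> Prop) x1 x2 y1 y2 :=
  forall x y, x1 <= x <= x2 -> y1 <= y <= y2 -> P (cpt x y).

Definition on_edges (P : C -> Prop) x1 x2 y1 y2 :=
  (forall t, x1 <= t <= x2 -> P (cpt t y1) /\ P (cpt t y2)) /\
  (forall t, y1 <= t <= y2 -> P (cpt x1 t) /\ P (cpt x2 t)).

Lemma on_rect_edges P x1 x2 y1 y2 : x1 <= x2 -> y1 <= y2 ->
  on_rect P x1 x2 y1 y2 -> on_edges P x1 x2 y1 y2.
Proof. by move=> x12 y12 H; split=> t ?; split; apply: H => //; rewrite lexx ?x12 ?y12. Qed.

Lemma on_edges_impl (P Q : C -> Prop) x1 x2 y1 y2 : (forall z, P z -> Q z) ->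
  on_edges P x1 x2 y1 y2 -> on_edges Q x1 x2 y1 y2.
Proof.
by move=> PQ [H1 H2]; split=> t => [/H1|/H2] [? ?]; split; exact: PQ.
Qed.

Section Fixed.
Variables x1 x2 y1 y2 : R.
Hypotheses (x12 : x1 <= x2) (y12 : y1 <= y2).

Lemma rect_ext g g' : on_edges (fun z => g z = g' z) x1 x2 y1 y2 ->
  Rect g x1 x2 y1 y2 = Rect g' x1 x2 y1 y2.
Proof.
case=> H1 H2; rewrite /Rect.
rewrite (@pint_ext _ (fun t => g (cpt t y1)) (fun t => g' (cpt t y1))); last by move=> t /H1 [].
rewrite (@pint_ext _ (fun t => g (cpt t y2)) (fun t => g' (cpt t y2))); last by move=> t /H1 [].
rewrite (@pint_ext _ (fun t => g (cpt x2 t)) (fun t => g' (cpt x2 t))); last by move=> t /H2 [].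
by rewrite (@pint_ext _ (fun t => g (cpt x1 t)) (fun t => g' (cpt x1 t)));
  last by move=> t /H2 [].
Qed.

Lemma rectD g g' : on_edges (ccont g) x1 x2 y1 y2 ->
  on_edges (ccont g') x1 x2 y1 y2 ->
  Rect (fun z => g z + g' z) x1 x2 y1 y2 = Rect g x1 x2 y1 y2 + Rect g' x1 x2 y1 y2.
Proof.
case=> H1 H2 [H1' H2']; rewrite /Rect.
have hE y : (forall t, x1 <= t <= x2 -> ccont g (cpt t y) /\ ccont g' (cpt t y)) ->
    pint (fun t => g (cpt t y) + g' (cpt t y)) x1 x2 =
    pint (fun t => g (cpt t y)) x1 x2 + pint (fun t => g' (cpt t y)) x1 x2.
  by move=> H; apply: pintD => // t /H [] *; apply: rcont_h.
have vE x : (forall t, y1 <= t <= y2 -> ccont g (cpt x t) /\ ccont g' (cpt x t)) ->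
    pint (fun t => g (cpt x t) + g' (cpt x t)) y1 y2 =
    pint (fun t => g (cpt x t)) y1 y2 + pint (fun t => g' (cpt x t)) y1 y2.
  by move=> H; apply: pintD => // t /H [] *; apply: rcont_v.
rewrite !hE ?vE; [ring| | | |].
- by move=> t ht; case: (H2 t ht) (H2' t ht) => ? ? [].
- by move=> t ht; case: (H2 t ht) (H2' t ht) => ? ? [].
- by move=> t ht; case: (H1 t ht) (H1' t ht) => ? ? [].
- by move=> t ht; case: (H1 t ht) (H1' t ht) => ? ? [].
Qed.

Lemma rectZ u g : on_edges (ccont g) x1 x2 y1 y2 ->
  Rect (fun z => u * g z) x1 x2 y1 y2 = u * Rect g x1 x2 y1 y2.
Proof.
case=> H1 H2; rewrite /Rect.
have hE y : (forall t, x1 <= t <= x2 -> ccont g (cpt t y)) ->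
    pint (fun t => u * g (cpt t y)) x1 x2 = u * pint (fun t => g (cpt t y)) x1 x2.
  by move=> H; apply: pintZ => // t /H *; apply: rcont_h.
have vE x : (forall t, y1 <= t <= y2 -> ccont g (cpt x t)) ->
    pint (fun t => u * g (cpt x t)) y1 y2 = u * pint (fun t => g (cpt x t)) y1 y2.
  by move=> H; apply: pintZ => // t /H *; apply: rcont_v.
rewrite !hE ?vE; [ring| | | |]; by move=> t ht; (case: (H1 t ht) + case: (H2 t ht)).
Qed.

Lemma rect_le g (M : R) : on_edges (ccont g) x1 x2 y1 y2 ->
  on_edges (fun z => cabs (g z) <= M) x1 x2 y1 y2 ->
  cabs (Rect g x1 x2 y1 y2) <= M * (2 * (x2 - x1) + 2 * (y2 - y1)).
Proof.
case=> H1 H2 [M1 M2]; rewrite /Rect.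
have A1 : cabs (pint (fun t => g (cpt t y1)) x1 x2) <= M * (x2 - x1).
  by apply: pint_le => // t ht; [apply: rcont_h; case: (H1 t ht)|case: (M1 t ht)].
have A2 : cabs (pint (fun t => g (cpt t y2)) x1 x2) <= M * (x2 - x1).
  by apply: pint_le => // t ht; [apply: rcont_h; case: (H1 t ht)|case: (M1 t ht)].
have A3 : cabs (pint (fun t => g (cpt x1 t)) y1 y2) <= M * (y2 - y1).
  by apply: pint_le => // t ht; [apply: rcont_v; case: (H2 t ht)|case: (M2 t ht)].
have A4 : cabs (pint (fun t => g (cpt x2 t)) y1 y2) <= M * (y2 - y1).
  by apply: pint_le => // t ht; [apply: rcont_v; case: (H2 t ht)|case: (M2 t ht)].
rewrite (le_trans (cabsB _ _))// (le_trans (lerD (cabsB _ _) (lexx _)))//.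
rewrite (le_trans (lerD (lerD (cabsD _ _) (lexx _)) (lexx _)))//.
rewrite !cabsM cabs_i !mul1r.
by move: A1 A2 A3 A4; lra.
Qed.

(** On each edge the integral is an increment of [G], and the four increments cancel. *)
Lemma rect_prim g G :
  on_edges (fun z => cdiff G z (g z)) x1 x2 y1 y2 -> Rect g x1 x2 y1 y2 = 0.
Proof.
case=> H1 H2; rewrite /Rect.
rewrite (@pintE _ _ (fun t => G (cpt t y1)))//; last first.
  by move=> t ht; apply: rdiff_h; case: (H1 t ht).
rewrite (@pintE _ (fun t => g (cpt t y2)) (fun t => G (cpt t y2)))//; last first.
  by move=> t ht; apply: rdiff_h; case: (H1 t ht).
have ii : - 'i%C * 'i%C = 1 :> C by rewrite mulNr -expr2 sqr_i opprK.
have V x : (forall t, y1 <= t <= y2 -> cdiff G (cpt x t) (g (cpt x t))) ->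
    'i%C * pint (fun t => g (cpt x t)) y1 y2 = G (cpt x y2) - G (cpt x y1).
  move=> H; rewrite (@pintE _ _ (fun t => - 'i%C * G (cpt x t)))//.
    by rewrite -mulrBr mulrA mulrN -mulNr ii mul1r.
  move=> t ht; have := rdiffZ (- 'i%C) (rdiff_v (H t ht)).
  by rewrite mulrCA ii mulr1.
rewrite !V; [ring| |]; by move=> t ht; case: (H2 t ht).
Qed.

End Fixed.

Lemma rect_splitx g x1 m x2 y1 y2 : x1 <= m <= x2 -> y1 <= y2 ->
  on_rect (ccont g) x1 x2 y1 y2 ->
  Rect g x1 x2 y1 y2 = Rect g x1 m y1 y2 + Rect g m x2 y1 y2.
Proof.
move=> xm y12 gc; rewrite /Rect.
rewrite (@pint_cat _ (fun t => g (cpt t y1)) _ _ m)//; last first.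
  by move=> t ht; apply: rcont_h; apply: gc; rewrite ?lexx.
rewrite (@pint_cat _ (fun t => g (cpt t y2)) _ _ m)//; last first.
  by move=> t ht; apply: rcont_h; apply: gc; rewrite ?lexx ?y12.
by ring.
Qed.

Lemma rect_splity g x1 x2 y1 m y2 : x1 <= x2 -> y1 <= m <= y2 ->
  on_rect (ccont g) x1 x2 y1 y2 ->
  Rect g x1 x2 y1 y2 = Rect g x1 x2 y1 m + Rect g x1 x2 m y2.
Proof.
move=> x12 ym gc; rewrite /Rect.
rewrite (@pint_cat _ (fun t => g (cpt x1 t)) _ _ m)//; last first.
  by move=> t ht; apply: rcont_v; apply: gc; rewrite ?lexx.
rewrite (@pint_cat _ (fun t => g (cpt x2 t)) _ _ m)//; last first.
  by move=> t ht; apply: rcont_v; apply: gc; rewrite ?lexx ?x12.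
by ring.
Qed.

Lemma on_rect_sub P x1 x2 y1 y2 x1' x2' y1' y2' :
  x1 <= x1' -> x2' <= x2 -> y1 <= y1' -> y2' <= y2 ->
  on_rect P x1 x2 y1 y2 -> on_rect P x1' x2' y1' y2'.
Proof. by move=> ? ? ? ? H x y ? ?; apply: H; lra. Qed.

End RectangleIntegral.

(** * Goursat's theorem *)

Section CauchyTheory.
Variable R : realType.
Local Notation C := R[i].
Implicit Types (z w l u : C) (x y a b : R) (g : C -> C).

(** The four quarters sum to the whole, so one of them carries at least a quarter of the modulus. *)
Lemma quadrisection g x1 x2 y1 y2 : x1 <= x2 -> y1 <= y2 ->
  on_rect (ccont g) x1 x2 y1 y2 ->
  exists x1' x2' y1' y2' : R, [/\ x1 <= x1', x2' <= x2, y1 <= y1' & y2' <= y2] /\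
    [/\ x2' - x1' = (x2 - x1) / 2, y2' - y1' = (y2 - y1) / 2 &
     cabs (Rect g x1 x2 y1 y2) <= 4 * cabs (Rect g x1' x2' y1' y2')].
Proof.
move=> x12 y12 gc; pose xm := (x1 + x2) / 2; pose ym := (y1 + y2) / 2.
pose A := cabs (Rect g x1 x2 y1 y2).
have [H1|H1] := leP A (4 * cabs (Rect g x1 xm y1 ym)).
  by exists x1, xm, y1, ym; split; split=> //; rewrite /xm /ym; lra.
have [H2|H2] := leP A (4 * cabs (Rect g x1 xm ym y2)).
  by exists x1, xm, ym, y2; split; split=> //; rewrite /xm /ym; lra.
have [H3|H3] := leP A (4 * cabs (Rect g xm x2 y1 ym)).
  by exists xm, x2, y1, ym; split; split=> //; rewrite /xm /ym; lra.
have [H4|H4] := leP A (4 * cabs (Rect g xm x2 ym y2)).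
  by exists xm, x2, ym, y2; split; split=> //; rewrite /xm /ym; lra.
suff : A < A by rewrite ltxx.
have xm1 : x1 <= xm by rewrite /xm ler_pdivlMr//; lra.
have xm2 : xm <= x2 by rewrite /xm ler_pdivrMr//; lra.
have ym1 : y1 <= ym by rewrite /ym ler_pdivlMr//; lra.
have ym2 : ym <= y2 by rewrite /ym ler_pdivrMr//; lra.
have E : Rect g x1 x2 y1 y2 =
  (Rect g x1 xm y1 ym + Rect g x1 xm ym y2) +
  (Rect g xm x2 y1 ym + Rect g xm x2 ym y2).
  rewrite (@rect_splitx _ _ _ xm)//; last by rewrite xm1.
  rewrite (@rect_splity _ _ x1 _ y1 ym)//; last 2 first.
    by rewrite ym1.
    by apply: on_rect_sub gc; lra.
  rewrite (@rect_splity _ _ xm x2 y1 ym)//; first by rewrite ym1.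
  by apply: on_rect_sub gc; lra.
rewrite {1}/A E {E}; apply: le_lt_trans (cabsD _ _) _.
have := cabsD (Rect g x1 xm y1 ym) (Rect g x1 xm ym y2).
have := cabsD (Rect g xm x2 y1 ym) (Rect g xm x2 ym y2).
by move: H1 H2 H3 H4; lra.
Qed.

(** After [n] steps the integral has lost at most a factor [4 ^ n], the square of the factor
    lost by the diameter: an integral of order smaller than the area is contradictory. *)
Lemma nested_rects g x1 x2 y1 y2 : x1 <= x2 -> y1 <= y2 ->
  on_rect (ccont g) x1 x2 y1 y2 ->
  exists s : nat -> (R * R) * (R * R), forall n,
    let: ((a1, a2), (b1, b2)) := s n in
    [/\ x1 <= a1, a2 <= x2, y1 <= b1 & b2 <= y2] /\
    [/\ a2 - a1 = (x2 - x1) / 2 ^+ n, b2 - b1 = (y2 - y1) / 2 ^+ n,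
        cabs (Rect g x1 x2 y1 y2) <= 4 ^+ n * cabs (Rect g a1 a2 b1 b2) &
        let: ((a1', a2'), (b1', b2')) := s n.+1 in
        [/\ a1 <= a1', a2' <= a2, b1 <= b1' & b2' <= b2]].
Proof.
move=> x12 y12 gc.
pose val (s : (R * R) * (R * R)) := let: ((a1, a2), (b1, b2)) := s in
  [/\ x1 <= a1, a2 <= x2, y1 <= b1 & b2 <= y2] /\ a1 <= a2 /\ b1 <= b2.
pose rel (s s' : (R * R) * (R * R)) := let: ((a1, a2), (b1, b2)) := s in
  let: ((a1', a2'), (b1', b2')) := s' in
  [/\ a1 <= a1', a2' <= a2, b1 <= b1' & b2' <= b2] /\
    [/\ a2' - a1' = (a2 - a1) / 2, b2' - b1' = (b2 - b1) / 2 &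
     cabs (Rect g a1 a2 b1 b2) <= 4 * cabs (Rect g a1' a2' b1' b2')].
have [|F HF] := @choice _ _ (fun s s' => val s -> rel s s').
  move=> [[a1 a2] [b1 b2]].
  have [[[A1 A2 A3 A4] [A5 A6]]|nv] := pselect (val ((a1, a2), (b1, b2))); last first.
    by exists ((a1, a2), (b1, b2)) => /nv.
  have [|a1' [a2' [b1' [b2' H]]]] := quadrisection A5 A6 (g := g).
    exact: on_rect_sub gc.
  by exists ((a1', a2'), (b1', b2')).
pose s n := iter n F ((x1, x2), (y1, y2)); exists s.
have vs n : val (s n).
  elim: n => [|n IH]; first by rewrite /s /= !lexx.
  have := HF _ IH; rewrite /s /= -/(s n).
  case: (s n) IH => [[a1 a2] [b1 b2]] [[A1 A2 A3 A4] [A5 A6]].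
  case: (F _) => [[a1' a2'] [b1' b2']] [[B1 B2 B3 B4] [B5 B6 _]].
  by split; [split|]; lra.
have vn n : let: ((a1, a2), (b1, b2)) := s n in
    [/\ a2 - a1 = (x2 - x1) / 2 ^+ n, b2 - b1 = (y2 - y1) / 2 ^+ n &
        cabs (Rect g x1 x2 y1 y2) <= 4 ^+ n * cabs (Rect g a1 a2 b1 b2)].
  elim: n => [|n IH].
    by rewrite /s /= !expr0 !divr1 mul1r.
  have := HF _ (vs n); move: IH; rewrite /s /= -/(s n).
  case: (s n) => [[a1 a2] [b1 b2]] [I1 I2 I3].
  case: (F _) => [[a1' a2'] [b1' b2']] [_ [-> -> H]].
  rewrite I1 I2 -!mulrA -!invfM -!exprSr; split=> //.
  apply: (le_trans I3); rewrite exprSr -mulrA ler_wpM2l// exprn_ge0//.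
move=> n; have := HF _ (vs n); have := vn n; have := vs n.
rewrite -/(s n) [s n.+1]/s /= -/(s n).
case: (s n) => [[a1 a2] [b1 b2]] [A1 _] [B1 B2 B3].
by case: (F _) => [[a1' a2'] [b1' b2']] [].
Qed.

Lemma nested_point (l r : nat -> R) : (forall n, l n <= r n) ->
  (forall n, l n <= l n.+1) -> (forall n, r n.+1 <= r n) ->
  exists p, forall n, l n <= p <= r n.
Proof.
move=> lr li rd.
have lm m n : (m <= n)%N -> l m <= l n.
  by move/subnKC <-; elim: (n - m)%N => [|k IH]; rewrite ?addn0// addnS (le_trans IH).
have rm m n : (m <= n)%N -> r n <= r m.
  by move/subnKC <-; elim: (n - m)%N => [|k IH]; rewrite ?addn0// addnS (le_trans (rd _)).
have ub n : ubound (range l) (r n).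
  move=> _ [m _ <-]; have [mn|/ltnW nm] := leqP m n.
    exact: le_trans (lm _ _ mn) (lr n).
  exact: le_trans (lr m) (rm _ _ nm).
exists (sup (range l)) => n; apply/andP; split.
  by apply: ub_le_sup; [exists (r 0%N); exact: ub|exists n].
by apply: sup_le_ub; [exists (l 0%N), 0%N|exact: ub].
Qed.

Lemma rect_affine (c d : C) p x1 x2 y1 y2 : x1 <= x2 -> y1 <= y2 ->
  Rect (fun z => c + (z - p) * d) x1 x2 y1 y2 = 0.
Proof.
move=> x12 y12.
apply: (rect_prim x12 y12 (G := fun z => c * z + (z - p) * (z - p) * (d / 2))).
apply: on_rect_edges => // x y _ _; set z := cpt x y.
have D1 : cdiff (fun w => w - p) z 1.
  by apply: cdiff_eq (cdiffB (cdiff_id _) (cdiff_cst _ _)); rewrite subr0.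
have := cdiffD (cdiffM (cdiff_cst c z) (cdiff_id z))
   (cdiffM (cdiffM D1 D1) (cdiff_cst (d / 2) z)).
by apply: cdiff_eq; field.
Qed.

Lemma ex_expn2_gt (B : R) : exists n, B < 2 ^+ n.
Proof.
exists (Num.truncn B).+1; rewrite -natrX.
have [B0|B0] := ltP B 0; first by apply: lt_le_trans B0 _.
apply: lt_le_trans (truncnS_gt B) _.
by rewrite ler_nat ltnW// ltn_expl.
Qed.

(** Goursat: quadrisecting a rectangle on which the integral is not 0 leads to
    a point near which the function fails to be affine to first order. *)
Theorem goursat g x1 x2 y1 y2 : x1 <= x2 -> y1 <= y2 ->
  on_rect (fun z => exists l, cdiff g z l) x1 x2 y1 y2 -> Rect g x1 x2 y1 y2 = 0.
Proof.
move=> x12 y12 gd.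
have gc : on_rect (ccont g) x1 x2 y1 y2.
  by move=> x y hx hy; have [l /ccont_cdiff] := gd x y hx hy.
have [s Hs] := nested_rects x12 y12 gc.
pose W := (x2 - x1) + (y2 - y1).
have W0 : 0 <= W by rewrite /W; lra.
have two n : 0 < (2 : R) ^+ n by rewrite exprn_gt0.
have [px Hpx] : exists p, forall n, (s n).1.1 <= p <= (s n).1.2.
  apply: nested_point => n; have := Hs n;
    case: (s n) => [[a1 a2] [b1 b2]]; case: (s n.+1) => [[a1' a2'] [b1' b2']] /=.
  - move=> [_ [A _ _ _]]; rewrite -subr_ge0 A divr_ge0// ?(ltW (two _))//; lra.
  - by case=> _ [_ _ _ []].
  - by case=> _ [_ _ _ []].
have [py Hpy] : exists p, forall n, (s n).2.1 <= p <= (s n).2.2.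
  apply: nested_point => n; have := Hs n;
    case: (s n) => [[a1 a2] [b1 b2]]; case: (s n.+1) => [[a1' a2'] [b1' b2']] /=.
  - move=> [_ [_ A _ _]]; rewrite -subr_ge0 A divr_ge0// ?(ltW (two _))//; lra.
  - by case=> _ [_ _ _ []].
  - by case=> _ [_ _ _ []].
apply: cabs_small0 => e e0.
have [l gl] : exists l, cdiff g (cpt px py) l.
  apply: gd; [have := Hpx 0%N|have := Hpy 0%N]; have := Hs 0%N;
    case: (s 0%N) => [[a1 a2] [b1 b2]]; case: (s 1%N) => [[? ?] [? ?]] /=;
    by case=> [[? ? ? ?] _] /andP[? ?]; apply/andP; split; lra.
have W1 : 0 < 2 * W ^+ 2 + 1 by rewrite ltr_wpDl// mulr_ge0// sqr_ge0.
have /cdiffP := gl; move=> /(_ (e / (2 * W ^+ 2 + 1)) (divr_gt0 e0 W1)).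
set e' := e / _; move=> [d d0 Hd].
have [n] := ex_expn2_gt (W / d); rewrite ltr_pdivrMr// => Wn.
have := Hs n; have := Hpx n; have := Hpy n.
case: (s n) => [[a1 a2] [b1 b2]]; case: (s n.+1) => [[? ?] [? ?]] /=.
move=> /andP[pb1 pb2] /andP[pa1 pa2] [[A1 A2 A3 A4] [A5 A6 A7 _]].
have a12 : a1 <= a2 by lra.
have b12 : b1 <= b2 by lra.
set z0 := cpt px py in gl Hd.
pose D := W / 2 ^+ n.
have DE : D = (a2 - a1) + (b2 - b1) by rewrite /D A5 A6 -mulrDl.
have Dd : D < d by rewrite /D ltr_pdivrMr// mulrC.
pose af z := g z0 + (z - z0) * l.
have afc : on_edges (ccont af) a1 a2 b1 b2.
  apply: on_rect_edges => // x y _ _; apply: (@ccont_cdiff _ _ _ (0 + (0 + l))).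
  rewrite /af; apply: cdiffD (cdiff_cst _ _) _.
  have := cdiffM (cdiffB (cdiff_id (cpt x y)) (cdiff_cst z0 _)) (cdiff_cst l _).
  by apply: cdiff_eq; ring.
have gc' : on_edges (ccont g) a1 a2 b1 b2.
  by apply: on_rect_edges => //; exact: on_rect_sub gc.
have rc : on_edges (ccont (fun z => g z + -1 * af z)) a1 a2 b1 b2.
  case: afc gc' => [c1 c2] [c3 c4]; split=> t ht;
   [case: (c1 t ht) (c3 t ht) => ? ? [? ?]|case: (c2 t ht) (c4 t ht) => ? ? [? ?]];
   split; apply: ccontD => //; exact: ccontZ.
have E : Rect g a1 a2 b1 b2 = Rect (fun z => g z + -1 * af z) a1 a2 b1 b2.
  rewrite rectD//; last first.
    by apply: on_edges_impl afc => z; apply: ccontZ.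
  by rewrite rectZ// /af rect_affine// mulr0 addr0.
have K : cabs (Rect g a1 a2 b1 b2) <= e' * D * (2 * D).
  rewrite E {E}; have -> : 2 * D = 2 * (a2 - a1) + 2 * (b2 - b1) by rewrite DE; ring.
  apply: rect_le => //; apply: on_rect_edges => // x y /andP[hx1 hx2] /andP[hy1 hy2].
  set z := cpt x y.
  have zD : cabs (z - z0) <= D.
    rewrite (le_trans (cabs_le _))// DE lerD//.
      rewrite ReD ReN !Re_cpt ler_norml; apply/andP; split; lra.
    rewrite ImD ImN !Im_cpt ler_norml; apply/andP; split; lra.
  have := Hd (z - z0) (le_lt_trans zD Dd).
  have -> : z0 + (z - z0) = z by ring.
  have -> : g z + -1 * af z = g z - g z0 - (z - z0) * l by rewrite /af; ring.
  move=> /le_trans; apply; rewrite ler_wpM2l// divr_ge0 ?ltW//.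
rewrite (le_trans A7)//.
apply: (@le_trans _ _ (4 ^+ n * (e' * D * (2 * D)))).
  by rewrite ler_wpM2l// exprn_ge0.
have -> : 4 ^+ n * (e' * D * (2 * D)) = e' * (2 * W ^+ 2).
  have -> : (4 : R) ^+ n = 2 ^+ n * 2 ^+ n by rewrite -exprMn; congr (_ ^+ _); ring.
  by rewrite /D; field; rewrite gt_eqF.
rewrite /e' mulrAC ler_pdivrMr// ler_wpM2l ?ltW//.
by rewrite ltrDl.
Qed.

(** Goursat still holds with one exceptional point of continuity: cut away all
    but a small square around that point. *)
Lemma goursat_point g a x0 y0 : - a < x0 < a -> - a < y0 < a ->
  on_rect (ccont g) (- a) a (- a) a ->
  on_rect (fun z => z != cpt x0 y0 -> exists l, cdiff g z l) (- a) a (- a) a ->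
  Rect g (- a) a (- a) a = 0.
Proof.
move=> /andP[xa1 xa2] /andP[ya1 ya2] gc gd.
have gz : ccont g (cpt x0 y0) by apply: gc; apply/andP; split; lra.
have [d d0 Hd] := gz 1 ltr01.
pose M := cabs (g (cpt x0 y0)) + 1.
have M0 : 0 < M by rewrite /M ltr_wpDl ?cabs_ge0.
apply: cabs_small0 => e e0.
pose h := Num.min (Num.min (Num.min (x0 + a) (a - x0)) (Num.min (y0 + a) (a - y0)))
            (Num.min (d / 3) (e / (8 * M))).
have h0 : 0 < h.
  rewrite /h !lt_min; do ?(apply/andP; split); try lra.
  by rewrite divr_gt0// mulr_gt0.
have : h <= h by []; rewrite {2}/h !le_min => /andP[/andP[/andP[h1 h2] /andP[h3 h4]] /andP[h5]].
rewrite ler_pdivlMr ?mulr_gt0// => h6.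
have Z x1 x2 y1 y2 : - a <= x1 -> x1 <= x2 -> x2 <= a -> - a <= y1 -> y1 <= y2 ->
    y2 <= a -> (forall x y, x1 <= x <= x2 -> y1 <= y <= y2 -> x = x0 -> y = y0 -> False) ->
    Rect g x1 x2 y1 y2 = 0.
  move=> ? ? ? ? ? ? H; apply: goursat => // x y hx hy; apply: gd; [lra|lra|].
  apply/eqP => E; apply: (H x y) => //.
    by rewrite -(Re_cpt x y) E Re_cpt.
  by rewrite -(Im_cpt x y) E Im_cpt.
have sub x1 x2 y1 y2 : - a <= x1 -> x2 <= a -> - a <= y1 -> y2 <= a ->
    on_rect (ccont g) x1 x2 y1 y2.
  by move=> ? ? ? ?; exact: on_rect_sub gc.
rewrite (@rect_splitx _ _ _ (x0 - h)); [|lra|lra|by []].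
rewrite (Z (- a) (x0 - h)); [|lra..|by move=> x y ? ? ? ?; lra].
rewrite add0r (@rect_splitx _ _ _ (x0 + h)); [|lra|lra|by apply: sub; lra].
rewrite (Z (x0 + h) a); [|lra..|by move=> x y ? ? ? ?; lra].
rewrite addr0 (@rect_splity _ _ _ _ _ (y0 - h)); [|lra|lra|by apply: sub; lra].
rewrite (Z _ _ (- a) (y0 - h)); [|lra..|by move=> x y ? ? ? ?; lra].
rewrite add0r (@rect_splity _ _ _ _ _ (y0 + h)); [|lra|lra|by apply: sub; lra].
rewrite (Z _ _ (y0 + h) a); [|lra..|by move=> x y ? ? ? ?; lra].
rewrite addr0.
have x12 : x0 - h <= x0 + h by lra.
have y12 : y0 - h <= y0 + h by lra.
apply: (@le_trans _ _ (M * (2 * (x0 + h - (x0 - h)) + 2 * (y0 + h - (y0 - h)))));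
  last by move: h6; lra.
apply: rect_le => //; first by apply: on_rect_edges => //; apply: sub; lra.
apply: on_rect_edges => // x y hx hy.
have := Hd (cpt x y - cpt x0 y0).
have -> : cpt x0 y0 + (cpt x y - cpt x0 y0) = cpt x y by ring.
move=> H1.
have := ler_cabsB (g (cpt x y)) (g (cpt x0 y0)).
suff /H1 : cabs (cpt x y - cpt x0 y0) < d by rewrite /M; lra.
apply: le_lt_trans (cabs_le _) _.
rewrite ReD ReN !Re_cpt ImD ImN !Im_cpt.
have : `|x - x0| <= h by rewrite ler_norml; apply/andP; split; lra.
have : `|y - y0| <= h by rewrite ler_norml; apply/andP; split; lra.
by lra.
Qed.

End CauchyTheory.

(** * Limits and power series *)

Section Limits.
Variable R : realType.
Local Notation C := R[i].
Implicit Types (z w l u : C) (x y a b : R) (s t : nat -> C).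

Definition clim s l :=
  forall e : R, 0 < e -> exists N, forall n, (N <= n)%N -> cabs (s n - l) <= e.

Lemma clim_unique s l l' : clim s l -> clim s l' -> l = l'.
Proof.
move=> H H'; apply/eqP; rewrite -subr_eq0; apply/eqP/cabs_small0 => e e0.
have e2 : 0 < e / 2 by lra.
have [N HN] := H _ e2; have [N' HN'] := H' _ e2.
have := HN _ (leq_maxl N N'); have := HN' _ (leq_maxr N N').
set n := maxn N N'; rewrite [in X in _ -> X -> _]cabsBC => h1 h2.
have := ler_cabsBD l l' (s n); lra.
Qed.

Lemma clim_cst l : clim (fun=> l) l.
Proof. by move=> e e0; exists 0%N => n _; rewrite subrr cabs0 ltW. Qed.

Lemma climD s t l m : clim s l -> clim t m -> clim (fun n => s n + t n) (l + m).
Proof.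
move=> H H' e e0; have e2 : 0 < e / 2 by lra.
have [N HN] := H _ e2; have [N' HN'] := H' _ e2.
exists (maxn N N') => n; rewrite geq_max => /andP[/HN h1 /HN' h2].
have -> : s n + t n - (l + m) = (s n - l) + (t n - m) by ring.
have := cabsD (s n - l) (t n - m); lra.
Qed.

Lemma climZ u s l : clim s l -> clim (fun n => u * s n) (u * l).
Proof.
move=> H e e0; have c0 : 0 < cabs u + 1 by rewrite ltr_wpDl ?cabs_ge0.
have [N HN] := H _ (divr_gt0 e0 c0).
exists N => n /HN; rewrite ler_pdivlMr// -mulrBr cabsM mulrC => h.
by apply: le_trans h; rewrite ler_wpM2r ?cabs_ge0// lerDl.
Qed.

Lemma climB s t l m : clim s l -> clim t m -> clim (fun n => s n - t n) (l - m).
Proof.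
move=> H H'; have := climD H (climZ (-1) H'); rewrite mulN1r.
by congr clim; apply/funext => n; rewrite mulN1r.
Qed.

Lemma clim_le s l (B : R) : clim s l ->
  (exists N, forall n, (N <= n)%N -> cabs (s n) <= B) -> cabs l <= B.
Proof.
move=> H [N0 HB]; apply/ler_addgt0Pr => e e0; have [N HN] := H e e0.
have := HN _ (leq_maxl N N0); have := HB _ (leq_maxr N N0).
by have := ler_cabsB l (s (maxn N N0)); rewrite cabsBC; lra.
Qed.

Lemma clim_dist_le s l z (B : R) : clim s l ->
  (exists N, forall n, (N <= n)%N -> cabs (s n - z) <= B) -> cabs (l - z) <= B.
Proof. by move=> H HB; apply: clim_le HB; exact: climB H (clim_cst z). Qed.

Lemma clim_ext s t l : (exists N, forall n, (N <= n)%N -> s n = t n) ->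
  clim s l -> clim t l.
Proof.
move=> [N0 E] H e e0; have [N HN] := H e e0; exists (maxn N N0) => n.
by rewrite geq_max => /andP[/HN h1 /E <-].
Qed.

Lemma clim_shift s l : clim s l -> clim (fun n => s n.+1) l.
Proof. by move=> H e /H[N HN]; exists N => n Nn; apply: HN; rewrite ltnW. Qed.

Lemma clim_cvg s l :
  ((fun n => Re (s n)) @ \oo --> Re l) -> ((fun n => Im (s n)) @ \oo --> Im l) ->
  clim s l.
Proof.
move=> /cvgrPdist_le H1 /cvgrPdist_le H2 e e0; have e2 : 0 < e / 2 by lra.
have [N1 _ HN1] := H1 _ e2; have [N2 _ HN2] := H2 _ e2.
exists (maxn N1 N2) => n; rewrite geq_max => /andP[/HN1/= h1 /HN2/= h2].
apply: (le_trans (cabs_le _)).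
by rewrite ReD ReN ImD ImN distrC [X in _ + X]distrC; lra.
Qed.

Lemma clim_cvg_cabs s l : clim s l -> (fun n => cabs (s n)) @ \oo --> cabs l.
Proof.
move=> H; apply/cvgrPdist_le => e /H[N HN]; exists N => // n /HN h.
have := ler_cabsB (s n) l; have := ler_cabsB l (s n); rewrite cabsBC => ? ?.
by rewrite ler_norml; apply/andP; split; lra.
Qed.

Lemma clim_Re s l : clim s l -> (fun n => Re (s n)) @ \oo --> Re l.
Proof.
move=> H; apply/cvgrPdist_le => e /H[N HN]; exists N => // n /HN h.
by apply: le_trans h; rewrite cabsBC -ReN -ReD cabs_Re.
Qed.

Lemma real_abs_cvg (u v : nat -> R) (V : R) : (forall k, `|u k| <= v k) ->
  (forall n, \sum_(k < n) v k <= V) -> cvgn (series u).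
Proof.
move=> uv vV; apply: normed_cvg.
apply: nondecreasing_is_cvgn.
  by apply: nondecreasing_series => n _ _ /=.
exists V => _ [n _ <-]; rewrite /series /=.
apply: le_trans (vV n); rewrite -(big_mkord xpredT v).
by apply: ler_sum => k _; exact: uv.
Qed.

Lemma abs_clim s (v : nat -> R) (V : R) : (forall k, cabs (s k) <= v k) ->
  (forall n, \sum_(k < n) v k <= V) ->
  exists l, clim (fun n => \sum_(k < n) s k) l.
Proof.
move=> sv vV.
have h1 := @real_abs_cvg (fun k => Re (s k)) v V
  (fun k => le_trans (cabs_Re _) (sv k)) vV.
have h2 := @real_abs_cvg (fun k => Im (s k)) v V
  (fun k => le_trans (cabs_Im _) (sv k)) vV.
exists (limn (series (fun k => Re (s k))) +i* limn (series (fun k => Im (s k))))%C.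
apply: clim_cvg => /=.
  have -> : (fun n => Re (\sum_(k < n) s k)) = series (fun k => Re (s k)).
    by apply/funext => n; rewrite /series /= big_mkord Re_sum.
  exact: h1.
have -> : (fun n => Im (\sum_(k < n) s k)) = series (fun k => Im (s k)).
  by apply/funext => n; rewrite /series /= big_mkord Im_sum.
exact: h2.
Qed.

Lemma geo_sum_le (r : R) n : 0 <= r -> r < 1 -> \sum_(k < n) r ^+ k <= (1 - r)^-1.
Proof.
move=> r0 r1; have r10 : 0 < 1 - r by lra.
rewrite -[leRHS]mul1r ler_pdivlMr//.
by have := subrX1 r n; have := exprn_ge0 n r0; lra.
Qed.

Lemma geo_small (r B e : R) : 0 <= r -> r < 1 -> 0 < e ->
  exists N, forall n, (N <= n)%N -> B * r ^+ n <= e.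
Proof.
move=> r0 r1 e0.
have : (fun n => B * r ^+ n) @ \oo --> (B * 0 : R).
  by apply: cvgMr; apply: cvg_expr; rewrite ger0_norm.
rewrite mulr0 => /cvgrPdist_le /(_ e e0)[N _ H]; exists N => n /H /=.
by rewrite sub0r normrN; apply: le_trans; exact: ler_norm.
Qed.

Lemma geo_le0 (r B x : R) : 0 <= r -> r < 1 -> (forall n, x <= B * r ^+ n) -> x <= 0.
Proof.
move=> r0 r1 H; apply/ler_addgt0Pr => e e0; rewrite add0r.
by have [N HN] := geo_small B r0 r1 e0; apply: le_trans (H N) (HN _ _).
Qed.

Lemma sqr_geo_sum (r : R) : 0 <= r -> r < 1 ->
  exists K : R, 0 <= K /\ forall n, \sum_(k < n) k%:R ^+ 2 * r ^+ k <= K.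
Proof.
move=> r0 r1; pose s : R := (1 - r) / 4; have s0 : 0 < s by rewrite /s; lra.
pose q := (1 + s) ^+ 2 * r.
have q0 : 0 <= q by rewrite mulr_ge0// sqr_ge0.
have q1 : q < 1 by rewrite /q /s; nra.
have H k : k%:R ^+ 2 * r ^+ k <= (s ^+ 2)^-1 * q ^+ k.
  have -> : (s ^+ 2)^-1 * q ^+ k = (s ^+ 2)^-1 * ((1 + s) ^+ 2) ^+ k * r ^+ k.
    by rewrite /q (exprMn k ((1 + s) ^+ 2)) mulrA.
  apply: ler_wpM2r; first exact: exprn_ge0.
  rewrite mulrC ler_pdivlMr ?exprn_gt0//.
  rewrite -exprMn -exprM mulnC exprM ler_sqr ?nnegrE//; last first.
  - by rewrite exprn_ge0//; lra.
  - by rewrite mulr_ge0// ltW.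
  elim: k => [|k IH]; first by rewrite mul0r expr0.
  rewrite exprS -natr1; have := exprn_ege1 k (_ : 1 <= 1 + s); nra.
have i0 : 0 <= (s ^+ 2)^-1 by rewrite invr_ge0 sqr_ge0.
exists ((s ^+ 2)^-1 * (1 - q)^-1); split.
  by rewrite mulr_ge0// invr_ge0; lra.
move=> n; apply: (@le_trans _ _ (\sum_(k < n) (s ^+ 2)^-1 * q ^+ k)).
  by apply: ler_sum => k _; exact: H.
by rewrite -mulr_sumr ler_wpM2l// geo_sum_le.
Qed.

End Limits.

Section PowerSeries.
Variable R : realType.
Local Notation C := R[i].
Implicit Types (z w l u : C) (x y a b r : R) (c : nat -> C).

(** [conv c a]: the power series with coefficients [c] converges absolutely in
    the open disc of radius [a], in Cauchy's form. *)
Definition conv c a := forall b : R, 0 < b -> b < a ->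
  exists B : R, forall k, cabs (c k) <= B / b ^+ k.

Definition psum c z : C :=
  xget 0 [set l | clim (fun n => \sum_(k < n) c k * z ^+ k) l].

Lemma conv_bnd c a (B : R) : 0 < a -> (forall k, cabs (c k) <= B / a ^+ k) -> conv c a.
Proof.
move=> a0 H b b0 ba; exists B => k; apply: (le_trans (H k)).
have B0 : 0 <= B by have := le_trans (cabs_ge0 _) (H 0%N); rewrite expr0 divr1.
rewrite ler_wpM2l// lef_pV2 ?posrE ?exprn_gt0// lerXn2r// ?nnegrE ltW//.
Qed.

(** A radius strictly between [cabs z] and [a] turns Cauchy's bound into a geometric one. *)
Lemma conv_geo c a z : conv c a -> cabs z < a -> exists (B r : R),
  [/\ 0 <= B, 0 <= r, r < 1 & forall k, cabs (c k * z ^+ k) <= B * r ^+ k].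
Proof.
move=> cc za; have z0 := cabs_ge0 z; pose b := (cabs z + a) / 2.
have b0 : 0 < b by rewrite /b; lra.
have [|B HB] := cc b b0; first by rewrite /b; lra.
have B0 : 0 <= B by have := le_trans (cabs_ge0 _) (HB 0%N); rewrite expr0 divr1.
exists B, (cabs z / b); split => //.
- by rewrite divr_ge0// ltW.
- by rewrite ltr_pdivrMr// mul1r /b; lra.
move=> k; rewrite cabsM cabsX expr_div_n mulrCA [X in X <= _]mulrC.
by rewrite ler_wpM2l// exprn_ge0.
Qed.

Lemma psum_clim c a z : conv c a -> cabs z < a ->
  clim (fun n => \sum_(k < n) c k * z ^+ k) (psum c z).
Proof.
move=> cc za; have [B [r [B0 r0 r1 H]]] := conv_geo cc za.
have [l Hl] : exists l, clim (fun n => \sum_(k < n) c k * z ^+ k) l.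
  apply: (abs_clim (V := B * (1 - r)^-1) H) => n.
  by rewrite -mulr_sumr ler_wpM2l// geo_sum_le.
by rewrite /psum; case: xgetP => [l' _ //|/(_ l)].
Qed.

Lemma psumE c z l : clim (fun n => \sum_(k < n) c k * z ^+ k) l -> psum c z = l.
Proof.
by move=> H; rewrite /psum; case: xgetP => [l' _ H'|/(_ l)//]; exact: clim_unique H' H.
Qed.

Lemma psum0 c : psum c 0 = c 0%N.
Proof.
apply: psumE; apply: (clim_ext _ (clim_cst (c 0%N))); exists 1%N => -[//|n] _.
rewrite big_ord_recl expr0 mulr1 big1 ?addr0// => i _.
by rewrite expr0n mulr0.
Qed.

Definition dcoef c k : C := k.+1%:R * c k.+1.
Definition icoef c k : C := if k is k'.+1 then c k' / k'.+1%:R else 0.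

Lemma dcoefK c : dcoef (icoef c) = c.
Proof.
by apply/funext => k; rewrite /dcoef /icoef mulrCA mulfV ?mulr1// pnatr_eq0.
Qed.

Lemma conv_dcoef c a : conv c a -> conv (dcoef c) a.
Proof.
move=> cc b b0 ba; pose b' := (a + b) / 2.
have b'0 : 0 < b' by rewrite /b'; lra.
have bb' : b < b' by rewrite /b'; lra.
have [|B HB] := cc b' b'0; first by rewrite /b'; lra.
have B0 : 0 <= B by have := le_trans (cabs_ge0 _) (HB 0%N); rewrite expr0 divr1.
have r0 : 0 <= b / b' by rewrite divr_ge0// ltW.
have [|K [K0 HK]] := sqr_geo_sum r0; first by rewrite ltr_pdivrMr// mul1r.
exists (B * K / b) => k; rewrite /dcoef cabsM cabs_nat.
apply: (@le_trans _ _ (k.+1%:R * (B / b' ^+ k.+1))); first by rewrite ler_wpM2l.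
have h : k.+1%:R ^+ 2 * b ^+ k.+1 <= K * b' ^+ k.+1.
  rewrite -ler_pdivrMr ?exprn_gt0// -mulrA -expr_div_n.
  apply: le_trans (HK k.+2); rewrite big_ord_recr /= lerDr.
  by apply: sumr_ge0 => i _; rewrite mulr_ge0 ?exprn_ge0.
have -> : B * K / b / b ^+ k = B * (K / b ^+ k.+1).
  by rewrite exprS invfM !mulrA.
rewrite mulrCA ler_wpM2l// ler_pdivrMr ?exprn_gt0// mulrAC ler_pdivlMr ?exprn_gt0//.
apply: le_trans h; rewrite ler_wpM2r ?exprn_ge0 ?(ltW b0)//.
by rewrite expr2 ler_peMl// ler1n.
Qed.

Lemma conv_icoef c a : conv c a -> conv (icoef c) a.
Proof.
move=> cc b b0 ba; have [B HB] := cc b b0 ba.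
have B0 : 0 <= B by have := le_trans (cabs_ge0 _) (HB 0%N); rewrite expr0 divr1.
exists (B * b) => -[|k]; first by rewrite /icoef cabs0 expr0 divr1 mulr_ge0// ltW.
rewrite /icoef cabsM cabsV cabs_nat.
have -> : B * b / b ^+ k.+1 = B / b ^+ k.
  by rewrite exprS invfM mulrA mulfK ?gt_eqF.
apply: le_trans (HB k); rewrite ler_piMr ?cabs_ge0// invf_le1// ?ler1n//.
Qed.

(** The second-order Taylor remainder of [z ^ k], with a constant quadratic in [k]: its series
    against [r ^ k] converges by [sqr_geo_sum]. *)
Lemma exprD_affine_le z h r k : cabs z <= r -> cabs (z + h) <= r ->
  r ^+ 2 * cabs ((z + h) ^+ k - z ^+ k - h * (k%:R * z ^+ k.-1)) <=
  cabs h ^+ 2 * (k%:R ^+ 2 * r ^+ k).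
Proof.
move=> zr zhr; have r0 : 0 <= r := le_trans (cabs_ge0 _) zr.
elim: k => [|k IH].
  by rewrite !expr0 !mul0r mulr0 subrr subr0 cabs0 mulr0 expr0n /= !mul0r mulr0.
set E := _ - _ - _ in IH.
have -> : (z + h) ^+ k.+1 - z ^+ k.+1 - h * (k.+1%:R * z ^+ k.+1.-1) =
    (z + h) * E + h ^+ 2 * (k%:R * z ^+ k.-1).
  rewrite /E; case: k {IH E} => [|k] /=; first by rewrite !expr1 expr0; ring.
  by rewrite !exprS -!natr1; ring.
have A : r ^+ 2 * cabs ((z + h) * E) <= r * (cabs h ^+ 2 * (k%:R ^+ 2 * r ^+ k)).
  by rewrite cabsM mulrCA ler_pM ?cabs_ge0// mulr_ge0 ?cabs_ge0 ?sqr_ge0.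
have B : r ^+ 2 * cabs (h ^+ 2 * (k%:R * z ^+ k.-1)) <=
    cabs h ^+ 2 * (k%:R * r ^+ k.+1).
  case: k {IH E A} => [|k] /=; first by rewrite !mul0r mulr0 cabs0 !mulr0.
  rewrite !cabsM !cabsX cabs_nat mulrCA ler_wpM2l ?sqr_ge0// mulrCA ler_wpM2l//.
  have -> : r ^+ k.+2 = r ^+ 2 * r ^+ k by rewrite -exprD.
  by rewrite ler_wpM2l ?sqr_ge0// lerXn2r ?nnegrE ?cabs_ge0.
have := cabsD ((z + h) * E) (h ^+ 2 * (k%:R * z ^+ k.-1)).
set X := cabs (_ + _); set Y := cabs _ in A *; set Z := cabs _ in B *.
have r2 : 0 <= r ^+ 2 by rewrite sqr_ge0.
move=> /(ler_wpM2l r2) XYZ; apply: (le_trans XYZ).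
rewrite mulrDr; apply: (le_trans (lerD A B)).
rewrite mulrCA -mulrDr ler_wpM2l ?sqr_ge0//.
rewrite mulrCA -exprS -mulrDl ler_wpM2r ?exprn_ge0// -natr1.
by have := ler0n R k; nra.
Qed.

(** Termwise differentiation: the remainders of the monomials sum to a multiple of the
    square of the increment. *)
Lemma psum_cdiff c a z : conv c a -> cabs z < a ->
  cdiff (psum c) z (psum (dcoef c) z).
Proof.
move=> cc za; have z0 := cabs_ge0 z.
pose r := (cabs z + a) / 2; have r0 : 0 < r by rewrite /r; lra.
have ra : r < a by rewrite /r; lra.
pose b := (r + a) / 2; have b0 : 0 < b by rewrite /b; lra.
have [|B HB] := cc b b0; first by rewrite /b; lra.
have B0 : 0 <= B by have := le_trans (cabs_ge0 _) (HB 0%N); rewrite expr0 divr1.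
have rb0 : 0 <= r / b by rewrite divr_ge0// ltW.
have [|K [K0 HK]] := sqr_geo_sum rb0.
  by rewrite ltr_pdivrMr// mul1r /b; lra.
pose Q := B * K / r ^+ 2.
have Q0 : 0 <= Q by rewrite divr_ge0 ?sqr_ge0// mulr_ge0.
have main h : cabs h < r - cabs z ->
    cabs (psum c (z + h) - psum c z - h * psum (dcoef c) z) <= Q * cabs h ^+ 2.
  move=> hr; have zh : cabs (z + h) <= r by have := cabsD z h; lra.
  have L1 := psum_clim cc (le_lt_trans zh ra).
  have L2 := psum_clim cc za.
  have L3 := psum_clim (conv_dcoef cc) za.
  have L := climB (climB (clim_shift L1) (clim_shift L2)) (climZ h L3).
  apply: (clim_le L); exists 0%N => n _.
  have -> : \sum_(k < n.+1) c k * (z + h) ^+ k - \sum_(k < n.+1) c k * z ^+ k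
      - h * \sum_(k < n) dcoef c k * z ^+ k =
      \sum_(k < n.+1) c k * ((z + h) ^+ k - z ^+ k - h * (k%:R * z ^+ k.-1)).
    rewrite mulr_sumr.
    have -> : \sum_(k < n) h * (dcoef c k * z ^+ k) =
        \sum_(k < n.+1) h * (k%:R * c k * z ^+ k.-1).
      by rewrite big_ord_recl /= !mul0r mulr0 add0r.
    by rewrite -!sumrB; apply: eq_bigr => k _; ring.
  apply: (le_trans (cabs_sum _ _ _)).
  have r20 : 0 < r ^+ 2 by rewrite exprn_gt0.
  apply: (@le_trans _ _ (\sum_(k < n.+1) B * (cabs h ^+ 2 / r ^+ 2) *
     (k%:R ^+ 2 * (r / b) ^+ k))).
    apply: ler_sum => k _; rewrite cabsM.
    have zr : cabs z <= r by rewrite /r; lra.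
    have := exprD_affine_le k zr zh; rewrite mulrC -ler_pdivlMr// => H.
    apply: (le_trans (ler_pM (cabs_ge0 _) (cabs_ge0 _) (HB k) H)).
    rewrite le_eqVlt; apply/orP; left; apply/eqP; rewrite (expr_div_n r b).
    have := exprn_gt0 k b0; set p := r ^+ k; set p' := b ^+ k => p'0.
    by field; rewrite !gt_eqF.
  rewrite -mulr_sumr.
  apply: (le_trans (ler_wpM2l _ (HK _))).
    by rewrite mulr_ge0// divr_ge0 ?sqr_ge0.
  by rewrite le_eqVlt; apply/orP; left; apply/eqP; rewrite /Q; field; rewrite gt_eqF.
apply/cdiffP => e e0.
have Q1 : 0 < Q + 1 by lra.
exists (Num.min (r - cabs z) (e / (Q + 1))).
  by rewrite lt_min divr_gt0// andbT /r; lra.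
move=> h; rewrite lt_min => /andP[h1]; rewrite ltr_pdivlMr// => h2.
apply: (le_trans (main h h1)); rewrite expr2 mulrA ler_wpM2r ?cabs_ge0//.
by have := cabs_ge0 h; nra.
Qed.

(** Otherwise the first differing term would dominate the difference near 0. *)
Lemma psum_inj c d a (e : R) : 0 < a -> 0 < e -> conv c a -> conv d a ->
  (forall t : R, 0 < t -> t < e -> psum c t%:C%C = psum d t%:C%C) -> c =1 d.
Proof.
move=> a0 e0 cc cd E k.
have b0 : 0 < a / 2 by lra.
have [|B1 H1] := cc _ b0; first by lra.
have [|B2 H2] := cd _ b0; first by lra.
set b := a / 2 in b0 H1 H2.
pose B := B1 + B2.
have HB j : cabs (c j - d j) <= B / b ^+ j.
  by rewrite (le_trans (cabsB _ _))// /B mulrDl lerD.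
have B0 : 0 <= B by have := le_trans (cabs_ge0 _) (HB 0%N); rewrite expr0 divr1.
elim/ltn_ind: k => k IH; apply/eqP; rewrite -subr_eq0; apply/eqP/cabs_small0 => x x0.
have bk : 0 < b ^+ k.+1 by rewrite exprn_gt0.
have S0 : 0 < 2 * B / b ^+ k.+1 + 1.
  by rewrite ltr_wpDl// divr_ge0 ?(ltW bk)//; lra.
pose t := Num.min (Num.min (e / 2) (b / 2)) (x / (2 * B / b ^+ k.+1 + 1)).
have t0 : 0 < t by rewrite /t !lt_min divr_gt0// divr_gt0//=; apply: divr_gt0.
have : t <= t by []; rewrite {2}/t !le_min => /andP[/andP[te tb]].
rewrite ler_pdivlMr// => tx.
have ta : cabs t%:C%C < a by rewrite cabs_real gtr0_norm//; rewrite /b in tb; lra.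
have te' : t < e by lra.
have L := climB (psum_clim cc ta) (psum_clim cd ta).
rewrite (E t t0 te') subrr in L.
have Z : cabs ((c k - d k) * t%:C%C ^+ k) <= 2 * B * (t / b) ^+ k.+1.
  rewrite -cabsN -sub0r.
  apply: (clim_dist_le L); exists k.+1 => n kn.
  rewrite -sumrB; under eq_bigr do rewrite -mulrBl.
  rewrite -(big_mkord xpredT (fun j => (c j - d j) * t%:C%C ^+ j)).
  rewrite (big_cat_nat (n := k.+1))//= big_nat_recr//= big_nat_cond big1 ?add0r.
    rewrite addrAC subrr add0r (le_trans (cabs_sum _ _ _))//.
    rewrite -{1}[k.+1]add0n big_addn big_mkord.
    apply: (@le_trans _ _ (\sum_(j < n - k.+1) B * (t / b) ^+ k.+1 * (2^-1) ^+ j)).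
      apply: ler_sum => j _; rewrite cabsM cabsX cabs_real gtr0_norm//.
      apply: (@le_trans _ _ (B * (t / b) ^+ (j + k.+1))).
        rewrite expr_div_n mulrCA mulrC ler_wpM2l ?exprn_ge0 ?(ltW t0)//.
      rewrite addnC exprD mulrA ler_wpM2l//.
        by rewrite mulr_ge0// exprn_ge0// divr_ge0// ltW.
      rewrite lerXn2r// ?nnegrE ?invr_ge0//; first by rewrite divr_ge0// ltW.
      by rewrite ler_pdivrMr//; lra.
    rewrite -mulr_sumr; apply: (@le_trans _ _ (B * (t / b) ^+ k.+1 * 2)); last by lra.
    apply: ler_wpM2l; first by rewrite mulr_ge0// exprn_ge0// divr_ge0// ltW.
    have E2 : 2 = (1 - 2^-1)^-1 :> R by field.
    rewrite [leRHS]E2.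
    by apply: geo_sum_le; lra.
  by move=> j /andP[/andP[_ jk] _]; rewrite IH// subrr mul0r.
move: Z; rewrite cabsM cabsX cabs_real gtr0_norm// expr_div_n exprS.
rewrite [t * _ / _]mulrAC !mulrA ler_pM2r ?exprn_gt0// => Z.
apply: (le_trans Z); move: tx; rewrite mulrDr mulr1 => tx.
by rewrite mulrAC mulrC; lra.
Qed.

End PowerSeries.

(** * Cauchy's formula and Taylor expansion on a square *)

(** Contours are squares, whose edges are parallel to the axes: this avoids parametrized
    circles and the number pi. The normalization is [rect (fun w => w^-1)]; its modulus
    is bounded below in [winding_ge4]. *)
Section Taylor.
Variable R : realType.
Local Notation C := R[i].
Implicit Types (z w l u : C) (x y r : R) (g : C -> C).

Definition square_edges (P : C -> Prop) (a : R) := on_edges P (- a) a (- a) a.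

Lemma square_edgesP (P : C -> Prop) (a : R) : 0 < a ->
  (forall z, a <= cabs z -> cabs z < 2 * a ->
     `|Re z| <= a -> `|Im z| <= a -> P z) -> square_edges P a.
Proof.
move=> a0 H.
have K x y : `|x| <= a -> `|y| <= a -> (a <= `|x| \/ a <= `|y|) -> P (cpt x y).
  move=> hx hy hxy; have x2 : x ^+ 2 <= a ^+ 2.
    by rewrite -real_normK ?num_real// lerXn2r// ?nnegrE ltW.
  have y2 : y ^+ 2 <= a ^+ 2.
    by rewrite -real_normK ?num_real// lerXn2r// ?nnegrE ltW.
  apply: H; rewrite ?Re_cpt ?Im_cpt//.
    case: hxy => /le_trans; apply.
      by rewrite -{1}(Re_cpt x y) cabs_Re.
    by rewrite -{1}(Im_cpt x y) cabs_Im.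
  rewrite -ltr_sqr ?nnegrE ?cabs_ge0//; last by lra.
  by rewrite sqr_cabs Re_cpt Im_cpt; nra.
have aa : `|a| = a by rewrite gtr0_norm.
by split=> t /andP[t1 t2]; split; apply: K;
  rewrite ?normrN ?aa ?ler_norml ?lexx ?t1 ?t2; auto.
Qed.

Variable a : R.
Hypothesis a0 : 0 < a.
Local Notation rect g := (Rect g (- a) a (- a) a).
Let aa : - a <= a. Proof. by move: a0; lra. Qed.

Lemma cpt_inv x y : (cpt x y)^-1 =
  (x / (x ^+ 2 + y ^+ 2) +i* (- (y / (x ^+ 2 + y ^+ 2))))%C :> C.
Proof.
have -> : cpt x y = (x +i* y)%C.
  by apply: complexP; rewrite ?Re_cpt ?Im_cpt.
by [].
Qed.

Lemma ccontV g z : ccont g z -> g z != 0 -> ccont (fun w => (g w)^-1) z.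
Proof.
move=> gc gz e e0; set G := cabs (g z); have G0 : 0 < G by rewrite cabs_gt0.
have [d1 d10 H1] := gc _ (divr_gt0 G0 (ltr0n _ 2)).
have e'0 : 0 < e * (G * (G / 2)) by rewrite !mulr_gt0// invr_gt0.
have [d2 d20 H2] := gc _ e'0.
exists (Num.min d1 d2) => [|h]; first by rewrite lt_min d10.
rewrite lt_min => /andP[/H1 h1 /H2 h2].
have gh : G / 2 <= cabs (g (z + h)).
  have := ler_cabsB (g z) (g (z + h)); rewrite cabsBC -/G.
  by move: h1; rewrite -/G; lra.
have gh0 : g (z + h) != 0 by rewrite -cabs_gt0; lra.
have -> : (g (z + h))^-1 - (g z)^-1 = - (g (z + h) - g z) / (g z * g (z + h)).
  by field; rewrite ?gz ?gh0.
rewrite cabsM cabsV cabsN cabsM -/G.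
have gg : G * (G / 2) <= G * cabs (g (z + h)) by rewrite ler_pM2l.
have gg0 : 0 < G * (G / 2) by rewrite mulr_gt0// divr_gt0.
rewrite ler_pdivrMr ?(lt_le_trans gg0)//.
by apply: (le_trans h2); rewrite ler_wpM2l// ltW.
Qed.

Lemma edges_inv_cont : square_edges (ccont (fun w => w^-1)) a.
Proof.
apply: square_edgesP => // z az _ _ _; apply: ccontV.
  exact: ccont_cdiff (cdiff_id z).
by rewrite -cabs_gt0 (lt_le_trans a0).
Qed.

Lemma ccontM f g z : ccont f z -> ccont g z -> ccont (fun w => f w * g w) z.
Proof.
move=> fc gc e e0; set F := cabs (f z); set G := cabs (g z).
have F0 : 0 <= F by exact: cabs_ge0.
have G0 : 0 <= G by exact: cabs_ge0.
have S0 : 0 < F + G + 1 by lra.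
pose e' := Num.min 1 (e / (F + G + 1)).
have e'0 : 0 < e' by rewrite lt_min ltr01 divr_gt0.
have : e' <= e' by []; rewrite {2}/e' le_min ler_pdivlMr// => /andP[e'1 e'2].
have [d1 d10 H1] := fc _ e'0; have [d2 d20 H2] := gc _ e'0.
exists (Num.min d1 d2) => [|h]; first by rewrite lt_min d10.
rewrite lt_min => /andP[/H1 h1 /H2 h2].
set u := f (z + h) - f z in h1; set v := g (z + h) - g z in h2.
have -> : f (z + h) * g (z + h) - f z * g z = f z * v + u * g z + u * v.
  by rewrite /u /v; ring.
apply: (le_trans (cabsD _ _)); apply: (le_trans (lerD (cabsD _ _) (lexx _))).
rewrite !cabsM -/F -/G; apply: le_trans e'2.
have u0 := cabs_ge0 u; have v0 := cabs_ge0 v; clearbody u v.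
by nra.
Qed.

(** The value is 2 pi i; each edge, of length [2 a], contributes an imaginary part of density
    at least [(2 a)^-1]. *)
Lemma winding_ge4 : 4 <= cabs (rect (fun w => w^-1)).
Proof.
have ap := a0.
have [cE1 cE2] := edges_inv_cont.
have c1 t : - a <= t <= a -> rcont (fun t => (cpt t (- a))^-1) t.
  by move=> ht; apply: (rcont_h (g := fun w => w^-1)); case: (cE1 t ht).
have c2 t : - a <= t <= a -> rcont (fun t => (cpt t a)^-1) t.
  by move=> ht; apply: (rcont_h (g := fun w => w^-1)); case: (cE1 t ht).
have c3 t : - a <= t <= a -> rcont (fun t => (cpt (- a) t)^-1) t.
  by move=> ht; apply: (rcont_v (g := fun w => w^-1)); case: (cE2 t ht).
have c4 t : - a <= t <= a -> rcont (fun t => (cpt a t)^-1) t.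
  by move=> ht; apply: (rcont_v (g := fun w => w^-1)); case: (cE2 t ht).
have key t : - a <= t <= a -> (2 * a)^-1 <= a / (t ^+ 2 + a ^+ 2).
  move=> /andP[t1 t2]; have a2 : 0 < t ^+ 2 + a ^+ 2 by nra.
  by rewrite ler_pdivlMr// mulrC ler_pdivrMr ?mulr_gt0//; nra.
have len : - (2 * a)^-1 * (a - - a) = -1 by field; rewrite gt_eqF.
set p1 := pint (fun t => (cpt t (- a))^-1) (- a) a.
have b1 : Re ('i%C * p1) <= -1.
  rewrite -len; apply: pint_Re_le => // t /[dup] ht /key.
  by rewrite cpt_inv ReM /= sqrrN; lra.
set p2 := pint (fun t => (cpt t a)^-1) (- a) a.
have b2 : Re (- 'i%C * p2) <= -1.
  rewrite -len; apply: pint_Re_le => // t /[dup] ht /key.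
  by rewrite cpt_inv ReM /=; lra.
set p3 := pint (fun t => (cpt (- a) t)^-1) (- a) a.
have b3 : Re (1 * p3) <= -1.
  rewrite -len; apply: pint_Re_le => // t /[dup] ht /key.
  by rewrite mul1r cpt_inv /= sqrrN [a ^+ 2 + _]addrC; lra.
set p4 := pint (fun t => (cpt a t)^-1) (- a) a.
have b4 : Re (-1 * p4) <= -1.
  rewrite -len; apply: pint_Re_le => // t /[dup] ht /key.
  by rewrite mulN1r ReN cpt_inv /= [a ^+ 2 + _]addrC; lra.
apply: le_trans (cabs_Im _); apply: le_trans (ler_norm _).
rewrite /Rect -/p1 -/p2 -/p3 -/p4; clearbody p1 p2 p3 p4.
rewrite !ImD !ImN !ImM /=; move: b1 b2 b3 b4; rewrite !ReM /=; lra.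
Qed.

(** [w ^ (- m - 2)] has an antiderivative on the edges, unlike [w^-1]. *)
Lemma rect_powV m : rect (fun w => (w ^+ m.+2)^-1) = 0.
Proof.
apply: (rect_prim aa aa (G := fun w => (- m.+1%:R^-1) * (w ^+ m.+1)^-1)).
apply: square_edgesP => // z az _ _ _.
have z0 : z != 0 by rewrite -cabs_gt0 (lt_le_trans a0).
have zm : z ^+ m.+1 != 0 by rewrite expf_eq0.
have := cdiffM (cdiff_cst (- m.+1%:R^-1) z) (cdiffV (g := fun w => w ^+ m.+1) zm (cdiffX m.+1 z)).
apply: cdiff_eq; rewrite mul0r addr0 /= !exprS.
have zm' : z ^+ m != 0 by rewrite expf_eq0 (negPf z0) andbF.
by field; rewrite zm' z0 nat1r pnatr_eq0.
Qed.

Section Expansion.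
Variables (h : C -> C) (z : C) (M : R).
Hypotheses (hc : square_edges (ccont h) a) (za : cabs z < a)
  (hM : square_edges (fun w => cabs (h w) <= M) a).

Definition cauchy_coef k := rect (fun w => h w * (w ^+ k.+1)^-1).


Let edge_neq w : a <= cabs w -> w != 0 /\ w - z != 0.
Proof.
have ap := a0; move=> aw; rewrite -!cabs_gt0; have := ler_cabsB w z.
by move: za; split; lra.
Qed.

Lemma edges_expand_cont n :
  square_edges (ccont (fun w => h w * (w ^+ n)^-1 * (w - z)^-1)) a.
Proof.
have K : square_edges (ccont (fun w => (w ^+ n)^-1 * (w - z)^-1)) a.
  apply: square_edgesP => // w aw _ _ _; have [w0 wz0] := edge_neq aw.
  have wn0 : w ^+ n != 0 by rewrite expf_eq0 (negPf w0) andbF.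
  have D := cdiffM (cdiffV (g := fun w => w ^+ n) wn0 (cdiffX n w))
    (cdiffV (g := fun w => w - z) wz0 (cdiffB (cdiff_id w) (cdiff_cst z w))).
  exact: ccont_cdiff D.
case: hc K => [h1 h2] [k1 k2]; split=> t ht.
  by case: (h1 t ht) (k1 t ht) => A B [A' B']; split;
    [have := ccontM A A'|have := ccontM B B'];
    under [X in ccont X]eq_fun do rewrite mulrA.
by case: (h2 t ht) (k2 t ht) => A B [A' B']; split;
  [have := ccontM A A'|have := ccontM B B'];
  under [X in ccont X]eq_fun do rewrite mulrA.
Qed.

Lemma edges_coef_cont n : square_edges (ccont (fun w => h w * (w ^+ n)^-1)) a.
Proof.
have K : square_edges (ccont (fun w => (w ^+ n)^-1)) a.
  apply: square_edgesP => // w aw _ _ _; have [w0 wz0] := edge_neq aw.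
  have wn0 : w ^+ n != 0 by rewrite expf_eq0 (negPf w0) andbF.
  exact: ccont_cdiff (cdiffV (g := fun w => w ^+ n) wn0 (cdiffX n w)).
case: hc K => [h1 h2] [k1 k2]; split=> t ht.
  by case: (h1 t ht) (k1 t ht) => A B [A' B']; split; apply: ccontM.
by case: (h2 t ht) (k2 t ht) => A B [A' B']; split; apply: ccontM.
Qed.

Let M0 : 0 <= M.
Proof.
have ap := a0; apply: le_trans (cabs_ge0 (h (cpt (- a) (- a)))) _.
by have [H _] := hM; have [|] := H (- a); first lra.
Qed.

Lemma edges_bound (f : C -> C) (B : R) :
  (forall w, a <= cabs w -> cabs (f w) <= B) ->
  square_edges (fun w => cabs (h w * f w) <= M * B) a.
Proof.
move=> fB.
have K : square_edges (fun w => cabs (f w) <= B) a.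
  by apply: square_edgesP => // w aw _ _ _; exact: fB.
case: hM K => [h1 h2] [k1 k2]; split=> t ht.
  by case: (h1 t ht) (k1 t ht) => A B' [A' B'']; split;
    rewrite cabsM ler_pM ?cabs_ge0.
by case: (h2 t ht) (k2 t ht) => A B' [A' B'']; split;
    rewrite cabsM ler_pM ?cabs_ge0.
Qed.

Lemma cauchy_coef_le k : cabs (cauchy_coef k) <= 8 * M / a ^+ k.
Proof.
apply: (le_trans (rect_le aa aa (edges_coef_cont k.+1) (@edges_bound (fun w => (w ^+ k.+1)^-1) (a ^+ k.+1)^-1 _))).
  move=> w aw; rewrite cabsV cabsX lef_pV2 ?posrE ?exprn_gt0//; last first.
    exact: lt_le_trans aw.
  by rewrite lerXn2r ?nnegrE ?(ltW a0) ?cabs_ge0.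
rewrite le_eqVlt; apply/orP; left; apply/eqP; rewrite exprS.
have := exprn_gt0 k a0; set p := a ^+ k => p0.
by field; rewrite !gt_eqF.
Qed.

(** Expansion of the Cauchy kernel [1 / (w - z)] in powers of [z / w], with the
    remainder of the geometric series. *)
Lemma cauchy_expand n :
  cabs (rect (fun w => h w * (w - z)^-1) - \sum_(k < n) cauchy_coef k * z ^+ k) <=
  8 * a * M / (a - cabs z) * (cabs z / a) ^+ n.
Proof.
have ap := a0; have z0 := cabs_ge0 z; have az : 0 < a - cabs z by move: za; lra.
pose D m := rect (fun w => h w * (w ^+ m)^-1 * (w - z)^-1).
have step m : D m = cauchy_coef m + z * D m.+1.
  rewrite /D -rectZ//; last exact: edges_expand_cont.
  rewrite /cauchy_coef -rectD//; last 2 first.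
  - exact: edges_coef_cont.
  - have [k1 k2] := edges_expand_cont m.+1.
    by split=> t ht; [case: (k1 t ht)|case: (k2 t ht)] => A B; split; apply: ccontZ.
  apply: rect_ext; apply: square_edgesP => // w aw _ _ _.
  have [w0 wz0] := edge_neq aw; rewrite exprS.
  have wm0 : w ^+ m != 0 by rewrite expf_eq0 (negPf w0) andbF.
  by field; rewrite w0 wm0 wz0.
have -> : rect (fun w => h w * (w - z)^-1) = D 0%N.
  by apply: rect_ext; split=> t _; rewrite !expr0 !invr1 !mulr1.
have -> : D 0%N = \sum_(k < n) cauchy_coef k * z ^+ k + z ^+ n * D n.
  elim: n => [|n IH]; first by rewrite big_ord0 expr0 mul1r add0r.
  by rewrite big_ord_recr /= {1}IH step exprSr; ring.
rewrite addrC addKr cabsM cabsX.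
have DB : cabs (D n) <= M * ((a ^+ n)^-1 * (a - cabs z)^-1) * (2 * (a - - a) + 2 * (a - - a)).
  have Dc := edges_expand_cont n.
  apply: (rect_le aa aa Dc).
  have := @edges_bound (fun w => (w ^+ n)^-1 * (w - z)^-1) ((a ^+ n)^-1 * (a - cabs z)^-1).
  case=> [w aw|e1 e2].
    have [w0 wz0] := edge_neq aw; have := ler_cabsB w z => wz.
    rewrite cabsM !cabsV cabsX ler_pM ?invr_ge0 ?exprn_ge0 ?cabs_ge0//.
      rewrite lef_pV2 ?posrE ?exprn_gt0 ?cabs_gt0//.
      by rewrite lerXn2r ?nnegrE ?(ltW a0) ?cabs_ge0.
    by rewrite lef_pV2 ?posrE ?cabs_gt0//; apply: le_trans wz; rewrite lerD2r.
  by split=> t ht; [case: (e1 t ht)|case: (e2 t ht)] => A B; rewrite -!mulrA.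
apply: (le_trans (ler_wpM2l _ DB)); first by rewrite exprn_ge0.
rewrite le_eqVlt; apply/orP; left; apply/eqP; rewrite expr_div_n.
have := exprn_gt0 n a0; set p := a ^+ n => p0.
by field; rewrite !gt_eqF.
Qed.

End Expansion.

(** The difference quotient of [g] at [z] is holomorphic off [z] and continuous at [z], so
    its integral vanishes by [goursat_point]. To move the singularity of the kernel from [z]
    to 0, expand the kernel: every term but the first has an antiderivative. *)
Lemma cauchy_formula g z : cabs z < a ->
  (forall w, cabs w < 2 * a -> exists l, cdiff g w l) ->
  rect (fun w => g w * (w - z)^-1) = g z * rect (fun w => w^-1).
Proof.
have ap := a0; move=> za gd; have z0 := cabs_ge0 z.
have e1 : on_edges (ccont (fun=> 1 : C)) (- a) a (- a) a.
  by apply: on_rect_edges => // x y _ _; exact: ccont_cdiff (cdiff_cst _ _).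
have e1M : square_edges (fun w => cabs ((fun=> 1 : C) w) <= 1) a.
  by apply: on_rect_edges => // x y _ _; rewrite cabs1.
have za1 : cabs z / a < 1 by rewrite ltr_pdivrMr// mul1r.
have za0 : 0 <= cabs z / a by rewrite divr_ge0// ltW.
have W : rect (fun w => 1 * (w - z)^-1) = rect (fun w => w^-1).
  apply/eqP; rewrite -subr_eq0 -cabs_eq0 eq_le cabs_ge0 andbT.
  pose K := 8 * a * 1 / (a - cabs z) * (cabs z / a).
  apply: (@geo_le0 _ (cabs z / a) K) => // n.
  have := cauchy_expand e1 za e1M n.+1.
  have -> : \sum_(k < n.+1) cauchy_coef (fun=> 1) k * z ^+ k = rect (fun w => w^-1).
    rewrite big_ord_recl /= expr0 mulr1 big1 ?addr0.
      by apply: rect_ext; split=> t _; rewrite !expr1 !mul1r.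
    move=> i _; rewrite /cauchy_coef -[RHS](mul0r (z ^+ bump 0 i)); congr (_ * _).
    rewrite -(rect_powV i); apply: rect_ext; split=> t _; rewrite !mul1r//.
  by rewrite exprS mulrA.
have [l gl] : exists l, cdiff g z l by apply: gd; lra.
pose k w := if w == z then l else (g w - g z) / (w - z).
have kd w : cabs w < 2 * a -> w != z -> exists m, cdiff k w m.
  move=> wa wz; have [m gm] := gd w wa.
  have wz0 : w - z != 0 by rewrite subr_eq0.
  have D := cdiff_div (g := fun w => w - z) wz0 (cdiffB gm (cdiff_cst (g z) w))
    (cdiffB (cdiff_id w) (cdiff_cst z w)).
  eexists; apply: (cdiff_ext (d := cabs (w - z))) D; first by rewrite cabs_gt0.
  move=> h hd; rewrite /k; case: eqP => // whz; exfalso; move: hd.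
  have -> : w - z = - h by rewrite -whz; ring.
  by rewrite cabsN ltxx.
have kz : ccont k z.
  move=> e e0; have /cdiffP := gl; move=> /(_ e e0)[d d0 H]; exists d => // h hd.
  rewrite /k eqxx; case: eqP => [_|/eqP hz]; first by rewrite subrr cabs0 ltW.
  have h0 : h != 0 by apply: contra hz => /eqP ->; rewrite addr0.
  have -> : (g (z + h) - g z) / (z + h - z) - l = (g (z + h) - g z - h * l) / h.
    have -> : z + h - z = h by ring.
    by field.
  by rewrite cabsM cabsV ler_pdivrMr ?cabs_gt0// H.
have inball x y : - a <= x <= a -> - a <= y <= a -> cabs (cpt x y) < 2 * a.
  move=> /andP[x1 x2] /andP[y1 y2].
  rewrite -ltr_sqr ?nnegrE ?cabs_ge0//; last by lra.
  by rewrite sqr_cabs Re_cpt Im_cpt; nra.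
have K0 : rect k = 0.
  have /andP[zr1 zr2] : - a < Re z < a.
    by rewrite -ltr_norml (le_lt_trans (cabs_Re _)).
  have /andP[zi1 zi2] : - a < Im z < a.
    by rewrite -ltr_norml (le_lt_trans (cabs_Im _)).
  apply: (@goursat_point _ _ _ (Re z) (Im z)); rewrite ?zr1 ?zi1 -?cptE//.
  - move=> x y hx hy; have [->//|ne] := eqVneq (cpt x y) z.
    by have [m /ccont_cdiff] := kd _ (inball _ _ hx hy) ne.
  - by move=> x y hx hy ne; apply: kd => //; exact: inball.
have gE : square_edges (ccont g) a.
  by apply: square_edgesP => // w _ wa _ _; have [m /ccont_cdiff] := gd w wa.
have G1 := edges_expand_cont gE za 0; have E1 := edges_expand_cont e1 za 0.
have X : rect k = rect (fun w => g w * (w ^+ 0)^-1 * (w - z)^-1 +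
     (- g z) * (1 * (w ^+ 0)^-1 * (w - z)^-1)).
  apply: rect_ext; apply: square_edgesP => // w aw _ _ _.
  rewrite /k; case: eqP => [wz|_]; last by rewrite expr0 invr1; ring.
  by exfalso; move: aw; rewrite wz; lra.
move: K0; rewrite X rectD//; last first.
  by case: E1 => [k1 k2]; split=> t ht; [case: (k1 t ht)|case: (k2 t ht)];
    split; apply: ccontZ.
rewrite rectZ// -W => /eqP; rewrite mulNr subr_eq0 => /eqP.
have Y (f : C -> C) : rect (fun w => f w * (w ^+ 0)^-1 * (w - z)^-1) =
    rect (fun w => f w * (w - z)^-1).
  by apply: rect_ext; split=> t _; rewrite !expr0 !invr1 !mulr1.
by rewrite (Y g) (Y (fun=> 1)).
Qed.

Definition taylor_coef g k : C := cauchy_coef g k / rect (fun w => w^-1).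

(** Taylor expansion at the origin; the passage from the square to the disc
    costs a factor 2 in the radius. *)
Theorem taylor g (M : R) :
  (forall w, cabs w < 2 * a -> exists l, cdiff g w l) ->
  square_edges (fun w => cabs (g w) <= M) a ->
  (forall k, cabs (taylor_coef g k) <= 2 * M / a ^+ k) /\
  (forall z, cabs z < a -> clim (fun n => \sum_(k < n) taylor_coef g k * z ^+ k) (g z)).
Proof.
have ap := a0; move=> gd gM.
have gE : square_edges (ccont g) a.
  by apply: square_edgesP => // w _ wa _ _; have [m /ccont_cdiff] := gd w wa.
have w4 := winding_ge4; set c0 := rect (fun w => w^-1) in w4.
have c0p : 0 < cabs c0 by lra.
have c00 : c0 != 0 by rewrite -cabs_gt0.
have z0 : cabs (0 : C) < a by rewrite cabs0.
have M0 : 0 <= M.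
  by have := cauchy_coef_le gE z0 gM 0; rewrite expr0 divr1 => /(le_trans (cabs_ge0 _)); lra.
split=> [k|z za].
  rewrite /taylor_coef -/c0 cabsM cabsV ler_pdivrMr//.
  apply: (le_trans (cauchy_coef_le gE z0 gM k)).
  have ak : 0 <= M / a ^+ k by rewrite divr_ge0// exprn_ge0// ltW.
  by rewrite -!mulrA; nra.
move=> e e0; have za0 := cabs_ge0 z.
have za1 : cabs z / a < 1 by rewrite ltr_pdivrMr// mul1r.
have za2 : 0 <= cabs z / a by rewrite divr_ge0// ltW.
have [N HN] := geo_small (8 * a * M / (a - cabs z)) za2 za1 e0.
exists N => n /HN; apply: le_trans.
apply: le_trans (cauchy_expand gE za gM n).
have -> : \sum_(k < n) taylor_coef g k * z ^+ k - g z =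
    - ((rect (fun w => g w * (w - z)^-1) - \sum_(k < n) cauchy_coef g k * z ^+ k) / c0).
  rewrite cauchy_formula// -/c0 mulrBl mulfK// mulr_suml opprB.
  by congr (_ - _); apply: eq_bigr => k _; rewrite /taylor_coef -/c0; ring.
rewrite cabsN cabsM cabsV ler_pdivrMr// ler_peMr ?cabs_ge0//; lra.
Qed.

End Taylor.

(** * Zero-free functions on a disc *)

Section ZeroFree.
Variable R : realType.
Local Notation C := R[i].
Implicit Types (z w l u : C) (x y r a M : R) (g : C -> C).

(** The square of half-side [a] lies in the disc of radius [2 a], where [M] bounds [g]. *)
Lemma taylor_bnd g a M : 0 < a ->
  (forall w, cabs w < 2 * a -> exists l, cdiff g w l) ->
  (forall w, cabs w < 2 * a -> cabs (g w) <= M) ->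
  exists c, [/\ forall k, cabs (c k) <= 2 * M / a ^+ k, conv c a &
   forall z, cabs z < a -> psum c z = g z].
Proof.
move=> a0 gd gM; exists (taylor_coef a g).
have [|H1 H2] := taylor a0 gd (M := M).
  by apply: square_edgesP => // w _ wa _ _; exact: gM.
by split=> //; [exact: conv_bnd H1|move=> z /H2 /psumE].
Qed.

Lemma taylor_ex g a : 0 < a ->
  (forall w, cabs w < 2 * a -> exists l, cdiff g w l) ->
  exists2 c, conv c a & forall z, cabs z < a -> psum c z = g z.
Proof.
move=> a0 gd.
have gE : square_edges (ccont g) a.
  by apply: square_edgesP => // w _ wa _ _; have [m /ccont_cdiff] := gd w wa.
have aa : - a <= a by lra.
have [M1 H1] := rcont_bounded aa (fun t ht => rcont_h (proj1 (proj1 gE t ht))).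
have [M2 H2] := rcont_bounded aa (fun t ht => rcont_h (proj2 (proj1 gE t ht))).
have [M3 H3] := rcont_bounded aa (fun t ht => rcont_v (proj1 (proj2 gE t ht))).
have [M4 H4] := rcont_bounded aa (fun t ht => rcont_v (proj2 (proj2 gE t ht))).
have [|K1 K2] := taylor a0 gd (M := Num.max (Num.max M1 M2) (Num.max M3 M4)).
  by split=> t ht; rewrite !le_max ?H1 ?H2 ?H3 ?H4 ?orbT.
by exists (taylor_coef a g); [exact: conv_bnd K1|move=> z /K2 /psumE].
Qed.

(** Along a ray the modulus of a zero-free [g] obeys the linear equation whose
    solution is the exponential of [Re l], where [l' = g' / g]. *)
Lemma cabs_exp_primitive g (E l : C -> C) a z : cabs z < a ->
  (forall w, cabs w < a -> cdiff g w (E w * g w)) ->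
  (forall w, cabs w < a -> cdiff l w (E w)) -> l 0 = 0 ->
  cabs (g z) ^+ 2 = cabs (g 0) ^+ 2 * expR (2 * Re (l z)).
Proof.
move=> za gd ld l0.
have tz (t : R) : 0 <= t <= 1 -> cabs (0 + t%:C%C * z) < a.
  move=> /andP[t0 t1]; rewrite add0r cabsM cabs_real ger0_norm//.
  by apply: le_lt_trans za; rewrite ler_piMl ?cabs_ge0.
pose G (t : R) := g (0 + t%:C%C * z); pose L (t : R) := l (0 + t%:C%C * z).
pose f (t : R) : R := (Re (G t) ^+ 2 + Im (G t) ^+ 2) * expR (- (2 * Re (L t))).
have fd (t : R) : 0 <= t <= 1 -> is_derive t 1 f 0.
  move=> ht; have wa := tz t ht; set w := 0 + t%:C%C * z in wa.
  have [g1 g2] := rdiff_line (gd w wa); have [l1 _] := rdiff_line (ld w wa).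
  have E1 : is_derive t 1 (fun t => expR (- (2 * Re (L t))))
     (expR (- (2 * Re (L t))) * (- (2 * Re (E w * z)))).
    have D : is_derive t 1 (fun t => - (2 * Re (L t))) (- (2 * Re (E w * z))).
      exact: (is_deriveN (is_deriveZ 2 l1)).
    exact: (is_derive1_comp (is_derive_expR _) D).
  have := is_deriveM (is_deriveD (is_deriveX 2 g1) (is_deriveX 2 g2)) E1.
  have -> : (fun t : R => Re (G t)) ^+ 2 + (fun t : R => Im (G t)) ^+ 2 =
     (fun t : R => Re (G t) ^+ 2 + Im (G t) ^+ 2).
    by apply/funext => s; rewrite !expr2.
  move=> H; apply: is_derive_eq H _; rewrite /GRing.scale /= -/w -/(G t) -/(L t).
  by rewrite !ReM !ImM !ReM; ring.
have [||c _] := @MVT_segment R f (fun=> 0) 0 1 ler01.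
- by move=> t; rewrite in_itv /= => /andP[t0 t1]; apply: fd; rewrite !ltW.
- apply: continuous_in_subspaceT => t; rewrite inE /= in_itv /= => ht.
  by apply: is_derive_continuous; exact: fd.
rewrite mul0r => /eqP; rewrite subr_eq0 => /eqP.
rewrite /f /G /L !mul0r !addr0 !mul1r add0r l0 -!sqr_cabs mulr0 oppr0 expR0 mulr1.
by move=> <-; rewrite -mulrA -expRD addNr expR0 mulr1.
Qed.

(** A Borel-Caratheodory bound.  With [l] the logarithm of [g / g 0] and [A]
    above [Re l], the map [l / (2 A - l)] is bounded by 1 and vanishes at 0, so
    it is at most 2/9 on a much smaller disc. *)
Theorem zero_free_lower g (r M m : R) : 0 < r -> 0 < m ->
  (forall w, cabs w < r -> exists l, cdiff g w l) ->
  (forall w, cabs w < r -> g w != 0) ->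
  (forall w, cabs w < r -> cabs (g w) <= M) -> m <= cabs (g 0) ->
  forall z, cabs z <= r / 80 -> (cabs (g z))^-1 <= expR 1 * M / m ^+ 2.
Proof.
move=> r0 m0 gd gn gM gm z zr.
pose a1 := r / 2; have a10 : 0 < a1 by rewrite /a1; lra.
have [|c cc cE] := taylor_ex (g := g) a10.
  by move=> w wa; apply: gd; rewrite /a1 in wa; lra.
have cp w : cabs w < a1 -> cdiff g w (psum (dcoef c) w).
  move=> wa; apply: (cdiff_ext (d := a1 - cabs w)) (psum_cdiff cc wa); first by lra.
  by move=> h hd; apply: cE; have := cabsD w h; lra.
pose E w := psum (dcoef c) w / g w.
pose a2 := r / 4; have a20 : 0 < a2 by rewrite /a2; lra.
have [|e ec eE] := taylor_ex (g := E) a20.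
  move=> w wa; have wa1 : cabs w < a1 by rewrite /a2 in wa; rewrite /a1; lra.
  have gw : g w != 0 by apply: gn; rewrite /a1 in wa1; lra.
  by eexists; apply: cdiff_div gw (psum_cdiff (conv_dcoef cc) wa1) (cp _ wa1).
pose l := psum (icoef e).
have ld w : cabs w < a2 -> cdiff l w (E w).
  move=> wa; have := psum_cdiff (conv_icoef ec) wa.
  by rewrite dcoefK eE.
have l0 : l 0 = 0 by rewrite /l psum0.
have M0 : m <= M by apply: (le_trans gm); apply: gM; rewrite cabs0.
have Mp : 0 < M by lra.
have mod w : cabs w < a2 -> cabs (g w) ^+ 2 = cabs (g 0) ^+ 2 * expR (2 * Re (l w)).
  move=> wa; apply: cabs_exp_primitive (ld) l0; first exact: wa.
  move=> v va; rewrite /E divfK; last by apply: gn; rewrite /a2 in va; lra.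
  by apply: cp; rewrite /a2 in va; rewrite /a1; lra.
pose A := ln (M / m) + 1.
have lnM : 0 <= ln (M / m) by rewrite ln_ge0// ler_pdivlMr// mul1r.
have A0 : 0 < A by rewrite /A; lra.
have lA w : cabs w < a2 -> Re (l w) < A.
  move=> wa; rewrite ltNge; apply/negP => Al.
  have := mod w wa; apply/eqP; rewrite lt_eqF//.
  have gwM : cabs (g w) ^+ 2 <= M ^+ 2.
    by rewrite lerXn2r ?nnegrE ?cabs_ge0 ?(ltW Mp)// gM//; rewrite /a2 in wa; lra.
  apply: (le_lt_trans gwM).
  have : m ^+ 2 * expR (2 * Re (l w)) <= cabs (g 0) ^+ 2 * expR (2 * Re (l w)).
    by rewrite ler_wpM2r ?expR_ge0// lerXn2r ?nnegrE ?cabs_ge0 ?(ltW m0).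
  apply: lt_le_trans.
  have -> : M ^+ 2 = m ^+ 2 * expR (2 * ln (M / m)).
    rewrite mulr2n mulrDl mul1r expRD lnK ?posrE ?divr_gt0//.
    by field; rewrite gt_eqF.
  by rewrite ltr_pM2l ?exprn_gt0// ltr_expR; move: Al; rewrite /A; lra.
pose D w := 2 * A%:C%C - l w.
have ReDw w : Re (D w) = 2 * A - Re (l w).
  have -> : D w = (2 * A)%:C%C - l w by rewrite /D rmorphM rmorph_nat.
  by rewrite ReD ReN.
have Dn w : cabs w < a2 -> D w != 0.
  move=> /lA lw; apply/eqP => D0; have := ReDw w; rewrite D0 /=; lra.
pose phi w := l w / D w.
pose a3 := r / 8; have a30 : 0 < a3 by rewrite /a3; lra.
have [|w wa|p [p1 p2 p3]] := @taylor_bnd phi a3 1 a30.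
- move=> w wa; have wa2 : cabs w < a2 by rewrite /a3 in wa; rewrite /a2; lra.
  have lw := ld w wa2; eexists.
  exact: cdiff_div (Dn w wa2) lw (cdiffB (cdiff_cst (2 * A%:C%C) w) lw).
- have wa2 : cabs w < a2 by rewrite /a3 in wa; rewrite /a2; lra.
  rewrite cabsM cabsV ler_pdivrMr ?cabs_gt0 ?Dn// mul1r.
  rewrite -ler_sqr ?nnegrE ?cabs_ge0// !sqr_cabs ReDw.
  have -> : Im (D w) = - Im (l w).
    have -> : D w = (2 * A)%:C%C - l w by rewrite /D rmorphM rmorph_nat.
    by rewrite ImD ImN add0r.
  by rewrite sqrrN lerD2r; have := lA w wa2; nra.
have za3 : cabs z < a3 by rewrite /a3; lra.
have za2 : cabs z < a2 by rewrite /a2; lra.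
have phi_le : cabs (phi z) <= 2 / 9.
  have L := psum_clim p2 za3; rewrite p3// in L.
  apply: (clim_le L); exists 1%N => -[//|n] _.
  have p00 : p 0%N = 0 by rewrite -psum0 p3 ?cabs0// /phi l0 mul0r.
  rewrite big_ord_recl /= p00 mul0r add0r.
  apply: (le_trans (cabs_sum _ _ _)).
  pose q : R := 10^-1.
  apply: (@le_trans _ _ (\sum_(i < n) 2 * q * q ^+ i)).
    apply: ler_sum => i _; rewrite cabsM cabsX.
    apply: (@le_trans _ _ (2 * 1 / a3 ^+ i.+1 * cabs z ^+ i.+1)).
      by rewrite ler_wpM2r ?exprn_ge0 ?cabs_ge0.
    rewrite mulr1 -[2 * q * _]mulrA -exprS -mulrA ler_wpM2l//.
    rewrite mulrC -expr_div_n lerXn2r ?nnegrE ?divr_ge0 ?cabs_ge0 ?(ltW a30) ?/q//.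
      exact: ltW.
    by rewrite ler_pdivrMr// /a3; lra.
  rewrite -mulr_sumr.
  have q0 : 0 <= q by rewrite /q; lra.
  have q1 : q < 1 by rewrite /q; lra.
  have := geo_sum_le n q0 q1; have -> : (1 - q)^-1 = 10 / 9 by rewrite /q; field.
  by rewrite /q; lra.
have lz : cabs (l z) <= A.
  have : cabs (l z) = cabs (phi z) * cabs (D z).
    by rewrite -cabsM /phi divfK ?Dn.
  have : cabs (D z) <= 2 * A + cabs (l z).
    apply: (le_trans (cabsB _ _)); rewrite cabsM cabs_real gtr0_norm//.
    by rewrite cabs_nat.
  have := cabs_ge0 (D z); have := cabs_ge0 (phi z); have := cabs_ge0 (l z).
  by move: phi_le; nra.
have gz0 : 0 < cabs (g z) by rewrite cabs_gt0 gn// (le_lt_trans zr)//; lra.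
have low : m ^+ 2 / (expR 1 * M) <= cabs (g z).
  have eM : 0 < expR 1 * M by rewrite mulr_gt0 ?expR_gt0.
  rewrite -ler_sqr ?nnegrE ?cabs_ge0 ?divr_ge0 ?sqr_ge0 ?(ltW eM)//.
  rewrite mod//; apply: (@le_trans _ _ (m ^+ 2 * expR (2 * (- A)))).
    have -> : expR (2 * (- A)) = (expR A ^+ 2)^-1.
      by rewrite mulrN expRN (_ : 2 * A = A + A) ?expRD ?expr2//; ring.
    have -> : expR A = expR 1 * M / m.
      by rewrite /A expRD lnK ?posrE ?divr_gt0//; ring.
    rewrite le_eqVlt; apply/orP; left; apply/eqP; field.
    by rewrite !gt_eqF ?expR_gt0.
  rewrite ler_pM ?sqr_ge0 ?expR_ge0//; first by rewrite lerXn2r ?nnegrE ?cabs_ge0 ?(ltW m0).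
  rewrite ler_expR ler_pM2l//.
  by have := cabs_Re (l z); rewrite ler_norml => /andP[+ _]; lra.
rewrite -[leRHS]invrK lef_pV2 ?posrE//.
  by rewrite invfM invrK mulrC.
by rewrite invr_gt0 !divr_gt0 ?mulr_gt0 ?expR_gt0 ?exprn_gt0.
Qed.

End ZeroFree.

(** * Moebius and von Mangoldt functions *)

Section Divisors.
Local Open Scope nat_scope.

(** Induction peeling off a full prime power, the form suited to multiplicative functions. *)
Lemma prime_part_ind (P : nat -> Prop) : P 1 ->
  (forall p k m, prime p -> 0 < k -> 0 < m -> ~~ (p %| m) -> P m -> P (p ^ k * m)) ->
  forall n, 0 < n -> P n.
Proof.
move=> P1 Pp n; elim/ltn_ind: n => n IH n0.
have [n1|n1] := leqP n 1; first by have -> : n = 1 by apply/eqP; rewrite eqn_leq n1.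
have p_pr := pdiv_prime n1; set p := pdiv n in p_pr.
have [m cpm nE] := pfactor_coprime p_pr n0.
have k0 : 0 < logn p n by rewrite logn_gt0 mem_primes p_pr n0 pdiv_dvd.
have m0 : 0 < m by move: n0; rewrite nE muln_gt0 => /andP[].
rewrite nE mulnC; apply: Pp => //; first by rewrite -prime_coprime.
apply: IH => //; rewrite nE ltn_Pmulr//.
by rewrite -(expn0 p) ltn_exp2l// prime_gt1.
Qed.

Lemma sum_divisors_prime_part (V : nmodType) (p k m : nat) (h : nat -> V) :
  prime p -> 0 < m -> ~~ (p %| m) ->
  (\sum_(d <- divisors (p ^ k * m)) h d =
   \sum_(i < k.+1) \sum_(d <- divisors m) h (p ^ i * d)%N)%R.
Proof.
move=> p_pr m0 pm; have p0 := prime_gt0 p_pr.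
have n0 : 0 < p ^ k * m by rewrite muln_gt0 expn_gt0 p0.
have pd d : d \in divisors m -> ~~ (p %| d).
  by rewrite -dvdn_divisors// => dm; apply: contra pm => /dvdn_trans; apply.
have logE i d : d \in divisors m -> logn p (p ^ i * d) = i.
  move=> dm; have d0 : 0 < d.
    by move: dm; rewrite -dvdn_divisors//; exact: dvdn_gt0.
  rewrite lognM ?expn_gt0 ?p0//. rewrite pfactorK//.
  by rewrite lognE (negPf (pd _ dm)) !andbF addn0.
rewrite -[RHS](big_mkord xpredT (fun i => \sum_(d <- divisors m) h (p ^ i * d)%N)%R).
rewrite -(@big_allpairs_dep _ _ _ _ _ _ (fun i d => p ^ i * d) (index_iota 0 k.+1)
  (fun=> divisors m) h).
apply: perm_big; apply: uniq_perm; first exact: divisors_uniq.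
  apply: allpairs_uniq; [exact: iota_uniq|exact: divisors_uniq|].
  move=> [i d] [j e] /allpairsPdep[i1 [d1 [_ d1m [-> ->]]]].
  move=> /allpairsPdep[j1 [e1 [_ e1m [-> ->]]]] /= E.
  have ij : i1 = j1 by rewrite -(logE i1 d1)// E logE.
  rewrite ij in E *; congr pair; apply/eqP.
  by rewrite -(eqn_pmul2l (_ : 0 < p ^ j1)) ?expn_gt0 ?p0// E.
move=> d; rewrite -dvdn_divisors//; apply/idP/allpairsPdep => [dn|].
  have d0 := dvdn_gt0 n0 dn.
  have [e cpe dE] := pfactor_coprime p_pr d0.
  exists (logn p d), e; split; last by rewrite mulnC.
    rewrite mem_index_iota /= ltnS.
    have := dvdn_leq_log p n0 dn.
    rewrite lognM ?expn_gt0 ?p0// pfactorK//.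
    by rewrite (lognE p m) (negPf pm) !andbF addn0.
  rewrite -dvdn_divisors//; have : e %| p ^ k * m.
    by apply: dvdn_trans dn; rewrite dE dvdn_mulr.
  by rewrite Gauss_dvdr// coprime_sym coprimeXl.
move=> [i [e []]]; rewrite mem_index_iota /= ltnS => ik em ->.
by rewrite dvdn_mul ?dvdn_exp2l// dvdn_divisors.
Qed.

Definition sqf n := (0 < n) && all (fun p => logn p n == 1) (primes n).

(** Multiplying by a prime is the one operation through which squarefree integers are used. *)
Lemma sqf_mulp p d : prime p -> 0 < d -> sqf (p * d) = ~~ (p %| d) && sqf d.
Proof.
move=> p_pr d0; have p0 := prime_gt0 p_pr; rewrite /sqf muln_gt0 p0 d0 /=.
have pE q : prime q -> logn q (p * d) = (q == p) + logn q d.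
  by move=> q_pr; rewrite lognM// logn_prime.
apply/allP/andP => [H|[pd /allP H] q].
  have pd : ~~ (p %| d).
    apply/negP => pd; have := H p; rewrite primesM// primes_prime// inE eqxx.
    move=> /(_ isT); rewrite pE// eqxx; have : 0 < logn p d.
      by rewrite logn_gt0 mem_primes p_pr d0.
    by case: (logn p d).
  split=> //; apply/allP => q qd; have q_pr : prime q by move: qd; rewrite mem_primes => /andP[].
  have := H q; rewrite primesM// qd orbT => /(_ isT); rewrite pE//.
  case: (q =P p) => // qp; move: qd; rewrite qp mem_primes (negPf pd) !andbF//.
rewrite primesM// primes_prime// inE => /orP[/eqP ->|qd].
  by rewrite pE// eqxx lognE (negPf pd) !andbF.
have q_pr : prime q by move: qd; rewrite mem_primes => /andP[].
rewrite pE//; case: (q =P p) => [qp|_]; last by rewrite add0n H.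
by move: qd; rewrite qp mem_primes (negPf pd) !andbF.
Qed.

Lemma size_primes_mulp p d : prime p -> 0 < d -> ~~ (p %| d) ->
  size (primes (p * d)) = (size (primes d)).+1.
Proof.
move=> p_pr d0 pd; have p0 := prime_gt0 p_pr.
rewrite -[RHS]/(size (p :: primes d)); apply/perm_size/uniq_perm.
- exact: primes_uniq.
- by rewrite /= primes_uniq mem_primes (negPf pd) !andbF.
by move=> q; rewrite primesM// primes_prime// !inE.
Qed.

Definition issq n := has (fun i => i ^ 2 == n) (iota 0 n.+1).

Lemma issqP n : reflect (exists i, n = i ^ 2) (issq n).
Proof.
apply: (iffP hasP) => [[i _ /eqP <-]|[i ->]]; first by exists i.
by exists i => //; rewrite mem_iota /= add0n ltnS; case: i => // i; rewrite -mulnn leq_pmulr.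
Qed.

Lemma issq_prime_part p k m : prime p -> 0 < m -> ~~ (p %| m) ->
  issq (p ^ k * m) = ~~ odd k && issq m.
Proof.
move=> p_pr m0 pm; have p0 := prime_gt0 p_pr.
have pl j x : 0 < x -> ~~ (p %| x) -> logn p (p ^ j * x) = j.
  move=> x0 px; rewrite lognM ?expn_gt0 ?p0// pfactorK//.
  by rewrite lognE (negPf px) !andbF addn0.
apply/issqP/andP => [[x E]|[k_even /issqP[y ->]]].
  have x0 : 0 < x.
    by case: x E => // /eqP; rewrite muln_eq0 expn_eq0 eqn0Ngt p0 eqn0Ngt m0.
  have [y cpy xE] := pfactor_coprime p_pr x0.
  have y0 : 0 < y by move: x0; rewrite xE muln_gt0 => /andP[].
  have py : ~~ (p %| y ^ 2) by rewrite Euclid_dvdX// andbT -prime_coprime.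
  have E' : p ^ k * m = p ^ (logn p x).*2 * y ^ 2.
    by rewrite E {1}xE expnMn -expnM muln2 mulnC.
  have kE : k = (logn p x).*2.
    by rewrite -(pl k m)// E' pl// expn_gt0 y0.
  split; first by rewrite kE odd_double.
  apply/issqP; exists y; apply/eqP.
  by rewrite -(eqn_pmul2l (_ : 0 < p ^ k)) ?expn_gt0 ?p0// E' -kE.
exists (p ^ k./2 * y); rewrite expnMn -expnM muln2; congr (_ ^ _ * _).
by rewrite -[LHS]odd_double_half (negPf k_even).
Qed.

End Divisors.

Section Mobius.
Variable R : realType.
Local Notation C := R[i].

Definition mu n : R := if sqf n then (-1) ^+ size (primes n) else 0.
Definition mu2 n : R := (sqf n)%:R.

Lemma mu1 : mu 1 = 1. Proof. by []. Qed.
Lemma mu21 : mu2 1 = 1. Proof. by []. Qed.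

Lemma sqr_mu n : mu n ^+ 2 = mu2 n.
Proof. by rewrite /mu /mu2; case: ifP => _; rewrite ?expr0n// sqrr_sign. Qed.

Lemma norm_mu n : `|mu n| <= 1.
Proof. by rewrite /mu; case: ifP => _; rewrite ?normr0// normr_sign. Qed.

Lemma mu_mulp p d : prime p -> (0 < d)%N ->
  mu (p * d) = if (p %| d)%N then 0 else - mu d.
Proof.
move=> p_pr d0; rewrite /mu sqf_mulp//; case: (boolP (p %| d)%N) => //= pd.
by case: ifP => _; rewrite ?oppr0// size_primes_mulp// exprS mulN1r.
Qed.

Lemma mu2_mulp p d : prime p -> (0 < d)%N ->
  mu2 (p * d) = if (p %| d)%N then 0 else mu2 d.
Proof.
by move=> p_pr d0; rewrite /mu2 sqf_mulp//; case: (boolP (p %| d)%N).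
Qed.

(** For a function supported on squarefree integers only the exponents 0 and 1 of [p] contribute. *)
Lemma sum_sqf_prime_part (g f : nat -> R) (s : R) p k m :
  (forall d, (0 < d)%N -> g (p * d)%N = if (p %| d)%N then 0 else s * g d) ->
  prime p -> (0 < k)%N -> (0 < m)%N -> ~~ (p %| m)%N ->
  \sum_(d <- divisors (p ^ k * m)) g d * f d =
  \sum_(d <- divisors m) g d * (f d + s * f (p * d)%N).
Proof.
move=> gp p_pr k0 m0 pm; rewrite sum_divisors_prime_part//.
have p0 := prime_gt0 p_pr.
case: k k0 => // k _; rewrite big_ord_recl big_ord_recl /= [X in _ + (_ + X)]big1 ?addr0; last first.
  move=> i _; rewrite big_seq big1// => d; rewrite -dvdn_divisors// => /(dvdn_gt0 m0) d0.
  rewrite /bump /= !add1n expnS -mulnA gp; last by rewrite muln_gt0 expn_gt0 p0 d0.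
  by rewrite expnS -mulnA dvdn_mulr// mul0r.
rewrite -big_split /= big_seq [RHS]big_seq; apply: eq_bigr => d.
rewrite -dvdn_divisors// => dm; have d0 := dvdn_gt0 m0 dm.
rewrite expn0 mul1n /bump /= add1n expn1 gp//.
case: ifP => [pd|_]; last by ring.
by move: pm; rewrite (dvdn_trans pd dm).
Qed.

Lemma sum_mu_divisors n : (0 < n)%N -> \sum_(d <- divisors n) mu d = (n == 1)%:R.
Proof.
move: n; apply: prime_part_ind => [|p k m p_pr k0 m0 pm _].
  by rewrite (_ : divisors 1 = [:: 1%N])// big_seq1.
have -> : \sum_(d <- divisors (p ^ k * m)) mu d = \sum_(d <- divisors (p ^ k * m)) mu d * 1.
  by apply: eq_bigr => d _; rewrite mulr1.
rewrite (@sum_sqf_prime_part mu (fun=> 1) (-1))//; last first.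
  by move=> d d0; rewrite mu_mulp// mulN1r.
rewrite big1; last by move=> d _; rewrite mulr1 subrr mulr0.
rewrite gtn_eqF// (leq_trans (prime_gt1 p_pr))//.
by rewrite -{1}(muln1 p) leq_mul// -{1}(expn1 p) leq_pexp2l// prime_gt0.
Qed.

(** The von Mangoldt function, as the Dirichlet convolution of the Moebius
    function and the logarithm. *)
Definition mangoldt n : R := \sum_(d <- divisors n) mu d * ln ((n %/ d)%N%:R).

(** For [n = p ^ k * m] with [p] not dividing [m], pairing [d] with [p * d] leaves [log p] times
    the sum of the Moebius function over the divisors of [m]. *)
Lemma mangoldt_ge0 n : (0 < n)%N -> 0 <= mangoldt n.
Proof.
move: n; apply: prime_part_ind => [|p k m p_pr k0 m0 pm _].
  by rewrite /mangoldt (_ : divisors 1 = [:: 1%N])// big_seq1 divn1 ln1 mulr0.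
have p0 := prime_gt0 p_pr.
rewrite /mangoldt (@sum_sqf_prime_part mu
  (fun d => ln ((p ^ k * m %/ d)%N%:R)) (-1))//; last first.
  by move=> d d0; rewrite mu_mulp// mulN1r.
have -> : \sum_(d <- divisors m) mu d * (ln ((p ^ k * m %/ d)%N%:R) +
     -1 * ln ((p ^ k * m %/ (p * d))%N%:R)) = \sum_(d <- divisors m) mu d * ln (p%:R).
  rewrite big_seq [RHS]big_seq; apply: eq_bigr => d; rewrite -dvdn_divisors// => dm.
  have d0 := dvdn_gt0 m0 dm; congr (_ * _).
  have md0 : (0 < m %/ d)%N by rewrite divn_gt0// dvdn_leq.
  case: k k0 => // k _; have dk : (d %| p ^ k * m)%N by rewrite dvdn_mull.
  rewrite expnS -mulnA divnMl// -muln_divA// natrM lnM ?posrE ?ltr0n//.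
    by ring.
  by rewrite divn_gt0// dvdn_leq// muln_gt0 expn_gt0 p0.
rewrite -mulr_suml sum_mu_divisors// mulr_ge0//.
by rewrite ln_ge0// ler1n.
Qed.

(** Every integer is uniquely a squarefree integer times a square; here proved one prime at
    a time, by the parity of the exponent. *)
Lemma sum_mu2_issq n : (0 < n)%N ->
  \sum_(d <- divisors n) mu2 d * (issq (n %/ d)%N)%:R = 1.
Proof.
move: n; apply: prime_part_ind => [|p k m p_pr k0 m0 pm IH].
  by rewrite (_ : divisors 1 = [:: 1%N])// big_seq1 divn1 mu21 mul1r.
have p0 := prime_gt0 p_pr.
rewrite (@sum_sqf_prime_part mu2 (fun d => (issq (p ^ k * m %/ d)%N)%:R) 1)//; last first.
  by move=> d d0; rewrite mu2_mulp// mul1r.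
rewrite -[RHS]IH big_seq [RHS]big_seq; apply: eq_bigr => d; rewrite -dvdn_divisors// => dm.
have d0 := dvdn_gt0 m0 dm; congr (_ * _).
have md0 : (0 < m %/ d)%N by rewrite divn_gt0// dvdn_leq.
have pmd : ~~ (p %| m %/ d)%N.
  by apply: contra pm => /dvdn_trans; apply; rewrite dvdn_div.
case: k k0 => // k _; rewrite {2}expnS -mulnA divnMl// -!muln_divA// !issq_prime_part//.
by rewrite /= negbK; case: (odd k); case: (issq _); rewrite /= ?mul1r ?addr0 ?add0r.
Qed.

End Mobius.

(** * Dirichlet convolution *)

Section Convolution.
Variable V : comNzRingType.
Implicit Types (a b : nat -> V).

Definition dsum a N : V := \sum_(1 <= n < N) a n.
Definition dconv a b n : V := \sum_(d <- divisors n) a d * b (n %/ d)%N.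

Lemma dsumS a N : (0 < N)%N -> dsum a N.+1 = dsum a N + a N.
Proof. by move=> N0; rewrite /dsum big_nat_recr. Qed.

(** Dirichlet's hyperbola: pairs [(d, e)] grouped by their product. *)
Lemma dsum_dconv a b N : dsum (dconv a b) N =
  \sum_(1 <= d < N) \sum_(1 <= e < N | (d * e < N)%N) a d * b e.
Proof.
transitivity (\sum_(1 <= n < N) \sum_(1 <= d < N) \sum_(1 <= e < N | (d * e == n)%N) a d * b e).
  rewrite /dsum big_nat [RHS]big_nat; apply: eq_bigr => n /andP[n0 nN].
  transitivity (\sum_(1 <= d < N | (d %| n)%N) a d * b (n %/ d)%N).
    rewrite /dconv -[RHS]big_filter; apply: perm_big; apply: uniq_perm.
    - exact: divisors_uniq.
    - by rewrite filter_uniq// iota_uniq.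
    move=> d; rewrite -dvdn_divisors// mem_filter mem_index_iota.
    case: (boolP (d %| n)%N) => //= dn; rewrite (dvdn_gt0 n0 dn)/=.
    by rewrite (leq_ltn_trans _ nN)// dvdn_leq.
  rewrite big_mkcond /= big_nat [RHS]big_nat; apply: eq_bigr => d /andP[d0 dN].
  case: (boolP (d %| n)%N) => [dn|dn].
    have nd0 : (0 < n %/ d)%N by rewrite divn_gt0// dvdn_leq.
    have ndN : (n %/ d < N)%N by rewrite (leq_ltn_trans (leq_div _ _)).
    rewrite big_mkcond (bigD1_seq (n %/ d)%N) ?iota_uniq ?mem_index_iota ?nd0//=.
    rewrite mulnC divnK// eqxx big1 ?addr0// => e /negP ene.
    by case: eqP => // de; case: ene; apply/eqP; rewrite -de mulKn.
  by rewrite big1// => e /eqP de; case/negP: dn; rewrite -de dvdn_mulr.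
rewrite exchange_big_nat /=; apply: eq_big_nat => d /andP[d0 dN].
rewrite (exchange_big_dep_nat predT)//= [RHS]big_mkcond big_nat [RHS]big_nat /=.
apply: eq_bigr => e /andP[e0 eN].
case: ifP => de; last first.
  rewrite big_nat_cond big1// => n /andP[/andP[_ nN] /eqP den].
  by move: nN; rewrite -den de.
rewrite big_mkcond (bigD1_seq (d * e)%N) ?iota_uniq ?mem_index_iota ?muln_gt0 ?d0 ?e0//=.
by rewrite eqxx big1 ?addr0// => n; rewrite eq_sym; case: eqP.
Qed.

End Convolution.

Section DirichletProduct.
Variable R : realType.
Local Notation C := R[i].
Implicit Types (a b : nat -> C).

Lemma dsum_bnd_cauchy (v : nat -> R) (B : R) : (forall n, 0 <= v n) ->
  (forall N, dsum v N <= B) -> forall e : R, 0 < e -> exists N0, forall N, (N0 <= N)%N ->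
  dsum v N - dsum v N0 <= e.
Proof.
move=> v0 vB e e0.
have nd : nondecreasing_seq (dsum v).
  apply/nondecreasing_seqP => n; case: n => [|n].
    by rewrite /dsum !big_geq.
  by rewrite (dsumS _ (ltn0Sn n)) lerDl.
have cv : cvgn (dsum v).
  by apply: nondecreasing_is_cvgn => //; exists B => _ [n _ <-].
have e2 : 0 < e / 2 by lra.
have /cvgrPdist_le /(_ _ e2)[N0 _ H] := cv.
exists N0 => N NN0; have := H N0 (leqnn _); have := H N NN0.
by rewrite /= !ler_norml => /andP[h1 h2] /andP[h3 h4]; lra.
Qed.

(** Convolution of absolutely convergent sums: up to N, the sum of the
    convolution differs from the product of the sums up to M (for M^2 < N) by at
    most the growth of the product of the absolute sums from M to N. *)
Theorem dirichlet_product a b (A B : R) la lb :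
  (forall N, dsum (fun n => cabs (a n)) N <= A) ->
  (forall N, dsum (fun n => cabs (b n)) N <= B) ->
  clim (dsum a) la -> clim (dsum b) lb ->
  clim (dsum (dconv a b)) (la * lb).
Proof.
move=> hA hB ca cb e e0.
set va := fun n => cabs (a n) in hA *; set vb := fun n => cabs (b n) in hB *.
have va0 n : 0 <= va n by exact: cabs_ge0.
have vb0 n : 0 <= vb n by exact: cabs_ge0.
have A0 : 0 <= A by have := hA 0%N; rewrite /dsum big_geq.
have B0 : 0 <= B by have := hB 0%N; rewrite /dsum big_geq.
have S0 : 0 < A + B + 1 by lra.
pose e1 := Num.min 1 (e / 4 / (A + B + 1)).
have e10 : 0 < e1 by rewrite lt_min ltr01 !divr_gt0.
have : e1 <= e1 by []; rewrite {2}/e1 le_min ler_pdivlMr// => /andP[e11 e1e].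
have [N1 H1] := dsum_bnd_cauchy va0 hA e10.
have [N2 H2] := dsum_bnd_cauchy vb0 hB e10.
have [N3 H3] := ca _ e10; have [N4 H4] := cb _ e10.
pose M := maxn (maxn N1 N2) (maxn N3 N4).
have nd (v : nat -> R) m n : (forall n, 0 <= v n) -> (m <= n)%N -> dsum v m <= dsum v n.
  move=> v0 mn; have [m0|m0] := posnP m.
    by rewrite m0 [leLHS]/dsum big_geq// sumr_ge0.
  by rewrite /dsum (big_cat_nat m0 mn)/= lerDl sumr_ge0.
exists (M * M).+1 => N MN.
have MN' : (M <= N)%N by apply: leq_trans MN; case: (M) => // m; rewrite leqW// leq_pmulr.
have tA : dsum va N - dsum va M <= e1.
  have h1 := H1 N (leq_trans (leq_trans (leq_maxl _ _) (leq_maxl _ _)) MN').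
  have := nd va N1 M va0 (leq_trans (leq_maxl N1 N2) (leq_maxl _ _)); lra.
have tB : dsum vb N - dsum vb M <= e1.
  have h2 := H2 N (leq_trans (leq_trans (leq_maxr _ _) (leq_maxl _ _)) MN').
  have := nd vb N2 M vb0 (leq_trans (leq_maxr N1 N2) (leq_maxl _ _)); lra.
have cA : cabs (dsum a M - la) <= e1.
  by apply: H3; rewrite (leq_trans (leq_maxl N3 N4))// leq_maxr.
have cB : cabs (dsum b M - lb) <= e1.
  by apply: H4; rewrite (leq_trans (leq_maxr N3 N4))// leq_maxr.
have D : cabs (dsum (dconv a b) N - dsum a M * dsum b M) <=
    dsum va N * dsum vb N - dsum va M * dsum vb M.
  have full (u v : nat -> C) K : (K <= N)%N -> dsum u K * dsum v K =
     \sum_(1 <= d < N) \sum_(1 <= e < N | (d < K)%N && (e < K)%N) u d * v e.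
    move=> KN; rewrite /dsum (big_nat_widen 1 K N predT)//= big_distrlr /=.
    rewrite big_mkcond; apply: eq_bigr => d _; case: ifP => dK /=.
      by rewrite (big_nat_widen 1 K N predT)//=.
    by rewrite big_pred0.
  have fullr (u v : nat -> R) K : (K <= N)%N -> dsum u K * dsum v K =
     \sum_(1 <= d < N) \sum_(1 <= e < N | (d < K)%N && (e < K)%N) u d * v e.
    move=> KN; rewrite /dsum (big_nat_widen 1 K N predT)//= big_distrlr /=.
    rewrite big_mkcond; apply: eq_bigr => d _; case: ifP => dK /=.
      by rewrite (big_nat_widen 1 K N predT)//=.
    by rewrite big_pred0.
  rewrite dsum_dconv full// !fullr// -!sumrB.
  apply: (le_trans (cabs_sum _ _ _)); rewrite big_nat [leRHS]big_nat.
  apply: ler_sum => d /andP[d0 dN]; rewrite !(big_mkcond (fun e => _ && _)).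
  rewrite [X in X - _](big_mkcond (fun e => (d * e < N)%N)) -!sumrB.
  apply: (le_trans (cabs_sum _ _ _)); rewrite big_nat [leRHS]big_nat.
  apply: ler_sum => f /andP[f0 fN]; rewrite dN fN /=.
  case: (boolP ((d < M)%N && (f < M)%N)) => [/andP[dM fM]|_].
    have -> : (d * f < N)%N.
      by rewrite (leq_ltn_trans _ MN)// leq_mul// ltnW.
    by rewrite !subrr cabs0.
  case: ifP => _; rewrite ?subr0 ?cabsM// cabs0 mulr_ge0//.
have -> : dsum (dconv a b) N - la * lb =
  (dsum (dconv a b) N - dsum a M * dsum b M) +
  ((dsum a M - la) * dsum b M + la * (dsum b M - lb)) by ring.
apply: (le_trans (cabsD _ _)).
apply: (le_trans (lerD D (cabsD _ _))); rewrite !cabsM.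
have laA : cabs la <= A.
  apply: (clim_le ca); exists 0%N => n _; apply: le_trans (hA n).
  exact: cabs_sum.
have lbB : cabs (dsum b M) <= B by apply: le_trans (hB M); exact: cabs_sum.
have k1 : cabs (dsum a M - la) * cabs (dsum b M) <= e1 * B by rewrite ler_pM ?cabs_ge0.
have k2 : cabs la * cabs (dsum b M - lb) <= A * e1 by rewrite ler_pM ?cabs_ge0.
have k3 : dsum va N * dsum vb N - dsum va M * dsum vb M <= e1 * B + A * e1.
  have -> : dsum va N * dsum vb N - dsum va M * dsum vb M =
    (dsum va N - dsum va M) * dsum vb N + dsum va M * (dsum vb N - dsum vb M) by ring.
  have vM : 0 <= dsum va M by rewrite sumr_ge0.
  have vN : 0 <= dsum vb N by rewrite sumr_ge0.
  by rewrite lerD// ler_pM//; rewrite subr_ge0 nd.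
by move: k1 k2 k3 e1e; rewrite /va /vb; lra.
Qed.

(** For real completely multiplicative [xi] with values in {-1, 0, 1}, the
    function [1 * xi] is a product of geometric sums over prime powers. *)
Lemma sum_divisors_real_char (xi : nat -> R) :
  xi 1%N = 1 -> (forall m n, xi (m * n)%N = xi m * xi n) ->
  (forall n, [\/ xi n = 0, xi n = 1 | xi n = -1]) ->
  forall n, (0 < n)%N -> 0 <= \sum_(d <- divisors n) xi d /\
    (issq n -> 1 <= \sum_(d <- divisors n) xi d).
Proof.
move=> x1 xM xv; apply: prime_part_ind => [|p k m p_pr k0 m0 pm [IH1 IH2]].
  by rewrite (_ : divisors 1 = [:: 1%N])// big_seq1 x1.
have xX i : xi (p ^ i)%N = xi p ^+ i.
  by elim: i => [|i IH]; rewrite ?expn0 ?expr0// expnS xM IH exprS.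
have -> : \sum_(d <- divisors (p ^ k * m)) xi d =
    (\sum_(i < k.+1) xi p ^+ i) * \sum_(d <- divisors m) xi d.
  rewrite sum_divisors_prime_part// mulr_suml; apply: eq_bigr => i _.
  by rewrite mulr_sumr; apply: eq_bigr => d _; rewrite xM xX.
have G : 0 <= \sum_(i < k.+1) xi p ^+ i /\ (~~ odd k -> 1 <= \sum_(i < k.+1) xi p ^+ i).
  case: (xv p) => ->.
  - by rewrite big_ord_recl expr0 big1 ?addr0 // => i _; rewrite /= exprS mul0r.
  - have -> : \sum_(i < k.+1) (1 : R) ^+ i = k.+1%:R.
      by rewrite (eq_bigr (fun=> 1)) ?sumr_const ?card_ord// => i _; rewrite expr1n.
    by split=> [|_]; rewrite ?ler0n ?ler1n.
  have -> : \sum_(i < k.+1) (-1 : R) ^+ i = (~~ odd k)%:R.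
    elim: (k) => [|j IH]; first by rewrite big_ord_recl big_ord0 addr0.
    rewrite big_ord_recr /= IH -signr_odd /=.
    by case: (odd j); rewrite /= ?expr0 ?expr1 ?add0r ?subrr.
  by split=> [|->//]; rewrite ler0n.
case: G => G1 G2; split; first by rewrite mulr_ge0.
rewrite issq_prime_part// => /andP[/G2 g2 /IH2 i2].
by rewrite -[leLHS]mulr1 ler_pM.
Qed.

End DirichletProduct.

(** * Truncated exponentials and powers of integers *)

Section Exponentials.
Variable R : realType.
Implicit Types (x s t u : R).

Definition expT K x : R := \sum_(j < K) x ^+ j / j`!%:R.

(** This is [n ^ (- s)], and by [ln 0 = 0] it is 1 at [n = 0]. *)
Definition npow s n : R := expR (- (s * ln n%:R)).

Lemma expTE K x : expT K x = series (exp_coeff x) K.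
Proof. by rewrite /series /= big_mkord. Qed.

Lemma expT_ge0 K x : 0 <= x -> 0 <= expT K x.
Proof. by move=> x0; apply: sumr_ge0 => j _; rewrite divr_ge0 ?exprn_ge0. Qed.

Lemma expT_cvg x : expT ^~ x @ \oo --> expR x.
Proof.
have -> : expT ^~ x = series (exp_coeff x) by apply/funext => K; rewrite expTE.
exact: is_cvg_series_exp_coeff.
Qed.

Lemma expT_le_expR K x : 0 <= x -> expT K x <= expR x.
Proof.
move=> x0; rewrite expTE; apply: nondecreasing_cvgn_le.
  by apply: nondecreasing_series => n _ _; apply: exp_coeff_ge0.
exact: is_cvg_series_exp_coeff.
Qed.

Lemma exp_coeff_le k (eta x : R) : 0 < eta -> 0 <= x ->
  x ^+ k / k`!%:R <= eta ^- k * expR (eta * x).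
Proof.
move=> e0 x0; rewrite -ler_pdivrMl ?invr_gt0 ?exprn_gt0// invrK mulrA -exprMn.
have ex0 : 0 <= eta * x by rewrite mulr_ge0// ltW.
apply: le_trans (expT_le_expR k.+1 ex0); rewrite /expT big_ord_recr /= lerDr.
exact: expT_ge0.
Qed.

(** For [j >= K] the factor [t ^ (K - j)] is at least 1, so the tail is at most [t ^ K] times
    the whole series at [x / t] (Rankin's trick). *)
Lemma expR_tail K x t : 0 < t -> t <= 1 ->
  `|expR x - expT K x| <= t ^+ K * expR (`|x| / t).
Proof.
move=> t0 t1; apply/ler_addgt0Pr => e e0.
have /cvgrPdist_le /(_ e e0)[N _ HN] := @expT_cvg x.
have := HN (maxn N K) (leq_maxl _ _); set n := maxn N K => /= h1.
have Kn : (K <= n)%N by rewrite leq_maxr.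
have -> : expR x - expT K x = (expR x - expT n x) + (expT n x - expT K x) by ring.
apply: (le_trans (ler_normD _ _)); rewrite addrC lerD//.
rewrite /expT -(big_mkord xpredT (fun j => x ^+ j / j`!%:R)).
rewrite -(big_mkord xpredT (fun j => x ^+ j / j`!%:R)) (big_cat_nat (leq0n K) Kn)/=.
rewrite addrAC subrr add0r; apply: (le_trans (ler_norm_sum _ _ _)).
have xt : 0 <= `|x| / t by rewrite divr_ge0// ltW.
apply: (@le_trans _ _ (t ^+ K * \sum_(K <= j < n) (`|x| / t) ^+ j / j`!%:R)).
  rewrite mulr_sumr big_nat [leRHS]big_nat; apply: ler_sum => j /andP[Kj _].
  rewrite normrM normfV normrX (ger0_norm (ler0n _ _)) mulrA ler_wpM2r ?invr_ge0//.
  rewrite expr_div_n mulrA ler_pdivlMr ?exprn_gt0// mulrC ler_wpM2r ?exprn_ge0//.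
  by rewrite ler_wiXn2l// ltW.
rewrite ler_wpM2l ?exprn_ge0 ?(ltW t0)//; apply: le_trans (expT_le_expR n xt).
rewrite /expT -(big_mkord xpredT (fun j => (`|x| / t) ^+ j / j`!%:R)).
rewrite (big_cat_nat (leq0n K) Kn)/= lerDr sumr_ge0// => j _.
by rewrite divr_ge0 ?exprn_ge0.
Qed.

Lemma npow_gt0 s n : 0 < npow s n. Proof. exact: expR_gt0. Qed.
Lemma npow_ge0 s n : 0 <= npow s n. Proof. exact: expR_ge0. Qed.
Lemma npow1 s : npow s 1 = 1.
Proof. by rewrite /npow ln1 mulr0 oppr0 expR0. Qed.
Lemma npowD s t n : npow (s + t) n = npow s n * npow t n.
Proof. by rewrite /npow -expRD mulrDl opprD. Qed.
Lemma npow_inv n : (0 < n)%N -> npow 1 n = n%:R^-1.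
Proof. by move=> n0; rewrite /npow mul1r expRN lnK// posrE ltr0n. Qed.
Lemma npow_nat k n : (0 < n)%N -> npow k%:R n = n%:R ^- k.
Proof.
by move=> n0; rewrite /npow -mulrN expRM_natl expRN lnK ?posrE ?ltr0n// exprVn.
Qed.
Lemma npowM s m n : (0 < m)%N -> (0 < n)%N -> npow s (m * n) = npow s m * npow s n.
Proof.
move=> m0 n0; rewrite /npow natrM lnM ?posrE ?ltr0n//.
by rewrite -expRD mulrDr opprD.
Qed.
Lemma ln_nat_ge0 n : 0 <= ln n%:R :> R.
Proof. by case: n => [|n]; [rewrite ln0|rewrite ln_ge0// ler1n]. Qed.
Lemma npow_le s t n : s <= t -> npow t n <= npow s n.
Proof. by move=> st; rewrite ler_expR lerN2 ler_wpM2r ?ln_nat_ge0. Qed.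
Lemma npow_anti s m n : 0 <= s -> (0 < m)%N -> (m <= n)%N -> npow s n <= npow s m.
Proof.
move=> s0 m0 mn; rewrite ler_expR lerN2 ler_wpM2l//.
by rewrite ler_ln ?posrE ?ltr0n ?ler_nat// (leq_trans m0).
Qed.

Lemma npow_telescope (eta : R) n : 0 < eta ->
  eta * npow (1 + eta) n.+2 <= npow eta n.+1 - npow eta n.+2.
Proof.
move=> e0; set a : R := n.+1%:R; set b : R := n.+2%:R.
have a0 : 0 < a by rewrite ltr0n.
have b0 : 0 < b by rewrite ltr0n.
have bE : b = a + 1 by rewrite /a /b natr1.
have E : npow eta n.+1 = npow eta n.+2 * expR (eta * (ln b - ln a)).
  by rewrite /npow -expRD; congr expR; rewrite -/a -/b; ring.
have L : b^-1 <= ln b - ln a.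
  rewrite -lerN2 opprB -ln_div ?posrE//.
  have -> : a / b = 1 + (- b^-1).
    have aE : a = b - 1 by rewrite bE addrK.
    by rewrite aE; field; rewrite gt_eqF.
  apply: le_ln1Dx; rewrite ltrN2 invf_lt1// bE; lra.
rewrite npowD npow_inv// E -/b.
have := expR_ge1Dx (eta * (ln b - ln a)); have := npow_gt0 eta n.+2 => p0 h.
have k : eta * b^-1 <= eta * (ln b - ln a) by rewrite ler_pM2l.
have q : eta * b^-1 <= expR (eta * (ln b - ln a)) - 1.
  by rewrite (le_trans k)// lerBrDl.
move: q (npow_gt0 eta n.+2); clear; move: (expR _) (npow eta n.+2) (b^-1).
by move=> X p bi q p0; have := ler_wpM2l (ltW p0) q; lra.
Qed.

Lemma npow_sum_le (eta : R) N : 0 < eta -> dsum (npow (1 + eta)) N <= 1 + eta^-1.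
Proof.
move=> e0; have ei : 0 < eta^-1 by rewrite invr_gt0.
case: N => [|N]; first by rewrite /dsum big_geq//; lra.
case: N => [|N]; first by rewrite /dsum big_geq//; lra.
suff : eta * dsum (npow (1 + eta)) N.+2 <= eta + 1 - npow eta N.+1.
  have := npow_gt0 eta N.+1 => p0 h.
  have -> : 1 + eta^-1 = (eta + 1) / eta by field; rewrite gt_eqF.
  by rewrite ler_pdivlMr// mulrC; lra.
elim: N => [|N IH].
  by rewrite /dsum big_nat1 !npow1; lra.
rewrite dsumS// mulrDr; have := npow_telescope N e0; lra.
Qed.

(** Partial sums of the Poisson distribution: decreasing in the parameter. *)
Definition poisson k u : R := expR (- u) * expT k u.

Lemma poisson_ge0 k u : 0 <= u -> 0 <= poisson k u.
Proof. by move=> u0; rewrite mulr_ge0 ?expR_ge0 ?expT_ge0. Qed.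

Lemma poisson_le1 k u : 0 <= u -> poisson k u <= 1.
Proof.
move=> u0; rewrite /poisson expRN mulrC ler_pdivrMr ?expR_gt0// mul1r.
exact: expT_le_expR.
Qed.

Lemma poissonS k u : poisson k.+1 u - poisson k u = expR (- u) * u ^+ k / k`!%:R.
Proof. by rewrite /poisson /expT big_ord_recr /=; ring. Qed.

Lemma is_derive_expT k u : is_derive u 1 (expT k.+1) (expT k u).
Proof.
elim: k => [|k IH].
  rewrite /expT big_ord0; have := is_derive_cst (1 : R) u 1.
  congr (is_derive _ _ _ _); apply/funext => x.
  by rewrite big_ord_recl big_ord0 expr0 fact0 divr1 addr0.
have D := is_deriveD IH (is_deriveZ (k.+1`!%:R^-1 : R) (is_deriveX k.+1 (is_derive_id u 1))).
have -> : expT k.+2 = expT k.+1 + k.+1`!%:R^-1 \*: (id ^+ k.+1 : R -> R).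
  apply/funext => x; rewrite /expT big_ord_recr /=; congr (_ + _).
  rewrite mulrC. by rewrite exprfctE.
apply: is_derive_eq D _; rewrite /expT [RHS]big_ord_recr /=; congr (_ + _).
rewrite /GRing.scale /= mulr1 factS natrM; field.
by rewrite ?nat1r !pnatr_eq0 -?lt0n ?fact_gt0.
Qed.

Lemma is_derive_poisson k u :
  is_derive u 1 (poisson k.+1) (- (expR (- u) * u ^+ k / k`!%:R)).
Proof.
have E : is_derive u 1 (fun x => expR (- x)) (expR (- u) * -1).
  exact: (is_derive1_comp (is_derive_expR _) (is_deriveN (is_derive_id u 1))).
have D := is_deriveM E (is_derive_expT k u); apply: is_derive_eq D _.
by rewrite /GRing.scale /= -poissonS /poisson; ring.
Qed.

(** The derivative of the sum telescopes to minus its last term. *)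
Lemma poisson_decr k u t : 0 <= u -> u <= t -> poisson k t <= poisson k u.
Proof.
case: k => [|k] u0 ut.
  by rewrite /poisson /expT !big_ord0 !mulr0.
have [||c] := @MVT_segment R (poisson k.+1)
  (fun u => - (expR (- u) * u ^+ k / k`!%:R)) u t ut.
- by move=> x _; exact: is_derive_poisson.
- apply: continuous_in_subspaceT => x _.
  exact: is_derive_continuous (is_derive_poisson k x).
rewrite in_itv /= => /andP[uc _] E; rewrite -subr_le0 E.
rewrite mulNr oppr_le0 mulr_ge0 ?subr_ge0// divr_ge0// mulr_ge0 ?expR_ge0//.
by rewrite exprn_ge0// (le_trans u0).
Qed.

End Exponentials.

(** * Taylor coefficients of Dirichlet series *)

Section DirichletCoefficients.
Variable R : realType.
Local Notation C := R[i].
Implicit Types (al : nat -> C) (s t x : R).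

Lemma clim_sum (K : nat) (u : nat -> nat -> C) (l : nat -> C) :
  (forall k, clim (u k) (l k)) ->
  clim (fun N => \sum_(k < K) u k N) (\sum_(k < K) l k).
Proof.
move=> H; elim: K => [|K IH].
  rewrite big_ord0; apply: clim_ext (@clim_cst _ 0); exists 0%N => n _.
  by rewrite big_ord0.
rewrite big_ord_recr /=; apply: clim_ext (climD IH (H K)); exists 0%N => n _.
by rewrite big_ord_recr.
Qed.

Lemma dsum_abs_clim (a : nat -> C) (A : R) :
  (forall N, dsum (fun n => cabs (a n)) N <= A) -> exists l, clim (dsum a) l.
Proof.
move=> hA.
have [|l Hl] := @abs_clim _ (fun k => a k.+1) (fun k => cabs (a k.+1)) A (fun=> lexx _).
  by move=> n; apply: le_trans (hA n.+1); rewrite /dsum big_add1 big_mkord.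
exists l => e e0; have [N HN] := Hl e e0; exists N.+1 => -[//|n] nN.
by rewrite /dsum big_add1 big_mkord; exact: HN.
Qed.

Definition dlim (a : nat -> C) : C := xget 0 [set l | clim (dsum a) l].

Lemma dlimP (a : nat -> C) (A : R) :
  (forall N, dsum (fun n => cabs (a n)) N <= A) -> clim (dsum a) (dlim a).
Proof.
by move=> /dsum_abs_clim[l Hl]; rewrite /dlim; case: xgetP => [l' _ //|/(_ l)].
Qed.

Lemma dlimE (a : nat -> C) l : clim (dsum a) l -> dlim a = l.
Proof.
by move=> H; rewrite /dlim; case: xgetP => [l' _ H'|/(_ l)//]; exact: clim_unique H' H.
Qed.

Lemma dlim_le (a : nat -> C) (A : R) :
  (forall N, dsum (fun n => cabs (a n)) N <= A) -> cabs (dlim a) <= A.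
Proof.
move=> hA; apply: (clim_le (dlimP hA)); exists 0%N => n _.
by apply: le_trans (hA n); exact: cabs_sum.
Qed.

(** The derivatives in [s] of [n ^ (- s)], divided by factorials and stripped of signs. *)
Definition lcoef s k n : R := npow s n * (ln n%:R ^+ k / k`!%:R).

Lemma lcoef_ge0 s k n : 0 <= lcoef s k n.
Proof. by rewrite mulr_ge0 ?npow_ge0// divr_ge0// exprn_ge0// ln_nat_ge0. Qed.

Lemma lcoef_le s k n (eta : R) : 0 < eta -> lcoef s k n <= eta ^- k * npow (s - eta) n.
Proof.
move=> e0; apply: (@le_trans _ _ (npow s n * (eta ^- k * expR (eta * ln n%:R)))).
  by rewrite ler_wpM2l ?npow_ge0// exp_coeff_le// ln_nat_ge0.
rewrite mulrCA ler_wpM2l ?invr_ge0 ?exprn_ge0 ?(ltW e0)//.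
by rewrite /npow -expRD mulrBl opprB addrC.
Qed.

(** As a difference of two sequences monotone in [n] and between 0 and 1, the coefficient
    is fit for summation by parts, without loss in [k]. *)
Lemma lcoef_poisson s k n : 0 < s ->
  lcoef s k n = s ^- k * (poisson k.+1 (s * ln n%:R) - poisson k (s * ln n%:R)).
Proof.
move=> s0; rewrite poissonS /lcoef exprMn /npow; field.
by rewrite ?pnatr_eq0 -?lt0n ?fact_gt0 ?expf_neq0// gt_eqF.
Qed.

Definition dter al s k n : C := al n * (lcoef s k n)%:C%C.
Definition dbnd al := forall n, cabs (al n) <= 1.

Lemma dter_bnd al s k (eta : R) : dbnd al -> 0 < eta -> eta < s - 1 ->
  forall N, dsum (fun n => cabs (dter al s k n)) N <= eta ^- k * (1 + (s - eta - 1)^-1).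
Proof.
move=> ab e0 es N.
apply: (@le_trans _ _ (eta ^- k * dsum (npow (s - eta)) N)).
  rewrite /dsum mulr_sumr; apply: ler_sum => n _.
  rewrite /dter cabsM cabs_real ger0_norm ?lcoef_ge0//.
  apply: le_trans (lcoef_le s k n e0).
  by rewrite ler_piMl ?lcoef_ge0.
rewrite ler_wpM2l ?invr_ge0 ?exprn_ge0 ?(ltW e0)//.
have -> : s - eta = 1 + (s - eta - 1) by ring.
have -> : 1 + (s - eta - 1) - 1 = s - eta - 1 by ring.
by apply: npow_sum_le; lra.
Qed.

(** Taylor coefficients at [s] of the Dirichlet series with coefficients [al]. *)
Definition dser al s k : C := (-1) ^+ k * dlim (dter al s k).

Lemma dter_clim al s k : dbnd al -> 1 < s ->
  clim (dsum (dter al s k)) (dlim (dter al s k)).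
Proof.
by move=> ab s1; apply: dlimP; apply: (@dter_bnd _ _ _ ((s - 1) / 2)) => //; lra.
Qed.

Lemma conv_dser al s : dbnd al -> 1 < s -> conv (dser al s) (s - 1).
Proof.
move=> ab s1 b b0 bs; exists (1 + (s - b - 1)^-1) => k.
rewrite /dser cabsM cabsX cabsN cabs1 expr1n mul1r.
by apply: (le_trans (dlim_le (dter_bnd k ab b0 bs))); rewrite mulrC.
Qed.

(** Truncating the exponential series of [n ^ (- t)] after [K] terms costs [th ^ K] uniformly
    in [n], if the exponent is lowered from [s] to [s - |t| / th], by [expR_tail]. The same
    [K] then serves for all lengths of the sum over [n]. *)
Lemma dser_eval al s t : dbnd al -> 1 < s -> `|t| < s - 1 ->
  psum (dser al s) t%:C%C = dlim (fun n => al n * (npow (s + t) n)%:C%C).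
Proof.
move=> ab s1 ts; have t0 := normr_ge0 t.
pose th := (`|t| + (s - 1)) / (2 * (s - 1)).
have th0 : 0 < th by rewrite divr_gt0//; lra.
have th1 : th < 1 by rewrite ltr_pdivrMr; lra.
have tth : `|t| / th < s - 1.
  rewrite /th invf_div mulrA ltr_pdivrMr; last by lra.
  by nra.
pose D := 1 + (s - `|t| / th - 1)^-1.
have st : 1 < s + t by have := ler_norm (- t); rewrite normrN; lra.
have T0 : clim (dsum (fun n => al n * (npow (s + t) n)%:C%C))
    (dlim (fun n => al n * (npow (s + t) n)%:C%C)).
  apply: (@dlimP _ (1 + (s + t - 1)^-1)) => N.
  apply: le_trans (npow_sum_le N _); last by lra.
  apply: ler_sum => n _; rewrite cabsM cabs_real ger0_norm ?npow_ge0//.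
  rewrite (_ : 1 + (s + t - 1) = s + t); last by ring.
  by rewrite ler_piMl ?npow_ge0.
set L := dlim _ in T0 *.
apply: psumE => e e0.
have [K0 HK] := geo_small D (ltW th0) th1 e0.
exists K0 => K KK0; apply: le_trans (HK K KK0).
have TK := clim_sum K (fun k => climZ ((-1) ^+ k * t%:C%C ^+ k) (dter_clim k ab s1)).
have -> : \sum_(k < K) dser al s k * t%:C%C ^+ k =
    \sum_(k < K) (-1) ^+ k * t%:C%C ^+ k * dlim (dter al s k).
  by apply: eq_bigr => k _; rewrite /dser; ring.
apply: (clim_le (climB TK T0)); exists 0%N => N _.
have -> : \sum_(k < K) (-1) ^+ k * t%:C%C ^+ k * dsum (dter al s k) N -
   dsum (fun n => al n * (npow (s + t) n)%:C%C) N =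
   \sum_(1 <= n < N) al n * (npow s n *
     (expT K (- (t * ln n%:R)) - expR (- (t * ln n%:R))))%:C%C.
  rewrite /dsum; under eq_bigr do rewrite mulr_sumr.
  rewrite exchange_big /= -sumrB; apply: eq_bigr => n _.
  have -> : \sum_(k < K) (-1) ^+ k * t%:C%C ^+ k * dter al s k n =
      al n * (npow s n * expT K (- (t * ln n%:R)))%:C%C.
    rewrite /expT mulr_sumr rmorph_sum /= mulr_sumr; apply: eq_bigr => k _.
    rewrite /dter /lcoef mulrCA; congr (_ * _).
    rewrite -(rmorphN1 (real_complex R)) -!rmorphXn /= -!rmorphM /=; congr (_%:C%C).
    by rewrite (exprNn (t * _)) exprMn; ring.
  by rewrite npowD -mulrBr -rmorphB /= mulrBr.
apply: (le_trans (cabs_sum _ _ _)).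
apply: (@le_trans _ _ (th ^+ K * dsum (npow (s - `|t| / th)) N)).
  rewrite /dsum mulr_sumr; apply: ler_sum => n _.
  rewrite cabsM cabs_real; apply: (@le_trans _ _ (1 * `|npow s n *
     (expT K (- (t * ln n%:R)) - expR (- (t * ln n%:R)))|)).
    by rewrite ler_wpM2r.
  rewrite mul1r normrM ger0_norm ?npow_ge0// distrC.
  apply: (le_trans (ler_wpM2l (npow_ge0 _ _) (expR_tail K _ th0 (ltW th1)))).
  rewrite mulrCA ler_wpM2l ?exprn_ge0 ?(ltW th0)//.
  rewrite normrN normrM (ger0_norm (ln_nat_ge0 _ _)) /npow -expRD ler_expR.
  by rewrite le_eqVlt; apply/orP; left; apply/eqP; field; rewrite gt_eqF.
rewrite mulrC ler_wpM2r ?exprn_ge0 ?(ltW th0)// /D.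
have -> : s - `|t| / th = 1 + (s - `|t| / th - 1) by ring.
have -> : 1 + (s - `|t| / th - 1) - 1 = s - `|t| / th - 1 by ring.
by apply: npow_sum_le; lra.
Qed.

(** Taylor expansion about a real point [s > 1] of a holomorphic function known
    to be a Dirichlet series on the real half-line beyond 1: the two power series agree
    at small reals, so [psum_inj] applies, and values of the series at complex points
    never enter. *)
Theorem taylor_dirichlet (g : C -> C) al s (a : R) : dbnd al -> 1 < s -> 0 < a ->
  (forall x, 1 < x -> g x%:C%C = dlim (fun n => al n * (npow x n)%:C%C)) ->
  (forall w, cabs w < 2 * a -> exists l, cdiff g (s%:C%C + w) l) ->
  conv (dser al s) a /\
  forall z, cabs z < a -> psum (dser al s) z = g (s%:C%C + z).
Proof.
move=> ab s1 a0 gE gd.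
have [|c cc cE] := taylor_ex (g := fun w => g (s%:C%C + w)) a0.
  by move=> w /gd[l gl]; exists l; exact: cdiff_shift.
pose b := Num.min a (s - 1).
have b0 : 0 < b by rewrite lt_min a0; lra.
have ca : conv c b.
  by move=> x x0 xb; apply: cc => //; rewrite (lt_le_trans xb)// ge_min lexx.
have cs : conv (dser al s) b.
  move=> x x0 xb; apply: conv_dser => //.
  by rewrite (lt_le_trans xb)// ge_min lexx orbT.
have E : c =1 dser al s.
  apply: (psum_inj b0 b0 ca cs) => t t0; rewrite lt_min => /andP[ta ts].
  rewrite cE ?cabs_real ?gtr0_norm// dser_eval ?gtr0_norm// -rmorphD gE//; lra.
have <- : c = dser al s by apply/funext.
by split.
Qed.

(** Summation by parts: the decrements of the weight are nonnegative and sum to at most 1. *)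
Lemma abel_bound al (q : nat -> R) (B : R) : (forall N, cabs (dsum al N) <= B) ->
  (forall n, 0 <= q n.+1 <= 1) -> (forall n, q n.+2 <= q n.+1) ->
  forall N, cabs (dsum (fun n => al n * (q n)%:C%C) N) <= B.
Proof.
move=> aB q01 qd N.
have B0 : 0 <= B by apply: le_trans (cabs_ge0 _) (aB 0%N).
case: N => [|N]; first by rewrite /dsum big_geq// cabs0.
have E : dsum (fun n => al n * (q n)%:C%C) N.+1 = dsum al N.+1 * (q N.+1)%:C%C +
    \sum_(1 <= n < N.+1) dsum al n.+1 * (q n - q n.+1)%:C%C.
  elim: N => [|N IH]; first by rewrite /dsum !big_geq// mul0r addr0.
  rewrite dsumS// IH [X in _ = _ + X]big_nat_recr//= [dsum al N.+2]dsumS//.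
  by rewrite !rmorphB /=; ring.
rewrite E; apply: (le_trans (cabsD _ _)).
have qN := q01 N; move: qN => /andP[qN0 qN1].
apply: (@le_trans _ _ (B * q N.+1 + \sum_(1 <= n < N.+1) B * (q n - q n.+1))).
  rewrite lerD//; first by rewrite cabsM cabs_real ger0_norm// ler_wpM2r.
  apply: (le_trans (cabs_sum _ _ _)); rewrite big_nat [leRHS]big_nat.
  apply: ler_sum => -[//|n] _; rewrite cabsM cabs_real ger0_norm ?subr_ge0//.
  by rewrite ler_wpM2r ?subr_ge0.
rewrite -mulr_sumr -mulrDr.
have -> : \sum_(1 <= n < N.+1) (q n - q n.+1) = q 1%N - q N.+1.
  elim: (N) => [|M IH]; first by rewrite big_geq// subrr.
  by rewrite big_nat_recr//= IH; ring.
rewrite addrC subrK; have := q01 0%N => /andP[_ q1].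
by rewrite ler_piMr.
Qed.

Lemma ln_natS n : ln n.+1%:R <= ln n.+2%:R :> R.
Proof. by rewrite ler_ln ?posrE ?ltr0n ?ler_nat. Qed.

(** Summation by parts with [lcoef_poisson] gives radius of convergence at least [s], beyond
    the disc of absolute convergence, as soon as the partial sums of [al] are bounded. *)
Lemma dser_bnd al s k (B : R) : dbnd al -> 1 < s ->
  (forall N, cabs (dsum al N) <= B) -> cabs (dser al s k) <= 2 * B / s ^+ k.
Proof.
move=> ab s1 aB; have s0 : 0 < s by lra.
rewrite /dser cabsM cabsX cabsN cabs1 expr1n mul1r.
apply: (clim_le (dter_clim k ab s1)); exists 0%N => N _.
pose P j := dsum (fun n => al n * (poisson j (s * ln n%:R))%:C%C) N.
have PB j : cabs (P j) <= B.
  apply: abel_bound => // n.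
    by rewrite poisson_ge0 ?poisson_le1 ?mulr_ge0 ?ln_nat_ge0 ?(ltW s0).
  by apply: poisson_decr; rewrite ?mulr_ge0 ?ln_nat_ge0 ?(ltW s0)// ler_pM2l ?ln_natS.
have -> : dsum (dter al s k) N = (s ^- k)%:C%C * (P k.+1 - P k).
  rewrite /P /dsum -sumrB mulr_sumr; apply: eq_bigr => n _.
  by rewrite /dter lcoef_poisson// rmorphM rmorphB /=; ring.
rewrite cabsM cabs_real ger0_norm ?invr_ge0 ?exprn_ge0 ?(ltW s0)//.
rewrite mulrC ler_wpM2r ?invr_ge0 ?exprn_ge0 ?(ltW s0)//.
by have := cabsB (P k.+1) (P k); have := PB k.+1; have := PB k; lra.
Qed.

(** The sum of [(log n)^k / (k! n^2)] is compared with the integral over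
    [x >= 1], whose value is 1: an antiderivative of the integrand is
    [- poisson k.+1 (log x)], and the integrand is a difference of two
    decreasing functions. *)
Lemma lcoef2_step k n : `|lcoef 2 k n.+1 -
   (poisson k.+1 (ln n.+1%:R) - poisson k.+1 (ln n.+2%:R))| <=
   2 ^- k * ((poisson k.+1 (2 * ln n.+1%:R) - poisson k.+1 (2 * ln n.+2%:R)) +
             (poisson k (2 * ln n.+1%:R) - poisson k (2 * ln n.+2%:R))).
Proof.
set a : R := n.+1%:R; set b : R := n.+2%:R.
have a1 : 1 <= a by rewrite ler1n.
have ab : a <= b by rewrite ler_nat.
pose psi x := expR (- ln x) * ln x ^+ k / k`!%:R * x^-1.
have D x : a <= x -> is_derive x 1 (fun x => poisson k.+1 (ln x)) (- psi x).
  move=> ax; have x0 : 0 < x by lra.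
  rewrite -mulNr; exact: (is_derive1_comp (is_derive_poisson k (ln x)) (is_derive1_ln x0)).
have [||c] := @MVT_segment R (fun x => poisson k.+1 (ln x)) (fun x => - psi x) a b ab.
- by move=> x; rewrite in_itv /= => /andP[ax _]; apply: D; rewrite ltW.
- apply: continuous_in_subspaceT => x; rewrite inE /= in_itv /= => /andP[ax _].
  exact: is_derive_continuous (D x ax).
rewrite in_itv /= => /andP[ac cb] E.
have c0 : 0 < c by lra.
have a0 : 0 < a by lra.
have bE : b - a = 1 by rewrite /b /a -natr1 addrAC subrr add0r.
have -> : poisson k.+1 (ln a) - poisson k.+1 (ln b) = psi c.
  by move: E; rewrite bE mulr1 => E; lra.
have psiE : psi c = 2 ^- k * (poisson k.+1 (2 * ln c) - poisson k (2 * ln c)).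
  rewrite poissonS /psi exprMn -[in c^-1](lnK c0) -expRN.
  have -> : - (2 * ln c) = - ln c + - ln c by ring.
  rewrite expRD; field.
  by rewrite ?pnatr_eq0 -?lt0n ?fact_gt0 ?expf_neq0// pnatr_eq0.
have l1 : 0 <= 2 * ln a by rewrite mulr_ge0// ln_ge0.
have lac : 2 * ln a <= 2 * ln c by rewrite ler_pM2l// ler_ln ?posrE.
have lcb : 2 * ln c <= 2 * ln b by rewrite ler_pM2l// ler_ln ?posrE//; lra.
have lc0 : 0 <= 2 * ln c by lra.
have p1 := poisson_decr k.+1 l1 lac; have p2 := poisson_decr k.+1 lc0 lcb.
have p3 := poisson_decr k l1 lac; have p4 := poisson_decr k lc0 lcb.
rewrite psiE lcoef_poisson// -/a -mulrBr normrM ger0_norm ?invr_ge0 ?exprn_ge0//.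
rewrite ler_wpM2l ?invr_ge0 ?exprn_ge0// ler_norml; apply/andP; split; lra.
Qed.

Lemma poisson_small k (e : R) : 0 < e ->
  exists N0, forall N, (N0 <= N)%N -> poisson k (ln N%:R) <= e.
Proof.
move=> e0.
have X0 : 0 < 2 ^+ k * 2 / e :> R by rewrite divr_gt0// mulr_gt0// exprn_gt0.
pose X := expR (2 ^+ k * 2 / e); exists (Num.truncn X).+1 => N NX.
have XN : X <= N%:R.
  by rewrite (le_trans (ltW (truncnS_gt X)))// ler_nat.
have N0 : 0 < N%:R :> R by apply: lt_le_trans XN; exact: expR_gt0.
set u := ln N%:R.
have uX : 2 ^+ k * 2 / e <= u by rewrite -ler_expR lnK.
have u0 : 0 < u by lra.
have h : expT k u <= 2 ^+ k * expR (u / 2).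
  apply: (@le_trans _ _ (2 ^+ k * expT k (u / 2))).
    rewrite /expT mulr_sumr; apply: ler_sum => j _.
    rewrite expr_div_n mulrA ler_wpM2r ?invr_ge0// mulrA ler_pdivlMr ?exprn_gt0//.
    rewrite mulrC ler_wpM2r ?exprn_ge0 ?(ltW u0)//.
    by rewrite ler_weXn2l ?ler1n// ltnW.
  rewrite ler_wpM2l ?exprn_ge0// expT_le_expR// divr_ge0// ltW//.
apply: (@le_trans _ _ (expR (- u) * (2 ^+ k * expR (u / 2)))).
  by rewrite ler_wpM2l ?expR_ge0.
have -> : expR (- u) * (2 ^+ k * expR (u / 2)) = 2 ^+ k / expR (u / 2).
  by rewrite -expRN mulrCA -expRD; congr (_ * expR _); field.
have ee := expR_ge1Dx (u / 2).
rewrite ler_pdivrMr ?expR_gt0//; move: uX; rewrite ler_pdivrMr// => uX.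
apply: (@le_trans _ _ (e * (u / 2))); first by lra.
by rewrite ler_pM2l//; lra.
Qed.

(** The Taylor coefficients of zeta at 2, up to sign, are those of [1 / (s - 1)] up to an
    exponentially small error. *)
Lemma zeta_coef k : cabs (dlim (dter (fun=> 1) 2 k) - 1) <= 2 / 2 ^+ k.
Proof.
have o1 : dbnd (fun=> 1 : C) by move=> n; rewrite cabs1.
apply/ler_addgt0Pr => e e0.
have [N0 HN0] := poisson_small k.+1 e0.
apply: (clim_dist_le (dter_clim k o1 (ltr1n _ 2))); exists (maxn N0 1) => N.
rewrite geq_max => /andP[/HN0 pN]; case: N pN => // N pN _.
have -> : dsum (dter (fun=> 1) 2 k) N.+1 = (dsum (lcoef 2 k) N.+1)%:C%C.
  by rewrite /dsum rmorph_sum /=; apply: eq_bigr => n _; rewrite /dter mul1r.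
rewrite -(rmorph1 (real_complex R)) -rmorphB cabs_real.
have p1 : poisson k.+1 (ln 1%:R) = 1 :> R.
  by rewrite ln1 /poisson oppr0 expR0 mul1r /expT big_ord_recl expr0 fact0 divr1
     big1 ?addr0// => i _; rewrite /= exprS !mul0r.
have tel (q : nat -> R) : \sum_(1 <= n < N.+1) (q n - q n.+1) = q 1%N - q N.+1.
  elim: (N) => [|M IH]; first by rewrite big_geq// subrr.
  by rewrite big_nat_recr//= IH; ring.
have -> : dsum (lcoef 2 k) N.+1 - 1 =
   \sum_(1 <= n < N.+1) (lcoef 2 k n - (poisson k.+1 (ln n%:R) - poisson k.+1 (ln n.+1%:R)))
   - poisson k.+1 (ln N.+1%:R).
  by rewrite sumrB (tel (fun n => poisson k.+1 (ln n%:R))) p1 /dsum; ring.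
apply: (le_trans (ler_normB _ _)); rewrite lerD//; last first.
  by rewrite ger0_norm// poisson_ge0// ln_nat_ge0.
apply: (le_trans (ler_norm_sum _ _ _)).
apply: (@le_trans _ _ (\sum_(1 <= n < N.+1) 2 ^- k *
   ((poisson k.+1 (2 * ln n%:R) - poisson k.+1 (2 * ln n.+1%:R)) +
             (poisson k (2 * ln n%:R) - poisson k (2 * ln n.+1%:R))))).
  rewrite big_nat [leRHS]big_nat; apply: ler_sum => -[//|n] _; exact: lcoef2_step.
rewrite -mulr_sumr big_split /= (tel (fun n => poisson k.+1 (2 * ln n%:R))).
rewrite (tel (fun n => poisson k (2 * ln n%:R))) mulrC ler_wpM2r ?invr_ge0 ?exprn_ge0//.
have l0 n : 0 <= 2 * ln n%:R :> R by rewrite mulr_ge0 ?ln_nat_ge0.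
have := poisson_le1 k.+1 (l0 1%N); have := poisson_le1 k (l0 1%N).
have := poisson_ge0 k.+1 (l0 N.+1); have := poisson_ge0 k (l0 N.+1); lra.
Qed.

End DirichletCoefficients.

(** * Characters modulo q and orthogonality *)

Section Separation.
Variable R : realType.
Local Notation C := R[i].
Variable gT : finGroupType.
Hypothesis cG : abelian [set: gT]%G.
Local Notation G := ([set: gT]%G).

(** [X ^ m - 1] is separable and splits over an algebraically closed field of characteristic 0. *)
Lemma finite_order_diagonalizable n (A : 'M[C]_n.+1) m : (0 < m)%N -> A ^+ m = 1 ->
  diagonalizable A.
Proof.
move=> m0 Am; apply/diagonalizableP.
have [rs rsE] := closed_field_poly_normal ('X^m - 1 : {poly C}).
have lc : lead_coef ('X^m - 1 : {poly C}) = 1.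
  by apply/eqP; rewrite -monicE; exact: monic_Xn_sub_1.
rewrite lc scale1r in rsE; exists rs.
  rewrite -separable_prod_XsubC -rsE; apply: separable_Xn_sub_1.
  by rewrite pnatr_eq0 -lt0n.
rewrite -rsE; apply: mxminpoly_min.
by rewrite rmorphB rmorphXn /= horner_mx_X Am rmorph1 subrr.
Qed.

Lemma joint_diagonalization n (rG : gT -> 'M[C]_n.+1) : rG 1%g = 1 ->
  (forall x y, rG (x * y)%g = rG x * rG y) ->
  exists2 P, P \in unitmx & forall x, is_diag_mx (P *m rG x *m invmx P).
Proof.
move=> r1 rM.
have rX x k : rG (x ^+ k)%g = rG x ^+ k.
  by elim: k => [|k IH]; rewrite ?expg0 ?r1 ?expr0// expgS rM IH exprS.
have /codiagonalizableP[P Pu /allP dP] :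
    {in [seq rG x | x <- enum gT] &, forall f g, comm_mx f g} /\
    (forall f, f \in [seq rG x | x <- enum gT] -> diagonalizable f).
  split=> [_ _ /mapP[x _ ->] /mapP[y _ ->]|_ /mapP[x _ ->]].
    rewrite /comm_mx -[_ *m _]rM -[in RHS]/(rG y * rG x) -rM.
    by congr rG; apply: (centsP cG); rewrite inE.
  apply: (@finite_order_diagonalizable _ _ #[x]%g); first exact: order_gt0.
  by rewrite -rX expg_order.
exists P => // x; have := dP (rG x); rewrite map_f ?mem_enum// => /(_ isT).
by rewrite /= /similar_to /conjmx pinvmxE.
Qed.

(** The regular representation is faithful and, the group being abelian, simultaneously
    diagonalizable; some diagonal entry distinguishes [u] from 1, and each diagonal entry
    is a character. *)
Lemma char_separation u : u != 1%g -> exists f : gT -> C,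
  [/\ f 1%g = 1, forall x y, f (x * y)%g = f x * f y & f u != 1].
Proof.
move=> u1; pose n := #|gT|.-1.
have nE : #|gT| = n.+1 by rewrite /n prednK// (cardD1 1%g).
pose e (i : 'I_n.+1) : gT := enum_val (cast_ord (esym nE) i).
pose r (x : gT) : 'I_n.+1 := cast_ord nE (enum_rank x).
have er x : e (r x) = x by rewrite /e /r cast_ordK enum_rankK.
have re i : r (e i) = i by rewrite /e /r enum_valK cast_ordKV.
pose rG (x : gT) : 'M[C]_n.+1 := \matrix_(i, j) (e j == (e i * x)%g)%:R.
have r1 : rG 1%g = 1.
  apply/matrixP => i j; rewrite !mxE mulg1; congr (_%:R).
  by congr nat_of_bool; apply/eqP/eqP => [/(congr1 r)|->//]; rewrite !re => ->.
have rM x y : rG (x * y)%g = rG x * rG y.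
  apply/matrixP => i j; rewrite !mxE (bigD1 (r (e i * x)%g))//= !mxE er eqxx mul1r.
  rewrite mulgA big1 ?addr0// => k kn; rewrite !mxE.
  case: eqP => [ek|_]; last by rewrite mul0r.
  by move: kn; rewrite -ek re eqxx.
have [P Pu dP] := joint_diagonalization r1 rM.
pose D x := P *m rG x *m invmx P.
have D1 : D 1%g = 1 by rewrite /D r1 mulmx1 mulmxV.
have DM x y : D (x * y)%g = D x *m D y.
  by rewrite /D rM /= -!mulmxA; congr (_ *m (_ *m _)); rewrite !mulmxA mulVmx// mul1mx.
have Dd x i j : i != j -> D x i j = 0 by move/is_diag_mxP: (dP x); apply.
have [i Di] : exists i, D u i i != 1.
  apply/existsP; apply: contraT; rewrite negb_exists => /forallP H.
  have Du : D u = 1.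
    apply/matrixP => i j; rewrite [RHS]mxE; have [<-|ij] := eqVneq i j.
      by apply/eqP; rewrite -[_ == _]negbK; exact: H.
    by rewrite Dd.
  have ru : rG u = 1.
    have : invmx P *m D u *m P = rG u by rewrite /D !mulmxA mulVmx// mul1mx mulmxKV.
    by rewrite Du mulmx1 mulVmx.
  case/negP: u1; have := congr1 (fun M : 'M[C]_n.+1 => M (r 1%g) (r u)) ru.
  rewrite !mxE !er mul1g eqxx; case: eqP => [E _|_ /eqP]; last by rewrite oner_eq0.
  by rewrite -(er u) -E er.
exists (fun x => D x i i); split=> //; first by rewrite D1 mxE eqxx.
move=> x y; rewrite DM mxE (bigD1 i)//= big1 ?addr0// => j ji.
by rewrite Dd ?mul0r// eq_sym.
Qed.

End Separation.

Section Characters.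
Variable R : realType.
Local Notation C := R[i].
Variable q : nat.
Hypothesis q1 : (1 < q)%N.
Local Notation D := (@dirichlet_char R q).
Local Notation ch := {ffun 'Z_q -> cplx R}.
Implicit Types (chi psi : ch) (a b : 'Z_q).

Lemma char1 chi : D chi -> chi 1 = 1. Proof. by case. Qed.
Lemma charM chi a b : D chi -> chi (a * b) = chi a * chi b.
Proof. by case=> _ H _; exact: H. Qed.
Lemma char_unit chi a : D chi -> (chi a != 0) = (a \is a GRing.unit).
Proof. by case=> _ _ H; exact: H. Qed.
Lemma char_nunit chi a : D chi -> a \isn't a GRing.unit -> chi a = 0.
Proof. by move=> Dc; rewrite -(char_unit a Dc) negbK => /eqP. Qed.
Lemma charX chi a k : D chi -> chi (a ^+ k) = chi a ^+ k.
Proof.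
by move=> Dc; elim: k => [|k IH]; rewrite ?expr0 ?char1// !exprS charM// IH.
Qed.

Lemma unit_finite_order a : a \is a GRing.unit ->
  exists2 m, (0 < m)%N & a ^+ m = 1.
Proof.
move=> ua; pose G := [set: {unit 'Z_q}]%G.
exists #|G|; first exact: (cardG_gt0 G).
have := @expg_cardG _ G (FinRing.unit 'Z_q ua) (finset.in_setT _).
by move/(congr1 val); rewrite FinRing.val_unitX/= => ->.
Qed.

Lemma cabs_char chi a : D chi -> a \is a GRing.unit -> cabs (chi a) = 1.
Proof.
move=> Dc /unit_finite_order[m m0 am].
have : cabs (chi a) ^+ m = 1 by rewrite -cabsX -charX// am char1// cabs1.
by move/eqP; rewrite pexpr_eq1 ?cabs_ge0// => /eqP.
Qed.

Lemma cabs_char_le1 chi a : D chi -> cabs (chi a) <= 1.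
Proof.
move=> Dc; case: (boolP (a \is a GRing.unit)) => ua; first by rewrite cabs_char.
by rewrite char_nunit// cabs0.
Qed.

Definition conj_char chi : ch := [ffun a => (chi a)^*%C].
Definition mul_char chi psi : ch := [ffun a => chi a * psi a].

Lemma mulcJ z : z * z^*%C = (cabs z ^+ 2)%:C%C :> C.
Proof. by rewrite sqr_cabs; case: z => x y; apply: complexP => /=; ring. Qed.

Lemma char_conjK chi a : D chi -> a \is a GRing.unit -> chi a * (chi a)^*%C = 1.
Proof. by move=> Dc ua; rewrite mulcJ cabs_char// expr1n. Qed.

Lemma dirichlet_mul chi psi : D chi -> D psi -> D (mul_char chi psi).
Proof.
move=> Dc Dp; split; first by rewrite ffunE !char1// mulr1.
  by move=> a b; rewrite !ffunE !charM// mulrACA.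
by move=> a; rewrite ffunE mulf_eq0 negb_or !char_unit// andbb.
Qed.

Lemma dirichlet_conj chi : D chi -> D (conj_char chi).
Proof.
move=> Dc; split; first by rewrite ffunE char1// conjc1.
  by move=> a b; rewrite !ffunE charM// rmorphM.
by move=> a; rewrite ffunE conjc_eq0 char_unit.
Qed.

Lemma principal_dirichlet : D (principal_char R q).
Proof.
split; first by rewrite ffunE unitr1.
  by move=> a b; rewrite !ffunE unitrM -natrM mulnb.
by move=> a; rewrite ffunE pnatr_eq0; case: (a \is a _).
Qed.

Lemma char_neq_principal chi : D chi -> chi <> principal_char R q ->
  exists2 b, b \is a GRing.unit & chi b != 1.
Proof.
move=> Dc np; suff : ~~ [forall b, (b \is a GRing.unit) ==> (chi b == 1)].
  by rewrite negb_forall => /existsP[b]; rewrite negb_imply => /andP[]; exists b.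
apply/negP => /forallP H; apply: np; apply/ffunP => b; rewrite ffunE.
case: (boolP (b \is a GRing.unit)) => ub; last by rewrite char_nunit.
by have := H b; rewrite ub => /eqP.
Qed.

Lemma sum_char_values chi : D chi -> chi <> principal_char R q -> \sum_a chi a = 0.
Proof.
move=> Dc np; have [b ub cb] := char_neq_principal Dc np.
have E : \sum_a chi a = chi b * \sum_a chi a.
  rewrite mulr_sumr [LHS](reindex_inj (mulrI ub)) /=.
  by apply: eq_bigr => a _; rewrite charM.
apply/eqP; have : (1 - chi b) * \sum_a chi a == 0.
  by rewrite mulrBl mul1r -E subrr.
by rewrite mulf_eq0 subr_eq0 eq_sym (negPf cb).
Qed.

Definition chars : seq ch := finmap.enum_fset (fset_set D).

Lemma charsP chi : reflect (D chi) (chi \in chars).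
Proof.
have E : (chi \in chars) = (chi \in D) := in_fset_set (@finite_dirichlet_char R q) chi.
by rewrite E; apply: (iffP idP); rewrite inE.
Qed.

Lemma chars_uniq : uniq chars. Proof. exact: finmap.fset_uniq. Qed.

Lemma char_separates a : a \is a GRing.unit -> a != 1 ->
  exists2 psi, D psi & psi a != 1.
Proof.
move=> ua a1; pose u := FinRing.unit 'Z_q ua.
have cG : abelian [set: {unit 'Z_q}]%G by exact: units_Zp_abelian.
have [|f [f1 fM fu]] := char_separation R cG (u := u).
  by apply: contra a1 => /eqP /(congr1 val) /= ->.
pose psi : ch := [ffun b => oapp f 0 (insub b : option {unit 'Z_q})].
have psiU b (ub : b \is a GRing.unit) : psi b = f (FinRing.unit 'Z_q ub).
  by rewrite ffunE insubT.
have psiN b : b \isn't a GRing.unit -> psi b = 0.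
  by move=> nb; rewrite ffunE insubN.
have fn0 x : f x != 0.
  apply/eqP => fx; have := f1; rewrite -(mulgV x) fM fx mul0r => /esym/eqP.
  by rewrite oner_eq0.
exists psi; last by rewrite psiU.
split.
- rewrite (psiU 1 (unitr1 _)) -f1; congr f; exact: val_inj.
- move=> b c; case: (boolP (b \is a GRing.unit)) => ub; last first.
    by rewrite !(psiN b)// ?mul0r// psiN// unitrM (negPf ub).
  case: (boolP (c \is a GRing.unit)) => uc; last first.
    by rewrite !(psiN c)// ?mulr0// psiN// unitrM (negPf uc) andbF.
  have ubc : b * c \is a GRing.unit by rewrite unitrM ub.
  rewrite (psiU _ ub) (psiU _ uc) (psiU _ ubc) -fM; congr f; exact: val_inj.
move=> b; case: (boolP (b \is a GRing.unit)) => ub; last by rewrite psiN// eqxx.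
by rewrite psiU fn0.
Qed.

Lemma sum_chars_neq1 a : a \is a GRing.unit -> a != 1 ->
  \sum_(chi <- chars) chi a = 0.
Proof.
move=> ua a1; have [psi Dp pa] := char_separates ua a1.
have cancel : {in chars, cancel (mul_char psi) (mul_char (conj_char psi))}.
  move=> chi /charsP Dc; apply/ffunP => b; rewrite !ffunE mulrA [_^*%C * _]mulrC.
  case: (boolP (b \is a GRing.unit)) => ub; first by rewrite char_conjK// mul1r.
  by rewrite (char_nunit Dc)// mulr0.
have E : \sum_(chi <- chars) chi a = psi a * \sum_(chi <- chars) chi a.
  rewrite mulr_sumr; transitivity (\sum_(chi <- chars) mul_char psi chi a); last first.
    by apply: eq_bigr => chi _; rewrite ffunE.
  rewrite -(big_map (mul_char psi) xpredT (fun chi => chi a)).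
  apply: perm_big; apply: uniq_perm; first exact: chars_uniq.
    by rewrite map_inj_in_uniq ?chars_uniq//; exact: can_in_inj cancel.
  move=> chi; apply/charsP/mapP => [Dc|[c /charsP Dc ->]]; last exact: dirichlet_mul.
  exists (mul_char (conj_char psi) chi).
    by apply/charsP; apply: dirichlet_mul => //; exact: dirichlet_conj.
  apply/ffunP => b; rewrite !ffunE mulrA.
  case: (boolP (b \is a GRing.unit)) => ub; first by rewrite char_conjK// mul1r.
  by rewrite (char_nunit Dc)// mulr0.
apply/eqP; have : (1 - psi a) * \sum_(chi <- chars) chi a == 0.
  by rewrite mulrBl mul1r -E subrr.
by rewrite mulf_eq0 subr_eq0 eq_sym (negPf pa).
Qed.

Lemma card_units : \sum_(a : 'Z_q) ((a \is a GRing.unit)%:R : C) = (totient q)%:R.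
Proof.
rewrite -natr_sum; congr (_%:R).
rewrite -card_units_Zp ?(ltnW q1)// cardsT card_sub -sum1_card [RHS]big_mkcond /=.
by apply: eq_bigr => a _; rewrite inE; case: (a \is a _).
Qed.

(** Counting pairs of a character and a unit both ways: summing over units first leaves the
    principal character, over characters first leaves the unit 1. *)
Lemma sum_chars_1 : \sum_(chi <- chars) chi 1 = (totient q)%:R.
Proof.
rewrite -card_units.
have -> : \sum_(chi <- chars) chi 1 = \sum_(a : 'Z_q) \sum_(chi <- chars) chi a.
  rewrite (bigD1 1)//= [X in _ = _ + X]big1 ?addr0// => a a1.
  case: (boolP (a \is a GRing.unit)) => ua; first exact: sum_chars_neq1.
  by rewrite big_seq big1// => chi /charsP Dc; rewrite char_nunit.
rewrite exchange_big /= (bigD1_seq (principal_char R q)) ?chars_uniq//=; last first.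
  by apply/charsP; exact: principal_dirichlet.
rewrite [X in _ + X]big_seq_cond [X in _ + X]big1 ?addr0; last first.
  by move=> chi /andP[/charsP Dc /eqP np]; exact: sum_char_values.
by apply: eq_bigr => a _; rewrite ffunE.
Qed.

Theorem char_orthogonality a b : \sum_(chi <- chars) chi a * (chi b)^*%C =
  ((b \is a GRing.unit) && (a == b))%:R * (totient q)%:R.
Proof.
case: (boolP (b \is a GRing.unit)) => ub /=; last first.
  rewrite mul0r big_seq big1// => chi /charsP Dc.
  by rewrite (char_nunit Dc ub) conjc0 mulr0.
have E : \sum_(chi <- chars) chi a * (chi b)^*%C = \sum_(chi <- chars) chi (a / b).
  rewrite big_seq [RHS]big_seq; apply: eq_bigr => chi /charsP Dc.
  have := char_conjK Dc ub => cb; rewrite -[in LHS](divrK ub a) (charM (a / b) b)//.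
  by rewrite -mulrA cb mulr1.
rewrite E; case: eqP => [->|ab]; first by rewrite divrr// mul1r sum_chars_1.
rewrite mul0r; case: (boolP (a \is a GRing.unit)) => ua.
  apply: sum_chars_neq1; first by rewrite unitrM ua unitrV.
  by apply/eqP => abE; apply: ab; rewrite -(divrK ub a) abE mul1r.
rewrite big_seq big1// => chi /charsP Dc.
by rewrite char_nunit// unitrM (negPf ua).
Qed.

Lemma char_m1 chi : D chi -> chi (-1) = 1 \/ chi (-1) = -1.
Proof.
move=> Dc; have : chi (-1) ^+ 2 == 1 by rewrite -charX// sqrrN expr1n char1.
by rewrite sqrf_eq1 => /orP[] /eqP; [left|right].
Qed.

(** The even characters are picked out by the weight [(1 + chi (-1)) / 2]. *)
Lemma even_orthogonality a b :
  2 * \sum_(chi <- chars | chi (-1) == 1) chi a * (chi b)^*%C =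
  ((b \is a GRing.unit) && (a == b))%:R * (totient q)%:R +
  ((b \is a GRing.unit) && (- a == b))%:R * (totient q)%:R.
Proof.
rewrite -!char_orthogonality -big_split /= big_mkcond mulr_sumr.
rewrite big_seq [RHS]big_seq; apply: eq_bigr => chi /charsP Dc.
rewrite -(mulN1r a) charM//.
case: (char_m1 Dc) => ->; first by rewrite eqxx; ring.
case: eqP => [E|_]; last by ring.
have /eqP := E; rewrite eq_sym -subr_eq0 opprK -(natrD _ 1 1) pnatr_eq0//.
Qed.

Definition cnat chi n : C := chi n%:R.

Lemma cnat1 chi : D chi -> cnat chi 1 = 1. Proof. exact: char1. Qed.
Lemma cnatM chi m n : D chi -> cnat chi (m * n) = cnat chi m * cnat chi n.
Proof. by move=> Dc; rewrite /cnat natrM charM. Qed.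
Lemma cnat_dbnd chi : D chi -> dbnd (cnat chi).
Proof. by move=> Dc n; exact: cabs_char_le1. Qed.

(** Complete periods sum to 0, so only the last, incomplete period contributes. *)
Lemma dsum_cnat_le chi : D chi -> chi <> principal_char R q ->
  forall N, cabs (dsum (cnat chi) N) <= q%:R.
Proof.
move=> Dc np.
have per n k : cnat chi (k * q + n) = cnat chi n.
  by rewrite /cnat natrD natrM pchar_Zp// mulr0 add0r.
have full : \sum_(0 <= n < q) cnat chi n = 0.
  transitivity (\sum_(0 <= n < (Zp_trunc q).+2) cnat chi n); first by rewrite Zp_cast.
  rewrite big_mkord -[RHS](sum_char_values Dc np).
  by apply: eq_bigr => a _; rewrite /cnat natr_Zp.
have blocks k : \sum_(0 <= n < k * q) cnat chi n = 0.
  elim: k => [|k IH]; first by rewrite big_geq.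
  rewrite (big_cat_nat (n := k * q))//= ?leq_mul// IH add0r.
  rewrite -{1}[(k * q)%N]add0n mulSn big_addn addnK -[RHS]full.
  by apply: eq_bigr => n _; rewrite addnC per.
move=> N.
have -> : dsum (cnat chi) N = \sum_(0 <= n < N) cnat chi n.
  case: N => [|N]; first by rewrite /dsum !big_geq.
  rewrite big_ltn// /dsum; have -> : cnat chi 0 = 0; last by rewrite add0r.
  by apply: char_nunit => //; rewrite unitr0.
rewrite (divn_eq N q) (big_cat_nat (n := (N %/ q * q)%N))//= ?leq_addr//.
rewrite blocks add0r -{1}[(N %/ q * q)%N]add0n big_addn addKn.
apply: (le_trans (cabs_sum _ _ _)).
apply: (@le_trans _ _ (\sum_(0 <= n < N %% q) 1)).
  by apply: ler_sum => n _; exact: cabs_char_le1.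
by rewrite sumr_const_nat subn0 ler_nat ltnW// ltn_mod ltnW.
Qed.

End Characters.

(** * The L-functions near and beyond the line through 1 *)

Section LFunction.
Variable R : realType.
Local Notation C := R[i].
Variable c0 : R.
Hypotheses (c0_gt0 : 0 < c0) (c0_exceptional : exceptional_zero_const c0).
Variable q : nat.
Hypothesis q1 : (1 < q)%N.
Local Notation D := (@dirichlet_char R q).
Local Notation ch := {ffun 'Z_q -> cplx R}.
Implicit Types (chi psi : ch).
Local Notation L := (@dirichletL R q).

Lemma dirichletL_prod_factor chi s : D chi -> L chi s = 0 -> dirichletL_prod q s = 0.
Proof.
move=> Dc c0'; rewrite /dirichletL_prod.
by rewrite (fsbigD1 chi)//= ?c0' ?mul0r//; exact: finite_dirichlet_char.
Qed.

Lemma ln_q_gt0 : 0 < ln q%:R :> R.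
Proof. by rewrite ln_gt0// ltr1n. Qed.

(** Every continuation exists: otherwise one factor, hence the product, would be
    identically 0, contradicting that it has at most one zero in the region. *)
Lemma dirichletLP chi : D chi -> is_dirichletL chi (L chi).
Proof.
move=> Dc; rewrite /dirichletL; case: xgetP => [F _ //|H].
have L0 s : L chi s = 0.
  rewrite /dirichletL; case: xgetP => // F E HF; exfalso; exact: (H F).
have [uniq_zero _] := c0_exceptional q1.
have Z (k : nat) : (2 <= k)%N -> zero_region c0 q (k%:R : cplx R) /\
    dirichletL_prod_zero q (k%:R : cplx R).
  move=> k2; have kE : (k%:R : C) = (k%:R : R)%:C%C by rewrite rmorph_nat.
  split; last first.
    split; last exact: dirichletL_prod_factor Dc (L0 _).
    by rewrite kE => -[] /eqP; rewrite pnatr_eq1 => /eqP k1; move: k2; rewrite k1.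
  rewrite /zero_region kE /= normr0 add0r mulr1.
  apply: (@le_trans _ _ 1); last by rewrite ler1n ltnW.
  by rewrite gerBl divr_ge0// ltW// ln_q_gt0.
have [z2 p2] := Z 2 isT; have [z3 p3] := Z 3 isT.
have := uniq_zero _ _ z2 p2 z3 p3 => /eqP.
by rewrite eqr_nat.
Qed.

Lemma dirichletL_cdiff chi s : D chi -> (chi = principal_char R q -> s <> 1) ->
  exists l, cdiff (L chi) s l.
Proof. by move=> Dc sP; apply: cdiff_derivable; have [H _] := dirichletLP Dc; exact: H. Qed.

Lemma nat_cpow_real n (x : R) : nat_cpow n (- x%:C%C : cplx R) = (npow x n)%:C%C.
Proof.
rewrite /nat_cpow /npow /= oppr0 mul0r cos0 sin0 mulNr.
by apply: complexP; rewrite ?ReM ?ImM /=; ring.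
Qed.

Definition nterm (al : nat -> C) (x : R) n : C := al n * (npow x n)%:C%C.

Lemma nterm_bnd al x N : dbnd al -> 1 < x ->
  dsum (fun n => cabs (nterm al x n)) N <= 1 + (x - 1)^-1.
Proof.
move=> ab x1; have xE : x = 1 + (x - 1) by ring.
apply: (@le_trans _ _ (dsum (npow x) N)); last first.
  by rewrite {1}xE; apply: npow_sum_le; lra.
apply: ler_sum => n _; rewrite cabsM cabs_real ger0_norm ?npow_ge0//.
by rewrite ler_piMl ?npow_ge0.
Qed.

Lemma nterm_clim al x : dbnd al -> 1 < x -> clim (dsum (nterm al x)) (dlim (nterm al x)).
Proof. by move=> ab x1; apply: dlimP => N; exact: nterm_bnd. Qed.

Lemma dirichletL_real chi x : D chi -> 1 < x ->
  L chi x%:C%C = dlim (nterm (cnat chi) x).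
Proof.
move=> Dc x1; apply/esym/dlimE => e e0.
have [_ /(_ x%:C%C x1)] := dirichletLP Dc.
move=> /cvgrPdist_le /(_ e%:C%C); rewrite ltcR => /(_ e0)[N _ HN].
exists N => n /HN /=; rewrite -cabs_norm lecR cabsBC.
congr (cabs (_ - _) <= _); rewrite /dsum; apply: eq_bigr => k _.
by rewrite /nterm /cnat nat_cpow_real.
Qed.

(** For nonprincipal [chi] the continuation is entire, so the expansion holds at every [z]. *)
Lemma dirichletL_taylor chi s z : D chi -> chi <> principal_char R q -> 1 < s ->
  conv (dser (cnat chi) s) (cabs z + 1) /\
  psum (dser (cnat chi) s) z = L chi (s%:C%C + z).
Proof.
move=> Dc np s1; have z0 := cabs_ge0 z.
have [||w _|cc H] := @taylor_dirichlet R (L chi) (cnat chi) s (cabs z + 1) (cnat_dbnd Dc) s1.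
- by lra.
- by move=> x x1; rewrite dirichletL_real.
- exact: dirichletL_cdiff.
by split=> //; apply: H; lra.
Qed.

Lemma dser_cnat_le chi s k : D chi -> chi <> principal_char R q -> 1 < s ->
  cabs (dser (cnat chi) s k) <= 2 * q%:R / s ^+ k.
Proof.
by move=> Dc np s1; apply: dser_bnd => //; [exact: cnat_dbnd|exact: dsum_cnat_le].
Qed.

(** Summing the bounds on the Taylor coefficients as a geometric series. *)
Lemma dirichletL_le chi s z (r : R) : D chi -> chi <> principal_char R q -> 1 < s ->
  cabs z <= r * s -> 0 <= r -> r < 1 ->
  cabs (L chi (s%:C%C + z)) <= 2 * q%:R / (1 - r).
Proof.
move=> Dc np s1 zr r0 r1; have s0 : 0 < s by lra.
have [cc <-] := dirichletL_taylor z Dc np s1.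
have zz : cabs z < cabs z + 1 by lra.
apply: (clim_le (psum_clim cc zz)); exists 0%N => n _.
apply: (le_trans (cabs_sum _ _ _)).
apply: (@le_trans _ _ (\sum_(k < n) 2 * q%:R * r ^+ k)).
  apply: ler_sum => k _; rewrite cabsM cabsX.
  apply: (@le_trans _ _ (2 * q%:R / s ^+ k * (r * s) ^+ k)).
    rewrite ler_pM ?cabs_ge0 ?exprn_ge0 ?cabs_ge0 ?dser_cnat_le//.
    by rewrite lerXn2r ?nnegrE ?cabs_ge0// mulr_ge0// ltW.
  rewrite exprMn le_eqVlt; apply/orP; left; apply/eqP; field.
  by rewrite gt_eqF// exprn_gt0.
by rewrite -mulr_sumr ler_wpM2l ?mulr_ge0// geo_sum_le.
Qed.

(** Complete multiplicativity: twisting commutes with Dirichlet convolution. *)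
Lemma dconv_twist (u v : nat -> C) chi x n : D chi -> (0 < n)%N ->
  dconv (fun n => u n * nterm (cnat chi) x n) (fun n => v n * nterm (cnat chi) x n) n =
  nterm (cnat chi) x n * dconv u v n.
Proof.
move=> Dc n0; rewrite /dconv mulr_sumr big_seq [RHS]big_seq; apply: eq_bigr => d.
rewrite -dvdn_divisors// => dn; have d0 := dvdn_gt0 n0 dn.
have nd0 : (0 < n %/ d)%N by rewrite divn_gt0// dvdn_leq.
rewrite -[in RHS](divnK dn) /nterm cnatM// npowM// mulnK// rmorphM /=.
by ring.
Qed.

Definition mobius_chi chi n : C := (mu R n)%:C%C * cnat chi n.

Lemma mobius_chi_bnd chi : D chi -> dbnd (mobius_chi chi).
Proof.
move=> Dc n; rewrite /mobius_chi cabsM cabs_real.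
by rewrite -[leRHS]mulr1 ler_pM ?cabs_ge0 ?norm_mu// cnat_dbnd.
Qed.

(** Dirichlet product with [sum_mu_divisors]. It yields both nonvanishing and the series of
    the inverse. *)
Lemma dirichletL_mobius chi x : D chi -> 1 < x ->
  dlim (nterm (mobius_chi chi) x) * L chi x%:C%C = 1.
Proof.
move=> Dc x1; rewrite dirichletL_real//.
have P := dirichlet_product (fun N => nterm_bnd N (mobius_chi_bnd Dc) x1)
  (fun N => nterm_bnd N (cnat_dbnd Dc) x1) (nterm_clim (mobius_chi_bnd Dc) x1)
  (nterm_clim (cnat_dbnd Dc) x1).
apply: clim_unique P _; apply: clim_ext (@clim_cst _ 1); exists 2%N => -[|[|N]]// _.
rewrite /dsum big_ltn// big_nat_cond big1 ?addr0.
  rewrite /dconv (_ : divisors 1 = [:: 1%N])// big_seq1 divn1 /nterm /mobius_chi.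
  by rewrite mu1 !npow1 !cnat1// !mulr1.
move=> n /andP[/andP[n2 _] _]; have n0 : (0 < n)%N by rewrite (leq_trans _ n2).
have := @dconv_twist (fun n => (mu R n)%:C%C) (fun=> 1) chi x n Dc n0.
rewrite /dconv => E.
transitivity (nterm (cnat chi) x n * \sum_(d <- divisors n) (mu R d)%:C%C * 1).
  by rewrite -E; apply: eq_bigr => d _; rewrite /nterm /mobius_chi; ring.
have -> : \sum_(d <- divisors n) (mu R d)%:C%C * 1 = (\sum_(d <- divisors n) mu R d)%:C%C.
  by rewrite rmorph_sum; apply: eq_bigr => d _; rewrite mulr1.
by rewrite sum_mu_divisors// gtn_eqF// mulr0.
Qed.

Lemma dirichletL_neq0 chi x : D chi -> 1 < x -> L chi x%:C%C != 0.
Proof.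
move=> Dc x1; apply/eqP => L0; have := dirichletL_mobius Dc x1.
by rewrite L0 mulr0 => /esym/eqP; rewrite oner_eq0.
Qed.

Lemma dirichletL_inv chi x : D chi -> 1 < x ->
  (L chi x%:C%C)^-1 = dlim (nterm (mobius_chi chi) x).
Proof.
move=> Dc x1; rewrite -[LHS]mul1r -(dirichletL_mobius Dc x1) mulfK//.
exact: dirichletL_neq0.
Qed.

Lemma dirichletL_inv_le chi x : D chi -> 1 < x ->
  (cabs (L chi x%:C%C))^-1 <= 1 + (x - 1)^-1.
Proof.
move=> Dc x1; rewrite -cabsV dirichletL_inv//.
by apply: dlim_le => N; exact: nterm_bnd (mobius_chi_bnd Dc) x1.
Qed.

Lemma dirichletL_le_zeta chi x : D chi -> 1 < x ->
  cabs (L chi x%:C%C) <= 1 + (x - 1)^-1.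
Proof.
move=> Dc x1; rewrite dirichletL_real//.
by apply: dlim_le => N; exact: nterm_bnd (cnat_dbnd Dc) x1.
Qed.

Definition mangoldt_term chi x n : C := (mangoldt R n)%:C%C * nterm (cnat chi) x n.

(** The von Mangoldt series is the Dirichlet product of the Moebius series, which is [1 / L],
    and of the series with coefficients [chi(n) log n], which is minus the derivative. *)
Lemma dirichletL_logderiv chi x : D chi -> 1 < x ->
  clim (dsum (mangoldt_term chi x)) (dlim (mangoldt_term chi x)) /\
  cdiff (L chi) x%:C%C (- dlim (mangoldt_term chi x) * L chi x%:C%C).
Proof.
move=> Dc x1; pose eta := (x - 1) / 2; have eta0 : 0 < eta by rewrite /eta; lra.
have eta1 : eta < x - 1 by rewrite /eta; lra.
have lnE n : dter (cnat chi) x 1 n = (ln n%:R)%:C%C * nterm (cnat chi) x n.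
  by rewrite /dter /lcoef expr1 (_ : 1`! = 1%N)// divr1 /nterm rmorphM /=; ring.
have ab := cnat_dbnd Dc.
have lb := @dter_bnd _ _ _ 1 eta ab eta0 eta1.
have P := dirichlet_product (fun N => nterm_bnd N (mobius_chi_bnd Dc) x1) lb
  (nterm_clim (mobius_chi_bnd Dc) x1) (dter_clim 1 ab x1).
have PE N : dsum (dconv (nterm (mobius_chi chi) x) (dter (cnat chi) x 1)) N =
    dsum (mangoldt_term chi x) N.
  rewrite /dsum big_nat [RHS]big_nat; apply: eq_bigr => n /andP[n0 _].
  have := @dconv_twist (fun n => (mu R n)%:C%C) (fun n => (ln n%:R)%:C%C) chi x n Dc n0.
  rewrite /dconv => E.
  transitivity (nterm (cnat chi) x n *
    \sum_(d <- divisors n) (mu R d)%:C%C * (ln (n %/ d)%N%:R)%:C%C).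
    rewrite -E; apply: eq_bigr => d _; rewrite lnE /nterm /mobius_chi; ring.
  rewrite /mangoldt_term mulrC /mangoldt rmorph_sum /=; congr (_ * _).
  by apply: eq_bigr => d _; rewrite rmorphM.
have Pm : clim (dsum (mangoldt_term chi x))
   (dlim (nterm (mobius_chi chi) x) * dlim (dter (cnat chi) x 1)).
  by apply: clim_ext P; exists 0%N => N _; rewrite PE.
rewrite (dlimE Pm); split=> //.
have a0 : 0 < eta by [].
have [||cc H] := @taylor_dirichlet R (L chi) (cnat chi) x eta ab x1 a0.
- by move=> y y1; rewrite dirichletL_real.
- move=> w wa; apply: dirichletL_cdiff => // _ /(congr1 (fun z : C => Re z)).
  rewrite /= => E1; have := cabs_Re w; have := ler_norm (- Re w); rewrite normrN.
  by move: E1; rewrite ReD /= => E1; rewrite /eta in wa; lra.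
have z0 : cabs (0 : C) < eta by rewrite cabs0.
have D0 := psum_cdiff cc z0.
have D1 : cdiff (fun w => L chi (x%:C%C + w)) 0 (psum (dcoef (dser (cnat chi) x)) 0).
  apply: (cdiff_ext (d := eta)) D0 => // h hd; apply: H; by rewrite add0r.
have -> : - (dlim (nterm (mobius_chi chi) x) * dlim (dter (cnat chi) x 1)) *
   L chi x%:C%C = psum (dcoef (dser (cnat chi) x)) 0.
  have -> : - (dlim (nterm (mobius_chi chi) x) * dlim (dter (cnat chi) x 1)) *
     L chi x%:C%C = - (dlim (nterm (mobius_chi chi) x) * L chi x%:C%C) *
     dlim (dter (cnat chi) x 1) by ring.
  by rewrite dirichletL_mobius// psum0 /dcoef /dser expr1; ring.
have := @cdiff_shift R (fun w => L chi (x%:C%C + w)) (- x%:C%C) x%:C%C.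
rewrite addNr => /(_ _ D1).
apply: (cdiff_ext (d := 1)) => // h _.
by congr (L chi _); ring.
Qed.

End LFunction.

(** * Estermann's inequality for sequences of Taylor coefficients *)

Section Estermann.
Variable R : realType.
Implicit Types (t y g h : nat -> R).

(** The Cauchy product truncated at total degree [K], summed by rows. *)
Lemma triangle_sum g h K :
  \sum_(k < K) \sum_(j < k.+1) g j * h (k - j)%N =
  \sum_(j < K) g j * \sum_(i < K - j) h i.
Proof.
elim: K => [|K IH]; first by rewrite !big_ord0.
rewrite big_ord_recr /= IH big_ord_recr [RHS]big_ord_recr /= subnn subSnn.
rewrite big_ord_recl big_ord0 addr0 addrA; congr (_ + _).
rewrite -big_split /=; apply: eq_bigr => j _.
by rewrite subSn ?(ltnW (ltn_ord j))// big_ord_recr /= mulrDr.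
Qed.

Lemma triangle_sumC g h K :
  \sum_(k < K) \sum_(j < k.+1) g j * h (k - j)%N =
  \sum_(i < K) h i * \sum_(j < K - i) g j.
Proof.
rewrite -triangle_sum; apply: eq_bigr => k _.
rewrite (reindex_inj rev_ord_inj) /=; apply: eq_bigr => j _.
have jk : (j <= k)%N by rewrite -ltnS.
by rewrite subSS (subKn jk) mulrC.
Qed.

Lemma lin_exp_le (s : R) k : 0 <= s -> k%:R * s <= (1 + s) ^+ k.
Proof.
move=> s0; elim: k => [|k IH]; first by rewrite mul0r expr0.
rewrite exprS -natr1.
have := exprn_ege1 k (_ : 1 <= 1 + s); rewrite lerDl => /(_ s0) h; nra.
Qed.

Lemma geo_tail_le (r : R) K n : 0 <= r -> r < 1 ->
  \sum_(K <= j < n) r ^+ j <= r ^+ K * (1 - r)^-1.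
Proof.
move=> r0 r1; rewrite -{1}[K]add0n big_addn big_mkord.
rewrite (eq_bigr (fun j : 'I_(n - K) => r ^+ K * r ^+ j)).
  by rewrite -mulr_sumr ler_wpM2l ?exprn_ge0// geo_sum_le.
by move=> j _; rewrite -exprD addnC.
Qed.

(** Here [t] stands for the Taylor coefficients of [L(s, chi)] at [s = 2] in powers of
    [2 - s], and [y] for those of zeta, which are close to the coefficients 1 of
    [1 / (s - 1)]; the coefficients [b] of the product are nonnegative because the
    Dirichlet coefficients of the product are. *)
Section Fixed.
Variables (t y : nat -> R) (Q : R).
Hypotheses (Q0 : 0 <= Q) (tB : forall k, `|t k| <= 2 * Q / 2 ^+ k)
  (yB : forall k, `|y k - 1| <= 2 / 2 ^+ k).
Let b k := \sum_(j < k.+1) t j * y (k - j)%N.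
Hypotheses (b_ge0 : forall k, 0 <= b k) (b0_ge1 : 1 <= b 0%N).

Lemma lim_dist_le (u : nat -> R) (l z B : R) : u @ \oo --> l ->
  (exists N, forall n, (N <= n)%N -> `|u n - z| <= B) -> `|l - z| <= B.
Proof.
move=> /cvgrPdist_le ul [N HN]; apply/ler_addgt0Pr => e e0.
have [N' _ HN'] := ul e e0; have h1 := HN _ (leq_maxl N N').
have h2 := HN' _ (leq_maxr N N'); set n := maxn N N' in h1 h2.
rewrite (_ : l - z = (u n - z) + (l - u n)); last by ring.
by apply: (le_trans (ler_normD _ _)); rewrite lerD.
Qed.

Lemma tail_le (w l : R) m : 0 <= w -> w <= 5 / 4 ->
  (fun n => \sum_(j < n) t j * w ^+ j) @ \oo --> l ->
  `|l - \sum_(j < m) t j * w ^+ j| <= 6 * Q * (5 / 8) ^+ m.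
Proof.
move=> w0 w1 cv; have Qge0 := Q0; apply: (lim_dist_le cv); exists m => n mn.
rewrite -!(big_mkord xpredT (fun j => t j * w ^+ j)) (big_cat_nat (leq0n m) mn)/=.
rewrite addrAC subrr add0r; apply: (le_trans (ler_norm_sum _ _ _)).
apply: (@le_trans _ _ (\sum_(m <= j < n) 2 * Q * (5 / 8) ^+ j)).
  apply: ler_sum => j _; rewrite normrM normrX (ger0_norm w0).
  apply: (@le_trans _ _ (2 * Q / 2 ^+ j * (5 / 4) ^+ j)).
    by rewrite ler_pM ?exprn_ge0// lerXn2r ?nnegrE//; lra.
  rewrite -mulrA ler_wpM2l ?mulr_ge0// -exprVn -exprMn.
  by rewrite le_eqVlt; apply/orP; left; apply/eqP; congr (_ ^+ _); field.
rewrite -mulr_sumr; apply: (@le_trans _ _ (2 * Q * ((5 / 8) ^+ m * (1 - 5 / 8)^-1))).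
  by rewrite ler_wpM2l ?mulr_ge0// geo_tail_le//; lra.
have -> : (1 - 5 / 8)^-1 = 8 / 3 :> R by field.
have : 0 <= Q * (5 / 8) ^+ m by rewrite mulr_ge0// exprn_ge0//; lra.
by lra.
Qed.

(** Truncate the expansion of [zeta L] at the point [2 - w] after [K] terms: by positivity
    it is at least 1. The part of zeta coming from [1 / (s - 1)] contributes
    [(w ^ K L1 - L) / (w - 1)] up to a tail, where [L = 0] is the value at the zero; the rest
    is a tail of the convergent expansion of [L]. *)
Theorem estermann_lower (w L1 : R) K : (0 < K)%N -> 1 < w -> w <= 5 / 4 ->
  (fun n => \sum_(j < n) t j * w ^+ j) @ \oo --> (0 : R) ->
  (fun n => \sum_(j < n) t j) @ \oo --> L1 ->
  200 * Q * (3 / 4) ^+ K <= 1 ->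
  w - 1 <= 2 * w ^+ K * L1.
Proof.
move=> K0 w1 w2 cw c1 QK; have Qge0 := Q0; have w0 : 0 <= w by lra.
have low : 1 <= \sum_(k < K) b k * w ^+ k.
  case: K K0 {QK} => // K _; rewrite big_ord_recl expr0 mulr1.
  apply: (le_trans b0_ge1); rewrite lerDl sumr_ge0// => k _.
  by rewrite mulr_ge0// exprn_ge0.
pose z k := y k - 1.
have E : \sum_(k < K) b k * w ^+ k =
    \sum_(j < K) (t j * w ^+ j) * (\sum_(i < K - j) w ^+ i) +
    \sum_(i < K) (z i * w ^+ i) * (\sum_(j < K - i) t j * w ^+ j).
  rewrite -(triangle_sum (fun j => t j * w ^+ j) (fun i => w ^+ i)).
  rewrite -(triangle_sumC (fun j => t j * w ^+ j) (fun i => z i * w ^+ i)).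
  rewrite -big_split /=; apply: eq_bigr => k _.
  rewrite -big_split /= /b mulr_suml; apply: eq_bigr => j _.
  have -> : w ^+ k = w ^+ j * w ^+ (k - j) by rewrite -exprD subnKC// -ltnS ltn_ord.
  by rewrite /z; ring.
set A := (X in _ = X + _) in E; set B := (X in _ = _ + X) in E.
have AE : (w - 1) * A = w ^+ K * (\sum_(j < K) t j) - \sum_(j < K) t j * w ^+ j.
  rewrite /A !mulr_sumr -sumrB; apply: eq_bigr => j _.
  rewrite mulrCA -subrX1.
  have -> : w ^+ K = w ^+ j * w ^+ (K - j) by rewrite -exprD subnKC// ltnW.
  by ring.
have r34 : 0 <= (3 / 4 : R) ^+ K by rewrite exprn_ge0//; lra.
(* 5/8 = (5/4) / 2 is the ratio of the tails; the linear factor is paid by passing to 3/4. *)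
have jle j : j%:R * (5 / 8 : R) ^+ j <= 5 * (3 / 4) ^+ j.
  have := @lin_exp_le (1 / 5) j; have -> : (1 + 1 / 5 : R) = 6 / 5 by field.
  move=> H; have {}H : j%:R <= 5 * (6 / 5 : R) ^+ j by have := H; lra.
  have -> : (3 / 4 : R) ^+ j = (6 / 5) ^+ j * (5 / 8) ^+ j.
    by rewrite -exprMn; congr (_ ^+ _); field.
  by rewrite mulrA ler_wpM2r// exprn_ge0//; lra.
have AB : `|w ^+ K * (L1 - \sum_(j < K) t j) - (0 - \sum_(j < K) t j * w ^+ j)| <=
    (w - 1) * (40 * Q * (3 / 4) ^+ K).
  have cvA : (fun n => w ^+ K * (\sum_(j < n) t j) - \sum_(j < n) t j * w ^+ j) @ \oo -->
     w ^+ K * L1 - 0 by apply: cvgB cw; exact: cvgMr.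
  have -> : w ^+ K * (L1 - \sum_(j < K) t j) - (0 - \sum_(j < K) t j * w ^+ j) =
    (w ^+ K * L1 - 0) - (w ^+ K * (\sum_(j < K) t j) - \sum_(j < K) t j * w ^+ j) by ring.
  apply: (lim_dist_le cvA); exists K => n Kn.
  rewrite -!(big_mkord xpredT (fun j => t j * w ^+ j)) (big_cat_nat (leq0n K) Kn)/=.
  rewrite -!(big_mkord xpredT t) (big_cat_nat (leq0n K) Kn)/=.
  have -> : w ^+ K * (\sum_(0 <= i < K) t i + \sum_(K <= i < n) t i) -
   (\sum_(0 <= i < K) t i * w ^+ i + \sum_(K <= i < n) t i * w ^+ i) -
   (w ^+ K * (\sum_(0 <= i < K) t i) - \sum_(0 <= i < K) t i * w ^+ i) =
    \sum_(K <= j < n) t j * (w ^+ K - w ^+ j).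
    transitivity (w ^+ K * (\sum_(K <= i < n) t i) - \sum_(K <= i < n) t i * w ^+ i).
      by ring.
    by rewrite mulr_sumr -sumrB; apply: eq_bigr => j _; ring.
  apply: (le_trans (ler_norm_sum _ _ _)).
  apply: (@le_trans _ _ (\sum_(K <= j < n) (w - 1) * (10 * Q * (3 / 4) ^+ j))).
    rewrite big_nat [leRHS]big_nat; apply: ler_sum => j /andP[Kj _].
    have wKj : w ^+ K <= w ^+ j by rewrite ler_weXn2l ?(ltW w1)// ltnW.
    rewrite normrM distrC (@ger0_norm _ (w ^+ j - w ^+ K)) ?subr_ge0//.
    have wj : w ^+ j - w ^+ K <= (w - 1) * (j%:R * (5 / 4) ^+ j).
      apply: (@le_trans _ _ (w ^+ j - 1)).
        by rewrite lerD2l lerN2 exprn_ege1 ?(ltW w1)//.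
      rewrite subrX1 ler_wpM2l//; first by lra.
      apply: (@le_trans _ _ (\sum_(i < j) (5 / 4) ^+ j)).
        apply: ler_sum => i _; apply: (@le_trans _ _ (w ^+ j)).
          by rewrite ler_weXn2l ?(ltW w1)// ltnW.
        by rewrite lerXn2r ?nnegrE//; lra.
      by rewrite sumr_const card_ord [leRHS]mulr_natl.
    apply: (@le_trans _ _ (2 * Q / 2 ^+ j * ((w - 1) * (j%:R * (5 / 4) ^+ j)))).
      by rewrite ler_pM// subr_ge0.
    have -> : 2 * Q / 2 ^+ j * ((w - 1) * (j%:R * (5 / 4) ^+ j)) =
       (w - 1) * (2 * Q * (j%:R * (5 / 8) ^+ j)).
      have -> : (5 / 8 : R) = 5 / 4 / 2 by field.
      rewrite (expr_div_n (5 / 4)); field.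
      by rewrite expf_neq0// pnatr_eq0.
    rewrite ler_wpM2l//; first by lra.
    have := jle j; have : 0 <= 2 * Q by lra.
    by move=> q2 /(ler_wpM2l q2); lra.
  rewrite -mulr_sumr ler_wpM2l//; first by lra.
  rewrite -mulr_sumr; apply: (@le_trans _ _ (10 * Q * ((3 / 4) ^+ K * (1 - 3 / 4)^-1))).
    by rewrite ler_wpM2l ?mulr_ge0// geo_tail_le//; lra.
  have -> : (1 - 3 / 4)^-1 = 4 :> R by field.
  by rewrite le_eqVlt; apply/orP; left; apply/eqP; ring.
have BB : `|B| <= 60 * Q * (3 / 4) ^+ K.
  apply: (le_trans (ler_norm_sum _ _ _)).
  apply: (@le_trans _ _ (\sum_(i < K) 12 * Q * (5 / 8) ^+ K)).
    apply: ler_sum => i _; rewrite normrM.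
    have T := tail_le (K - i) w0 w2 cw; rewrite sub0r normrN in T.
    have Z : `|z i * w ^+ i| <= 2 * (5 / 8) ^+ i.
      rewrite normrM normrX (ger0_norm w0).
      apply: (@le_trans _ _ (2 / 2 ^+ i * (5 / 4) ^+ i)).
        apply: ler_pM; rewrite ?exprn_ge0//; first exact: yB.
        by rewrite lerXn2r ?nnegrE//; lra.
      rewrite -mulrA ler_wpM2l// -exprVn -exprMn.
      by rewrite le_eqVlt; apply/orP; left; apply/eqP; congr (_ ^+ _); field.
    apply: (le_trans (ler_pM _ _ Z T)) => //.
    have -> : (5 / 8 : R) ^+ K = (5 / 8) ^+ i * (5 / 8) ^+ (K - i).
      by rewrite -exprD subnKC// ltnW.
    by rewrite le_eqVlt; apply/orP; left; apply/eqP; ring.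
  rewrite sumr_const card_ord -[leLHS]mulr_natl.
  by have := jle K => /(ler_wpM2l Q0); lra.
have AA : (w - 1) * A <= w ^+ K * L1 + (w - 1) * (40 * Q * (3 / 4) ^+ K).
  by move: AB; rewrite ler_norml AE => /andP[+ _]; lra.
have BB' : B <= 60 * Q * (3 / 4) ^+ K by apply: le_trans BB; exact: ler_norm.
rewrite E in low.
have wp : 0 < w - 1 by lra.
have : (w - 1) * 1 <= (w - 1) * (A + B) by rewrite ler_pM2l.
have := ler_wpM2l (ltW wp) BB'; have := ler_wpM2l (ltW wp) QK.
by move: AA; lra.
Qed.

(** If [L] vanishes at 1 the pole of zeta is cancelled, so the coefficients of the product
    decay faster than those of zeta, enough for the radius 3/2. *)
Theorem estermann_bounded : (fun n => \sum_(j < n) t j) @ \oo --> (0 : R) ->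
  exists B : R, forall K, \sum_(k < K) b k * (3 / 2) ^+ k <= B.
Proof.
move=> c1; have Qge0 := Q0; have [||K0 [K00 HK]] := @sqr_geo_sum R (3 / 4); try lra.
exists (20 * Q * K0) => K.
apply: (@le_trans _ _ (\sum_(k < K) 20 * Q * (k.+1%:R ^+ 2 * (3 / 4) ^+ k.+1))).
  apply: ler_sum => k _.
  have c1' : (fun n => \sum_(j < n) t j * 1 ^+ j) @ \oo --> (0 : R).
    by under eq_fun do under eq_bigr do rewrite expr1n mulr1.
  have bE : b k = \sum_(j < k.+1) t j + \sum_(j < k.+1) t j * (y (k - j)%N - 1).
    by rewrite /b -big_split /=; apply: eq_bigr => j _; ring.
  have T1 : `|\sum_(j < k.+1) t j| <= 2 * Q / 2 ^+ k.
    rewrite -normrN -sub0r; apply: (lim_dist_le c1); exists k.+1 => n kn.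
    rewrite -!(big_mkord xpredT t) (big_cat_nat (leq0n k.+1) kn)/=.
    rewrite addrAC subrr add0r; apply: (le_trans (ler_norm_sum _ _ _)).
    apply: (@le_trans _ _ (\sum_(k.+1 <= j < n) 2 * Q * (2^-1) ^+ j)).
      by apply: ler_sum => j _; rewrite exprVn.
    rewrite -mulr_sumr; apply: (@le_trans _ _ (2 * Q * (2^-1 ^+ k.+1 * (1 - 2^-1)^-1))).
      by rewrite ler_wpM2l ?mulr_ge0// geo_tail_le//; lra.
    rewrite exprVn exprS le_eqVlt; apply/orP; left; apply/eqP; field.
    by rewrite expf_neq0// pnatr_eq0.
  have T2 : `|\sum_(j < k.+1) t j * (y (k - j)%N - 1)| <= 4 * Q * k.+1%:R / 2 ^+ k.
    apply: (le_trans (ler_norm_sum _ _ _)).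
    apply: (@le_trans _ _ (\sum_(j < k.+1) 4 * Q / 2 ^+ k)).
      apply: ler_sum => j _; rewrite normrM.
      apply: (le_trans (ler_pM _ _ (tB j) (yB (k - j)))) => //.
      have -> : (2 : R) ^+ k = 2 ^+ j * 2 ^+ (k - j) by rewrite -exprD subnKC// -ltnS ltn_ord.
      rewrite le_eqVlt; apply/orP; left; apply/eqP; field.
      by rewrite !expf_neq0// pnatr_eq0.
    by rewrite sumr_const card_ord -[leLHS]mulr_natl; lra.
  have bk : b k <= 6 * Q * k.+1%:R / 2 ^+ k.
    rewrite bE; have := ler_norm (\sum_(j < k.+1) t j).
    have := ler_norm (\sum_(j < k.+1) t j * (y (k - j)%N - 1)).
    have k1 : (1 : R) <= k.+1%:R by rewrite ler1n.
    have Q2 : 0 <= Q / 2 ^+ k by rewrite divr_ge0// exprn_ge0.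
    by have := ler_wpM2l Q2 k1; lra.
  apply: (le_trans (ler_wpM2r _ bk)); first by rewrite exprn_ge0.
  have -> : 6 * Q * k.+1%:R / 2 ^+ k * (3 / 2) ^+ k = 6 * Q * k.+1%:R * (3 / 4) ^+ k.
    have -> : (3 / 4 : R) = 3 / 2 / 2 by field.
    rewrite (expr_div_n (3 / 2)); field.
    by rewrite expf_neq0// pnatr_eq0.
  have k1 : (k.+1%:R : R) <= k.+1%:R ^+ 2 by rewrite expr2 ler_peMl// ler1n.
  have g0 : 0 <= Q * (3 / 4) ^+ k by rewrite mulr_ge0// exprn_ge0//; lra.
  have k2 : (0 : R) <= k.+1%:R by [].
  rewrite (exprS (3 / 4) k); move: g0 k1 k2; move: ((3 / 4) ^+ k) (k.+1%:R : R) => p a g0 k1 k2.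
  by have := ler_wpM2l g0 k1; have := mulr_ge0 g0 k2; lra.
rewrite -mulr_sumr ler_wpM2l//; first by rewrite mulr_ge0.
apply: le_trans (HK K.+1); rewrite big_ord_recl /= expr0n mul0r add0r.
by [].
Qed.

End Fixed.
End Estermann.

(** * Real characters: nonvanishing and distance of a zero from 1 *)

Section NonVanishing.
Variable R : realType.
Local Notation C := R[i].
Variable c0 : R.
Hypotheses (c0_gt0 : 0 < c0) (c0_exceptional : exceptional_zero_const c0).
Variable q : nat.
Hypothesis q1 : (1 < q)%N.
Local Notation D := (@dirichlet_char R q).
Local Notation ch := {ffun 'Z_q -> cplx R}.
Implicit Types (chi psi : ch).
Local Notation L := (@dirichletL R q).

Section RealCharacter.
Variable chi : ch.
Hypotheses (Dc : D chi) (np : chi <> principal_char R q)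
  (real_chi : mul_char chi chi = principal_char R q).

Definition char_sign n : R := Re (cnat chi n).

Let xiE n : cnat chi n = (char_sign n)%:C%C.
Proof.
have : cnat chi n ^+ 2 = principal_char R q n%:R.
  by rewrite -real_chi ffunE expr2.
rewrite ffunE /char_sign; case: (_ \is a _) => /eqP.
  by rewrite sqrf_eq1 => /orP[] /eqP ->; apply: complexP => //=; rewrite oppr0.
by rewrite sqrf_eq0 => /eqP ->.
Qed.

Let xi_val n : [\/ char_sign n = 0, char_sign n = 1 | char_sign n = -1].
Proof.
have : cnat chi n ^+ 2 = principal_char R q n%:R.
  by rewrite -real_chi ffunE expr2.
rewrite ffunE /char_sign; case: (_ \is a _) => /eqP.
  by rewrite sqrf_eq1 => /orP[] /eqP -> /=; [apply: Or32|apply: Or33].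
by rewrite sqrf_eq0 => /eqP -> /=; apply: Or31.
Qed.

Lemma clim_realC (u : nat -> R) (l : C) : clim (fun n => (u n)%:C%C) l ->
  l = (Re l)%:C%C.
Proof.
move=> H; apply: complexP => //=; apply/eqP; rewrite -normr_eq0 eq_le normr_ge0 andbT.
apply/ler_addgt0Pr => e e0; rewrite add0r; have [N HN] := H e e0.
have := HN N (leqnn _); have := cabs_Im ((u N)%:C%C - l).
by rewrite ImD ImN /= add0r normrN => /le_trans; apply.
Qed.

(** The Taylor coefficients at 2, in powers of [2 - s], of [L(s, chi)] (for [t_coef]) and of
    zeta (for [y_coef]). *)
Definition t_coef k : R := Re (dlim (dter (cnat chi) 2 k)).
Definition y_coef k : R := Re (dlim (dter (fun=> 1 : C) 2 k)).

Let two1 : 1 < 2 :> R. Proof. by rewrite ltr1n. Qed.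
Let one_dbnd : dbnd (fun=> 1 : C). Proof. by move=> n; rewrite cabs1. Qed.

Lemma t_coefE k : dlim (dter (cnat chi) 2 k) = (t_coef k)%:C%C.
Proof.
have H := dter_clim k (cnat_dbnd Dc) two1.
apply: (@clim_realC (dsum (fun n => char_sign n * lcoef 2 k n))).
apply: clim_ext H; exists 0%N => N _; rewrite /dsum rmorph_sum.
by apply: eq_bigr => n _; rewrite /dter xiE [RHS]rmorphM.
Qed.

Lemma y_coefE k : dlim (dter (fun=> 1 : C) 2 k) = (y_coef k)%:C%C.
Proof.
have H := dter_clim k one_dbnd two1.
apply: (@clim_realC (dsum (lcoef 2 k))).
apply: clim_ext H; exists 0%N => N _; rewrite /dsum rmorph_sum.
by apply: eq_bigr => n _; rewrite /dter mul1r.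
Qed.

Lemma t_coef_le k : `|t_coef k| <= 2 * q%:R / 2 ^+ k.
Proof.
have := dser_cnat_le q1 k Dc np two1.
by rewrite /dser cabsM cabsX cabsN cabs1 expr1n mul1r t_coefE cabs_real.
Qed.

Lemma y_coef_le k : `|y_coef k - 1| <= 2 / 2 ^+ k.
Proof.
have := zeta_coef R k; rewrite y_coefE -(rmorph1 (real_complex R)) -rmorphB.
by rewrite cabs_real.
Qed.

(** The binomial theorem for [log d + log (n / d) = log n]. *)
Lemma lcoef_conv k n d : (0 < n)%N -> (d %| n)%N ->
  \sum_(j < k.+1) lcoef 2 j d * lcoef 2 (k - j) (n %/ d) = lcoef 2 k n :> R.
Proof.
move=> n0 dn; have d0 := dvdn_gt0 n0 dn.
have nd0 : (0 < n %/ d)%N by rewrite divn_gt0// dvdn_leq.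
rewrite -[in RHS](divnK dn) /lcoef npowM// natrM lnM ?posrE ?ltr0n//.
rewrite exprDn mulr_suml mulr_sumr; apply: eq_bigr => j _.
have jk : (j <= k)%N by rewrite -ltnS.
have bf := bin_fact jk; have : (k`! != 0)%N by rewrite -lt0n fact_gt0.
have jn : (j`!%:R != 0 :> R) by rewrite pnatr_eq0 -lt0n fact_gt0.
have kjn : ((k - j)`!%:R != 0 :> R) by rewrite pnatr_eq0 -lt0n fact_gt0.
have bn : ('C(k, j)%:R != 0 :> R) by rewrite pnatr_eq0 -lt0n bin_gt0.
move=> _; rewrite -bf !natrM -mulr_natr; field.
by rewrite kjn jn bn.
Qed.

Definition b_coef k : R := \sum_(j < k.+1) t_coef j * y_coef (k - j)%N.

Lemma b_coef_clim k :
  clim (dsum (fun n => (lcoef 2 k n * \sum_(d <- divisors n) char_sign d)%:C%C))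
    (b_coef k)%:C%C.
Proof.
have eta0 : (0 : R) < 1 / 2 by lra.
have eta1 : (1 / 2 : R) < 2 - 1 by lra.
have P j := dirichlet_product (dter_bnd j (cnat_dbnd Dc) eta0 eta1)
  (dter_bnd (k - j)%N one_dbnd eta0 eta1) (dter_clim j (cnat_dbnd Dc) two1)
  (dter_clim (k - j)%N one_dbnd two1).
have S := clim_sum k.+1 P.
have -> : (b_coef k)%:C%C = \sum_(j < k.+1)
   dlim (dter (cnat chi) 2 j) * dlim (dter (fun=> 1) 2 (k - j)).
  by rewrite /b_coef rmorph_sum; apply: eq_bigr => j _; rewrite rmorphM t_coefE y_coefE.
apply: clim_ext S; exists 0%N => N _.
rewrite /dsum exchange_big /= big_nat [RHS]big_nat; apply: eq_bigr => n /andP[n0 _].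
rewrite /dconv exchange_big /= mulr_sumr rmorph_sum big_seq [RHS]big_seq.
apply: eq_bigr => d; rewrite -dvdn_divisors// => dn.
rewrite -(lcoef_conv k n0 dn) mulr_suml rmorph_sum; apply: eq_bigr => j _.
by rewrite /dter xiE !rmorphM /=; ring.
Qed.

(** The Dirichlet coefficients of the product are nonnegative and at least 1 on squares. *)
Lemma b_coef_ge_squares k M :
  \sum_(1 <= m < M) npow 4 m * ((2 * ln m%:R) ^+ k / k`!%:R) <= b_coef k.
Proof.
have sgn1 : char_sign 1 = 1 by rewrite /char_sign cnat1.
have sgnM m n : char_sign (m * n) = char_sign m * char_sign n.
  by have := cnatM m n Dc; rewrite !xiE -rmorphM => /complexI.
have P := sum_divisors_real_char sgn1 sgnM xi_val.
pose f n := lcoef 2 k n * \sum_(d <- divisors n) char_sign d.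
have f0 n : (0 < n)%N -> 0 <= f n.
  by move=> n0; rewrite mulr_ge0 ?lcoef_ge0//; have [] := P n n0.
have fsq m : (0 < m)%N -> npow 4 m * ((2 * ln m%:R) ^+ k / k`!%:R) <= f (m ^ 2)%N.
  move=> m0; have m20 : (0 < m ^ 2)%N by rewrite expn_gt0 m0.
  have -> : npow 4 m * ((2 * ln m%:R) ^+ k / k`!%:R) = lcoef 2 k (m ^ 2) :> R.
    rewrite /lcoef natrX lnXn ?ltr0n// -(mulr_natl (ln m%:R) 2); congr (_ * _).
    have -> : (4 : R) = 2 + 2 by ring.
    by rewrite npowD -(npowM _ m0 m0) mulnn.
  rewrite /f -[leLHS]mulr1 ler_wpM2l ?lcoef_ge0//.
  by have [_] := P _ m20; apply; apply/issqP; exists m.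
have bL : forall N, dsum f N <= b_coef k.
  move=> N; apply/ler_addgt0Pr => e e0.
  have [N1 HN1] := b_coef_clim k e0.
  have := HN1 (maxn N N1) (leq_maxr _ _); set n := maxn N N1.
  have -> : dsum (fun n => (lcoef 2 k n * \sum_(d <- divisors n) char_sign d)%:C%C) n =
     (dsum f n)%:C%C by rewrite /dsum rmorph_sum.
  rewrite -rmorphB cabs_real ler_norml => /andP[_ h].
  have : dsum f N <= dsum f n.
    have [->|N0] := posnP N; first by rewrite [leLHS]/dsum big_geq// /dsum big_nat sumr_ge0// => i /andP[i0 _]; exact: f0.
    rewrite /dsum (big_cat_nat N0 (leq_maxl N N1))/= lerDl big_nat sumr_ge0//.
    by move=> i /andP[Ni _]; apply: f0; apply: leq_trans Ni.
  by lra.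
apply: le_trans (bL (M ^ 2)%N).
elim: M => [|M IH]; first by rewrite /dsum !big_geq.
have [->|M0] := posnP M; first by rewrite /dsum !big_geq.
rewrite big_nat_recr//=.
have MM : (M ^ 2 < M.+1 ^ 2)%N by rewrite ltn_sqr.
have M20 : (0 < M ^ 2)%N by rewrite expn_gt0 M0.
rewrite /dsum (big_cat_nat M20 (ltnW MM))/= lerD//.
rewrite big_ltn//; apply: (le_trans (fsq M M0)); rewrite lerDl big_nat sumr_ge0//.
by move=> i /andP[Mi _]; apply: f0; apply: leq_trans Mi.
Qed.

Lemma b_coef_ge0 k : 0 <= b_coef k.
Proof. by apply: le_trans (b_coef_ge_squares k 0); rewrite big_geq. Qed.

Lemma b_coef0 : 1 <= b_coef 0.
Proof.
apply: le_trans (b_coef_ge_squares 0 2).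
by rewrite big_nat1 npow1 expr0 fact0 divr1 mulr1.
Qed.

Lemma t_coef_cvg (w : R) :
  (fun n => \sum_(j < n) t_coef j * w ^+ j) @ \oo --> Re (L chi (2 - w)%:C%C).
Proof.
have [cc E] := dirichletL_taylor c0_gt0 c0_exceptional q1 (- w%:C%C) Dc np two1.
have zz : cabs (- w%:C%C) < cabs (- w%:C%C) + 1 :> R by lra.
have := clim_Re (psum_clim cc zz); rewrite E.
have -> : 2%:C%C - w%:C%C = (2 - w)%:C%C :> C by rewrite rmorphB.
suff -> : (fun n => Re (\sum_(k < n) dser (cnat chi) 2 k * (- w%:C%C) ^+ k)) =
  (fun n => \sum_(j < n) t_coef j * w ^+ j) by [].
apply/funext => n; rewrite Re_sum; apply: eq_bigr => j _.
rewrite /dser t_coefE mulrAC -exprMn mulN1r opprK -rmorphXn -rmorphM.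
by rewrite /= mulrC.
Qed.

Lemma real_char_lower (beta : R) K : (0 < K)%N -> 3 / 4 <= beta -> beta < 1 ->
  L chi beta%:C%C = 0 -> 200 * q%:R * (3 / 4) ^+ K <= 1 :> R ->
  1 - beta <= 2 * (2 - beta) ^+ K * cabs (L chi 1).
Proof.
move=> K0 b1 b2 Lb QK.
have w1 : 1 < 2 - beta by lra.
have cw := t_coef_cvg (w := 2 - beta).
have -> : 1 - beta = (2 - beta) - 1 by ring.
have E : 2 - (2 - beta) = beta by ring.
rewrite E Lb in cw.
have c1 := t_coef_cvg (w := 1).
have E1 : (fun n => \sum_(j < n) t_coef j * 1 ^+ j) = (fun n => \sum_(j < n) t_coef j).
  by apply/funext => n; apply: eq_bigr => j _; rewrite expr1n mulr1.
rewrite E1 (_ : (2 - 1 : R)%:C%C = 1) in c1; last first.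
  by rewrite (_ : 2 - 1 = 1 :> R) ?rmorph1//; ring.
have w2 : 2 - beta <= 5 / 4 by lra.
have := estermann_lower (ler0n _ q) t_coef_le y_coef_le b_coef_ge0 b_coef0 K0 w1 w2 cw c1 QK.
move=> /le_trans; apply; rewrite ler_wpM2l ?mulr_ge0 ?exprn_ge0//; first by lra.
by apply: le_trans (cabs_Re _); exact: ler_norm.
Qed.

Lemma harmonic_ge_ln M : (0 < M)%N -> ln M%:R <= \sum_(1 <= m < M) (m%:R : R)^-1.
Proof.
elim: M => // M IH _; have [->|M0] := posnP M; first by rewrite ln1 big_geq.
rewrite big_nat_recr//=; apply: (@le_trans _ _ (ln M%:R + M%:R^-1)); last first.
  by rewrite lerD2r IH.
have Mp : 0 < M%:R :> R by rewrite ltr0n.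
have -> : M.+1%:R = M%:R * (1 + M%:R^-1) :> R.
  by rewrite mulrDr mulr1 mulfV ?gt_eqF// natr1.
have i0 : 0 < (M%:R : R)^-1 by rewrite invr_gt0.
rewrite lnM ?posrE ?addr_gt0// lerD2l; apply: le_ln1Dx.
by apply: lt_trans i0; rewrite ltrN10.
Qed.

(** If [L] vanished at 1, the expansion of the product would be bounded at radius 3/2, hence
    at the point [s = 1/2]; but there the squares alone contribute the harmonic series. *)
Lemma real_char_neq0 : L chi 1 != 0.
Proof.
apply/eqP => L0; have c1 := t_coef_cvg (w := 1).
have E1 : (fun n => \sum_(j < n) t_coef j * 1 ^+ j) = (fun n => \sum_(j < n) t_coef j).
  by apply/funext => n; apply: eq_bigr => j _; rewrite expr1n mulr1.
rewrite E1 (_ : (2 - 1 : R)%:C%C = 1) in c1; last first.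
  by rewrite (_ : 2 - 1 = 1 :> R) ?rmorph1//; ring.
rewrite L0 in c1.
have [B HB] := estermann_bounded (ler0n _ q) t_coef_le y_coef_le c1.
have sqB M : \sum_(1 <= m < M) (m%:R : R)^-1 <= B.
  have cv : (fun K => \sum_(1 <= m < M) npow 4 m * expT K (3 * ln m%:R)) @ \oo -->
      (\sum_(1 <= m < M) npow 4 m * expR (3 * ln m%:R) : R).
    by apply: cvg_big => [|m _]; [exact: add_continuous|apply: cvgMr; exact: expT_cvg].
  have -> : \sum_(1 <= m < M) (m%:R : R)^-1 =
      \sum_(1 <= m < M) npow 4 m * expR (3 * ln m%:R).
    rewrite big_nat [RHS]big_nat; apply: eq_bigr => m /andP[m0 _].
    by rewrite -npow_inv// /npow -expRD; congr expR; ring.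
  apply: (cvgr_to_le cv).
  apply: nearW => K /=; apply: le_trans (HB K).
  rewrite /expT; under eq_bigr do rewrite mulr_sumr.
  rewrite exchange_big /=; apply: ler_sum => k _.
  apply: le_trans (ler_wpM2r _ (b_coef_ge_squares k M)); last first.
    by rewrite exprn_ge0//; lra.
  rewrite mulr_suml; apply: ler_sum => m _.
  rewrite le_eqVlt; apply/orP; left; apply/eqP.
  have -> : (3 : R) * ln m%:R = 2 * ln m%:R * (3 / 2) by field.
  by rewrite exprMn; ring.
have [n Hn] : exists n : nat, expR (B + 1) < n%:R by exists (Num.truncn (expR (B + 1))).+1; exact: truncnS_gt.
have n0 : (0 < n)%N.
  by rewrite -(ltr0n R); apply: lt_trans Hn; exact: expR_gt0.
have := sqB n; have := harmonic_ge_ln n0.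
have : B + 1 < ln n%:R by rewrite -ltr_expR lnK ?posrE ?ltr0n.
lra.
Qed.

End RealCharacter.
End NonVanishing.

(** * Complex characters: nonvanishing at 1 *)

Section ComplexCharacter.
Variable R : realType.
Local Notation C := R[i].
Variable c0 : R.
Hypotheses (c0_gt0 : 0 < c0) (c0_exceptional : exceptional_zero_const c0).
Variable q : nat.
Hypothesis q1 : (1 < q)%N.
Local Notation D := (@dirichlet_char R q).
Local Notation ch := {ffun 'Z_q -> cplx R}.
Implicit Types (chi psi : ch).
Local Notation L := (@dirichletL R q).

(** Unlike the modulus, its square is differentiable also at zeros. *)
Lemma is_derive_sqr_cabsL chi (x : R) : D chi -> 1 < x ->
  is_derive x 1 (fun t => cabs (L chi t%:C%C) ^+ 2)
    (- 2 * Re (dlim (mangoldt_term chi x)) * cabs (L chi x%:C%C) ^+ 2).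
Proof.
move=> Dc x1; have [_ dL] := dirichletL_logderiv c0_gt0 c0_exceptional q1 Dc x1.
set S := dlim _ in dL *.
have [|r1 r2] := @rdiff_line R (L chi) 0 1 x (- S * L chi x%:C%C).
  by rewrite add0r mulr1.
have -> : (fun t : R => cabs (L chi t%:C%C) ^+ 2) =
  (fun t : R => Re (L chi (0 + t%:C%C * 1))) ^+ 2 +
  (fun t : R => Im (L chi (0 + t%:C%C * 1))) ^+ 2.
  by apply/funext => t; rewrite sqr_cabs addrfctE !exprfctE /= add0r mulr1.
apply: is_derive_eq (is_deriveD (is_deriveX 2 r1) (is_deriveX 2 r2)) _.
rewrite /GRing.scale /=. rewrite add0r !mulr1 sqr_cabs ReM ImM ReN ImN.
ring.
Qed.

(** The inequality [3 + 4 cos t + cos (2 t) >= 0], weighted by von Mangoldt's function. *)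
Lemma mangoldt_341_ge0 chi (x : R) : D chi -> 1 < x ->
  0 <= 3 * Re (dlim (mangoldt_term (principal_char R q) x)) +
       4 * Re (dlim (mangoldt_term chi x)) +
       Re (dlim (mangoldt_term (mul_char chi chi) x)).
Proof.
move=> Dc x1; have Dp := @principal_dirichlet R q; have D2 := dirichlet_mul Dc Dc.
have [/clim_Re l0 _] := dirichletL_logderiv c0_gt0 c0_exceptional q1 Dp x1.
have [/clim_Re l1 _] := dirichletL_logderiv c0_gt0 c0_exceptional q1 Dc x1.
have [/clim_Re l2 _] := dirichletL_logderiv c0_gt0 c0_exceptional q1 D2 x1.
have l : (fun N => 3 * Re (dsum (mangoldt_term (principal_char R q) x) N) +
    4 * Re (dsum (mangoldt_term chi x) N) +
    Re (dsum (mangoldt_term (mul_char chi chi) x) N)) @ \oo -->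
   3 * Re (dlim (mangoldt_term (principal_char R q) x)) +
       4 * Re (dlim (mangoldt_term chi x)) +
       Re (dlim (mangoldt_term (mul_char chi chi) x)).
  by apply: cvgD l2; apply: cvgD; exact: cvgMr.
apply: (cvgr_to_ge l); apply: nearW => N; rewrite /dsum !Re_sum !mulr_sumr -!big_split /=.
rewrite big_nat sumr_ge0// => n /andP[n0 _].
have T psi : Re (mangoldt_term psi x n) = mangoldt R n * npow x n * Re (cnat psi n).
  by rewrite /mangoldt_term /nterm ReZ mulrC [X in Re X]mulrC ReZ; ring.
rewrite !T.
have -> : 3 * (mangoldt R n * npow x n * Re (cnat (principal_char R q) n)) +
  4 * (mangoldt R n * npow x n * Re (cnat chi n)) +
  mangoldt R n * npow x n * Re (cnat (mul_char chi chi) n) =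
  mangoldt R n * npow x n * (3 * Re (cnat (principal_char R q) n) +
     4 * Re (cnat chi n) + Re (cnat (mul_char chi chi) n)) by ring.
apply: mulr_ge0; first by rewrite mulr_ge0 ?npow_ge0 ?mangoldt_ge0.
rewrite /cnat !ffunE; case: (boolP (n%:R \is a GRing.unit)) => un; last first.
  by rewrite (char_nunit Dc un) mul0r /= !mulr0 !addr0.
have := cabs_char Dc un => /(congr1 (fun z => z ^+ 2)); rewrite sqr_cabs expr1n ReM /=.
move: (Re _) (Im _) => a b ab.
have -> : 3 * 1 + 4 * a + (a * a - b * b) = 2 * (a + 1) ^+ 2 by lra.
by rewrite mulr_ge0// sqr_ge0.
Qed.

(** The sixth, eighth and second powers of the moduli are the squares of the classical
    3-4-1 product. *)
Definition zeta341 chi (t : R) := (cabs (L (principal_char R q) t%:C%C) ^+ 2) ^+ 3 *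
     (cabs (L chi t%:C%C) ^+ 2) ^+ 4 * cabs (L (mul_char chi chi) t%:C%C) ^+ 2.

(** The logarithmic derivative is minus twice the quantity in [mangoldt_341_ge0]. *)
Lemma zeta341_decr chi (x y : R) : D chi -> 1 < x -> x <= y ->
  zeta341 chi y <= zeta341 chi x.
Proof.
move=> Dc x1 xy; pose V := zeta341 chi.
have Dp := @principal_dirichlet R q; have D2 := dirichlet_mul Dc Dc.
pose W (t : R) : R := - 2 * (3 * Re (dlim (mangoldt_term (principal_char R q) t)) +
       4 * Re (dlim (mangoldt_term chi t)) +
       Re (dlim (mangoldt_term (mul_char chi chi) t))) * V t.
have dV (t : R) : 1 < t -> is_derive t 1 V (W t).
  move=> t1.
  have d0 := is_derive_sqr_cabsL Dp t1; have d1 := is_derive_sqr_cabsL Dc t1.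
  have d2 := is_derive_sqr_cabsL D2 t1.
  have VE : V = (fun t : R => cabs (L (principal_char R q) t%:C%C) ^+ 2) ^+ 3 *
     (fun t : R => cabs (L chi t%:C%C) ^+ 2) ^+ 4 *
     (fun t : R => cabs (L (mul_char chi chi) t%:C%C) ^+ 2).
    by apply/funext => s; rewrite /V /zeta341 !mulrfctE !exprfctE.
  rewrite VE.
  apply: is_derive_eq (is_deriveM (is_deriveM (is_deriveX 3 d0) (is_deriveX 4 d1)) d2) _.
  rewrite /W /V /zeta341 /GRing.scale /= mulrfctE !exprfctE /=.
  ring.
have [||c] := @MVT_segment R V W x y xy.
- by move=> t; rewrite in_itv /= => /andP[xt _]; apply: dV; exact: lt_trans xt.
- apply: continuous_in_subspaceT => t; rewrite inE /= in_itv /= => /andP[xt _].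
  exact: is_derive_continuous (dV t (lt_le_trans x1 xt)).
rewrite in_itv /= => /andP[xc _] E; rewrite -subr_le0 E.
apply: mulr_le0_ge0; last by rewrite subr_ge0.
have c1 : 1 < c by apply: lt_le_trans xc.
rewrite /W.
have := mangoldt_341_ge0 Dc c1; set Z := _ + _ => Z0.
have V0 : 0 <= V c 
  by apply: mulr_ge0; [apply: mulr_ge0; apply: exprn_ge0|]; apply: exprn_ge0; rewrite ?exprn_ge0 ?cabs_ge0.
nra.
Qed.

(** If [L(1, chi) = 0], the product behaves like [h ^ (8 - 6)] at [1 + h], so it tends to 0;
    but it decreases away from 1, and is positive at 2. *)
Lemma complex_char_neq0 chi : D chi -> chi <> principal_char R q ->
  mul_char chi chi <> principal_char R q -> L chi 1 != 0.
Proof.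
move=> Dc np np2; have Dp := @principal_dirichlet R q; have D2 := dirichlet_mul Dc Dc.
apply/eqP => L1.
have [l /cdiffP dl] := dirichletL_cdiff c0_gt0 c0_exceptional q1 (s := 1) Dc
  (fun E => False_ind _ (np E)).
have [l2 /cdiff_cont c2] := dirichletL_cdiff c0_gt0 c0_exceptional q1 (s := 1) D2
  (fun E => False_ind _ (np2 E)).
have [d1 d10 H1] := dl 1 ltr01; have [d2 d20 H2] := c2 1 ltr01.
pose A := cabs l + 1; have A0 : 0 < A by rewrite /A ltr_wpDl ?cabs_ge0.
pose B := cabs (L (mul_char chi chi) 1) + 1.
have B0 : 0 < B by rewrite /B ltr_wpDl ?cabs_ge0.
pose V := zeta341 chi.
have V2 : 0 < V 2.
  have P psi : D psi -> 0 < cabs (L psi 2%:C%C).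
    by move=> Dpsi; rewrite cabs_gt0 (dirichletL_neq0 c0_gt0 c0_exceptional)// ltr1n.
  rewrite /V /zeta341; apply: mulr_gt0; last exact: exprn_gt0 (P _ D2).
  by apply: mulr_gt0; do 2 apply: exprn_gt0; apply: P.
pose K := 2 ^+ 6 * A ^+ 8 * B ^+ 2.
have K0 : 0 < K by rewrite /K !mulr_gt0// exprn_gt0.
have small (h : R) : 0 < h -> h < d1 -> h < d2 -> h < 1 -> V 2 <= K * h ^+ 2.
  move=> h0 hd1 hd2 h1.
  have x1 : 1 < 1 + h by lra.
  have := @zeta341_decr chi (1 + h) 2 Dc x1; rewrite -/V.
  move=> H; apply: (@le_trans _ _ (V (1 + h))); first by apply: H; lra.
  have hE : (1 + h)%:C%C = 1 + h%:C%C :> C by rewrite rmorphD rmorph1.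
  have b0 : cabs (L (principal_char R q) (1 + h)%:C%C) <= 2 / h.
    apply: (le_trans (dirichletL_le_zeta c0_gt0 c0_exceptional q1 Dp x1)).
    have -> : 1 + h - 1 = h by ring.
    have i1 : 1 <= h^-1 by rewrite invf_ge1// ltW.
    by move: i1; move: (h^-1) => i i1; lra.
  have b1 : cabs (L chi (1 + h)%:C%C) <= A * h.
    have := H1 h%:C%C; rewrite cabs_real gtr0_norm// => /(_ hd1).
    rewrite L1 subr0 -hE => H3.
    have := ler_cabsB (L chi (1 + h)%:C%C) (h%:C%C * l).
    by rewrite cabsM cabs_real gtr0_norm// /A; lra.
  have b2 : cabs (L (mul_char chi chi) (1 + h)%:C%C) <= B.
    have := H2 h%:C%C; rewrite cabs_real gtr0_norm// => /(_ hd2); rewrite -hE => H3.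
    have := ler_cabsB (L (mul_char chi chi) (1 + h)%:C%C) (L (mul_char chi chi) 1).
    by rewrite /B; lra.
  have -> : K * h ^+ 2 = ((2 / h) ^+ 2) ^+ 3 * ((A * h) ^+ 2) ^+ 4 * B ^+ 2.
    by rewrite /K; field; rewrite gt_eqF.
  have h20 : 0 <= 2 / h by rewrite divr_ge0// ltW.
  have Ah0 : 0 <= A * h by rewrite mulr_ge0 ?(ltW A0) ?(ltW h0).
  rewrite /V /zeta341; apply: ler_pM; rewrite ?mulr_ge0 ?exprn_ge0 ?cabs_ge0//; last first.
    by rewrite lerXn2r ?nnegrE ?cabs_ge0 ?(ltW B0).
  apply: ler_pM; rewrite ?exprn_ge0 ?cabs_ge0//.
    by rewrite !lerXn2r ?nnegrE ?exprn_ge0 ?cabs_ge0.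
  by rewrite !lerXn2r ?nnegrE ?exprn_ge0 ?cabs_ge0.
pose h := Num.min (Num.min (d1 / 2) (d2 / 2)) (Num.min (1 / 2) (V 2 / (2 * K))).
have h0 : 0 < h.
  rewrite /h !lt_min; do ?(apply/andP; split); try lra.
  by rewrite divr_gt0// mulr_gt0.
have : h <= h by []; rewrite {2}/h !le_min => /andP[/andP[e1 e2] /andP[e3]].
rewrite ler_pdivlMr ?mulr_gt0// => e4.
have H : V 2 <= K * h ^+ 2 by apply: small; lra.
have u : K * h * h <= K * h * (1 / 2) by apply: ler_wpM2l => //; rewrite mulr_ge0 ?ltW.
have H' : V 2 <= K * h * h by rewrite -mulrA -expr2.
have e4' : 2 * (K * h) <= V 2 by rewrite mulrA mulrC.
by move: H' e4' u V2; move: (K * h) => u; move: (u * h) (V 2) => w v; clear L1; lra.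
Qed.

Theorem nonprincipal_neq0 chi : D chi -> chi <> principal_char R q -> L chi 1 != 0.
Proof.
move=> Dc np; have [E|np2] := eqVneq (mul_char chi chi) (principal_char R q).
  exact: (real_char_neq0 c0_gt0 c0_exceptional q1 Dc np E).
by apply: complex_char_neq0 => //; apply/eqP.
Qed.

End ComplexCharacter.

(** * The diagonal sum over squarefree integers *)

Section Image.

(** Sums over the image of an increasing map, reindexed; applied to multiples and to squares. *)
Lemma dsum_image (V : comNzRingType) (h : nat -> nat) (I : pred nat) (a : nat -> V) M :
  {homo h : m n / (m < n)%N} -> (0 < M)%N -> (forall m, (0 < m)%N -> I (h m)) ->
  (forall n, (0 < n)%N -> I n -> exists2 m, (0 < m)%N & n = h m) ->
  dsum (fun n => if I n then a n else 0) (h M) = dsum (fun m => a (h m)) M.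
Proof.
move=> hh M0 Ih hI; rewrite /dsum -big_mkcond /= -big_filter.
rewrite -(big_map h xpredT) /=; congr bigop.
have h0 m : (0 < m)%N -> (0 < h m)%N by move=> m0; apply: leq_trans (hh _ _ m0).
have hle m n : (h m < h n)%N = (m < n)%N.
  apply/idP/idP => [|/hh//]; rewrite !ltnNge; apply: contra.
  by rewrite leq_eqVlt => /orP[/eqP->//|/hh/ltnW].
apply: (irr_sorted_eq ltn_trans ltnn).
- apply: sorted_filter; first exact: ltn_trans.
  by rewrite /index_iota iota_ltn_sorted.
- rewrite (homo_sorted (e := ltn))//.
  by rewrite /index_iota iota_ltn_sorted.
move=> n; rewrite mem_filter mem_index_iota; apply/idP/mapP => [/and3P[In n0 nM]|[m]].
  have [m m0 E] := hI _ n0 In; exists m => //.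
  by rewrite mem_index_iota m0 -hle -E.
by rewrite mem_index_iota => /andP[m0 mM] ->; rewrite Ih// h0// hh.
Qed.

Lemma clim_image (R : realType) (h : nat -> nat) (I : pred nat) (a : nat -> R[i]) l :
  {homo h : m n / (m < n)%N} -> (forall m, (0 < m)%N -> I (h m)) ->
  (forall n, (0 < n)%N -> I n -> exists2 m, (0 < m)%N & n = h m) ->
  clim (dsum (fun n => if I n then a n else 0)) l -> clim (dsum (fun m => a (h m))) l.
Proof.
move=> hh Ih hI H e /H[N HN]; exists (maxn N 1) => M; rewrite geq_max => /andP[NM M0].
rewrite -(dsum_image a hh M0 Ih hI); apply: HN; apply: (leq_trans NM).
by elim: M {NM M0} => // M IH; apply: leq_ltn_trans IH _; exact: hh.
Qed.

End Image.

Section ZetaEuler.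
Variable R : realType.
Local Notation C := R[i].
Implicit Types (P : seq nat).

Definition rough P n := all (fun p => ~~ (p %| n)%N) P.
Definition zterm P k n : C := if rough P n then (n%:R ^- k : R)%:C%C else 0.

Lemma zterm_bnd P k (I : pred nat) : (1 < k)%N ->
  forall N, dsum (fun n => cabs (if I n then zterm P k n else 0)) N <= 2.
Proof.
move=> k1 N; have := @npow_sum_le R 1 N ltr01; rewrite invr1 => H.
apply: le_trans (H : _ <= 2); rewrite /dsum big_nat [leRHS]big_nat.
apply: ler_sum => n /andP[n0 _]; rewrite (npow_nat R 2 n0).
have n1 : (1 : R) <= n%:R by rewrite ler1n.
have p0 : (0 : R) <= n%:R ^- 2 by rewrite invr_ge0 exprn_ge0.
rewrite /zterm; case: ifP => _; last by rewrite cabs0.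
case: ifP => _; last by rewrite cabs0.
rewrite cabs_real ger0_norm ?invr_ge0 ?exprn_ge0//.
by rewrite lef_pV2 ?posrE ?exprn_gt0 ?ltr0n// ler_weXn2l.
Qed.

Lemma zterm_clim P k : (1 < k)%N -> clim (dsum (zterm P k)) (dlim (zterm P k)).
Proof. by move=> k1; apply: dlimP; exact: (@zterm_bnd P k xpredT k1). Qed.

Lemma rough_mul P m n : all prime P -> rough P (m * n) = rough P m && rough P n.
Proof.
rewrite /rough; elim: P => //= p P IH /andP[p_pr /IH ->].
by rewrite Euclid_dvdM// negb_or andbACA.
Qed.

Lemma zterm_mul P k m n : all prime P -> zterm P k (m * n) = zterm P k m * zterm P k n.
Proof.
move=> Pp; rewrite /zterm rough_mul//; do 2 case: rough; rewrite /= ?mul0r ?mulr0//.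
by rewrite -rmorphM natrM exprMn invfM.
Qed.

(** One step of the Euler product: remove the multiples of [p], a copy of the sum scaled by
    [p ^ (- k)]. *)
Lemma zterm_sieve P p k : (1 < k)%N -> all prime P -> prime p -> p \notin P ->
  dlim (zterm (p :: P) k) = dlim (zterm P k) * (1 - p%:R ^- k)%:C%C.
Proof.
move=> k1 Pp p_pr pP; have p0 := prime_gt0 p_pr.
have [l Hl] := dsum_abs_clim (@zterm_bnd P k (fun n => p %| n)%N k1).
have roughp : rough P p.
  apply/allP => r rP; rewrite dvdn_prime2 ?(allP Pp r rP)//.
  by apply: contraNneq pP => <-.
have E : l = (p%:R ^- k : R)%:C%C * dlim (zterm P k).
  apply: (@clim_unique _ (dsum (fun m => zterm P k (p * m)))).
    apply: (@clim_image _ (fun m => p * m)%N (fun n => p %| n)%N) Hl.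
    - by move=> m n mn; rewrite ltn_pmul2l.
    - by move=> m m0; rewrite dvdn_mulr.
    - move=> n n0 /dvdnP[m nE]; exists m; last by rewrite nE mulnC.
      by move: n0; rewrite nE; case: m {nE}.
  apply: clim_ext (climZ _ (zterm_clim P k1)); exists 0%N => N _.
  rewrite /dsum mulr_sumr; apply: eq_bigr => m _.
  rewrite zterm_mul//; congr (_ * _); rewrite /zterm.
  by have -> := roughp.
apply: dlimE; have := climB (zterm_clim P k1) Hl.
rewrite E rmorphB rmorph1 mulrBr mulr1 [in X in _ -> X](mulrC (dlim _)).
apply: clim_ext; exists 0%N => N _; rewrite /dsum -sumrB; apply: eq_bigr => n _.
by rewrite /zterm /=; case: (_ %| _)%N; rewrite /= ?subrr ?subr0.
Qed.

Lemma zterm_dlim P k : (1 < k)%N -> all prime P -> uniq P ->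
  dlim (zterm P k) = dlim (zterm [::] k) * (\prod_(p <- P) (1 - p%:R ^- k))%:C%C.
Proof.
move=> k1; elim: P => [|p P IH] /=; first by rewrite big_nil rmorph1 mulr1.
move=> /andP[p_pr Pp] /andP[pP uP]; rewrite zterm_sieve// IH// big_cons rmorphM.
by rewrite -mulrA [X in _ = _ * X]mulrC.
Qed.

Lemma zeta_natE k : (1 < k)%N -> dlim (zterm [::] k) = (zeta_nat R k)%:C%C.
Proof.
move=> k1; have H := zterm_clim [::] k1.
have S N : dsum (zterm [::] k) N = (\sum_(1 <= n < N) (n%:R ^- k : R))%:C%C.
  by rewrite /dsum rmorph_sum.
have : (fun N => \sum_(1 <= n < N) (n%:R ^- k : R)) @ \oo --> Re (dlim (zterm [::] k)).
  by have := clim_Re H; under eq_fun do rewrite S.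
rewrite /zeta_nat => /cvg_lim -> //; apply: complexP => //=.
apply/eqP; rewrite -normr_le0; apply/ler_addgt0Pr => e e0; rewrite add0r.
have [N HN] := H e e0; have := HN N (leqnn N); rewrite cabsBC S => h.
by apply: le_trans h; apply: le_trans (cabs_Im _); rewrite ImD ImN /= subr0.
Qed.

Lemma zeta_nat_ge1 k : (1 < k)%N -> 1 <= zeta_nat R k.
Proof.
move=> k1; have := clim_Re (zterm_clim [::] k1); rewrite zeta_natE//= => H.
apply: (cvgr_to_ge H); exists 2%N => // N /= N2.
case: N N2 => [//|[//|N]] _; rewrite /dsum Re_sum big_nat_recl//=.
by rewrite expr1n invr1 lerDl sumr_ge0// => n _; rewrite invr_ge0 exprn_ge0.
Qed.

(** The squarefree part times the square part is everything: the sum times the sum over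
    squares, which is the sum with exponent 4, is the sum with exponent 2. *)
Lemma mu2_zterm_clim q : (0 < q)%N ->
  clim (dsum (fun n => (mu2 R n)%:C%C * zterm (primes q) 2 n))
   (zeta_nat R 2 / zeta_nat R 4 * \prod_(p <- primes q) (1 + p%:R ^- 2)^-1)%:C%C.
Proof.
move=> q0; set P := primes q.
have Pp : all prime P by apply/allP => p; rewrite mem_primes => /andP[].
have uP : uniq P by exact: primes_uniq.
pose a n := (mu2 R n)%:C%C * zterm P 2 n.
pose b n := if issq n then zterm P 2 n else 0.
have aB N : dsum (fun n => cabs (a n)) N <= 2.
  apply: le_trans (@zterm_bnd P 2 sqf isT N); apply: ler_sum => n _.
  by rewrite /a /mu2; case: sqf; rewrite /= ?rmorph1 ?mul1r// rmorph0 mul0r.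
have bB := @zterm_bnd P 2 issq isT.
have [la Ha] := dsum_abs_clim aB; have [lb Hb] := dsum_abs_clim bB.
have E1 : lb = dlim (zterm P 4).
  apply: (@clim_unique _ (dsum (fun m => zterm P 2 (m ^ 2)))).
    apply: (@clim_image _ (fun m => m ^ 2)%N issq) Hb.
    - by move=> m n mn; rewrite ltn_exp2r.
    - by move=> m _; apply/issqP; exists m.
    - by move=> n n0 /issqP[[|m] nE]; [rewrite nE in n0|exists m.+1].
  apply: clim_ext (zterm_clim P (isT : 1 < 4)%N); exists 0%N => N _.
  apply: eq_bigr => m _; rewrite -mulnn /zterm rough_mul// andbb.
  by rewrite natrM -expr2 -exprM.
have E2 : la * lb = dlim (zterm P 2).
  apply: (@clim_unique _ (dsum (dconv a b))).
    exact: dirichlet_product aB bB Ha Hb.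
  apply: clim_ext (zterm_clim P (isT : 1 < 2)%N); exists 0%N => N _.
  rewrite /dsum big_nat [RHS]big_nat; apply: eq_bigr => n /andP[n0 _].
  rewrite /dconv -[LHS]mulr1 -(rmorph1 (real_complex R)) -(sum_mu2_issq R n0).
  rewrite rmorph_sum mulr_sumr big_seq [RHS]big_seq; apply: eq_bigr => d.
  rewrite -dvdn_divisors// => dn.
  have zn : zterm P 2 n = zterm P 2 d * zterm P 2 (n %/ d)%N.
    by rewrite -zterm_mul// mulnC divnK.
  rewrite /a /b zn; case: issq; rewrite /= ?mulr1n ?mulr0n ?mulr1 ?mulr0 ?rmorph0 ?mulr0//.
  by rewrite mulrC mulrA.
suff <- : la = (zeta_nat R 2 / zeta_nat R 4 *
   \prod_(p <- P) (1 + p%:R ^- 2)^-1)%:C%C by exact: Ha.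
have z4 := zeta_nat_ge1 (isT : 1 < 4)%N.
move: E2; rewrite E1 (zterm_dlim _ Pp uP)// (@zterm_dlim P 2)// !zeta_natE// -!rmorphM.
set z2 := zeta_nat R 2; set z := zeta_nat R 4 in z4 *.
have p2 p : p \in P -> (0 : R) < p%:R ^- 2 /\ (p%:R ^- 2 : R) < 1.
  move=> /(allP Pp) /prime_gt1 p1; rewrite invr_gt0 exprn_gt0 ?ltr0n ?(ltnW p1)//.
  by rewrite invf_lt1 ?exprn_gt0 ?ltr0n ?(ltnW p1)// exprn_egt1// ltr1n.
have pE : \prod_(p <- P) (1 - p%:R ^- 4) =
  (\prod_(p <- P) (1 - p%:R ^- 2)) / \prod_(p <- P) (1 + p%:R ^- 2)^-1 :> R.
  rewrite prodfV invrK -big_split /=; apply: eq_bigr => p _.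
  have -> : p%:R ^- 4 = (p%:R ^- 2) ^+ 2 :> R by rewrite exprVn -exprM.
  by move: (p%:R ^- 2) => x; ring.
rewrite pE; set A := \prod_(p <- P) (1 - _); set B := \prod_(p <- P) _.
have A0 : A != 0.
  rewrite /A big_seq prodf_seq_neq0; apply/allP => p _; apply/implyP => /p2[_ h].
  by rewrite subr_eq0 gt_eqF.
have B0 : B != 0.
  rewrite /B big_seq prodf_seq_neq0; apply/allP => p _; apply/implyP => /p2[h _].
  by rewrite invr_eq0 gt_eqF// ltr_wpDl.
have z0 : z != 0 by rewrite gt_eqF// (lt_le_trans ltr01).
have Z0 : z * (A / B) != 0 by apply: mulf_neq0 => //; apply: mulf_neq0; rewrite ?invr_eq0.
move=> E; apply: (mulIf (_ : (z * (A / B))%:C%C != 0)); first by rewrite fmorph_eq0.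
rewrite E -rmorphM; congr (_%:C%C); move: z2 z A B z0 A0 B0 {pE E Z0 z4} => u v A B v0 A0 B0.
by field; rewrite ?A0 ?B0 ?v0.
Qed.

End ZetaEuler.

(** * The smoothed weights and the off-diagonal sum *)

Section Weight.
Variable R : realType.

Lemma bernoulli_le (x : R) n : 0 <= x -> x <= 1 -> 1 - n%:R * x <= (1 - x) ^+ n.
Proof.
move=> x0 x1; elim: n => [|n IH]; first by rewrite mul0r subr0 expr0.
have h : (1 - n%:R * x) * (1 - x) <= (1 - x) ^+ n * (1 - x) by rewrite ler_wpM2r// subr_ge0.
rewrite exprSr (le_trans _ h)// -natr1.
have : 0 <= n%:R * (x * x) by rewrite mulr_ge0// mulr_ge0.
by move: (n%:R : R) => m; nra.
Qed.

(** From [exp (- 1/6) >= 5/6], raised to the sixth power. *)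
Lemma expR1_lt3 : expR 1 < 3 :> R.
Proof.
have h : (5 / 6 : R) <= expR (- (1 / 6)) by have := expR_ge1Dx (- (1 / 6) : R); lra.
have e : (5 / 6 : R) ^+ 6 <= expR (- 1).
  have -> : expR (- 1) = expR (- (1 / 6)) ^+ 6 :> R.
    by rewrite -expRM_natl; congr expR; lra.
  by rewrite lerXn2r ?nnegrE ?expR_ge0//; lra.
have : (1 / 3 : R) < expR (- 1).
  apply: lt_le_trans e; rewrite !exprS expr0; lra.
rewrite expRN; have := expR_gt0 (1 : R); move: (expR 1) => x x0.
by rewrite ltr_pdivrMr// mulrC ltr_pdivlMr//; lra.
Qed.

(** Chernoff's bound with the parameter [1 - 1 / (2 K)], whose [K]-th power is at least 1/2
    by Bernoulli's inequality. The weak decay obtained makes the weighted harmonic series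
    converge. *)
Lemma poisson_exp_le K u : (0 < K)%N -> 0 <= u ->
  poisson K u <= 2 * expR (- (u / (2 * K%:R))) :> R.
Proof.
move=> K0 u0; have k0 : (0 : R) < K%:R by rewrite ltr0n.
have k1 : (1 : R) <= K%:R by rewrite ler1n.
set y : R := (2 * K%:R)^-1; have y0 : 0 < y by rewrite invr_gt0; lra.
have ky : K%:R * y = 1 / 2 by rewrite /y invfM mulrCA mulfV ?gt_eqF// mulr1 div1r.
have y1 : y <= 1 by nra.
have b := @bernoulli_le y K (ltW y0) y1; rewrite ky in b.
have x0 : 0 <= 1 - y by lra.
have x1 : 1 - y <= 1 by lra.
have H : (1 - y) ^+ K * expT K u <= expR ((1 - y) * u).
  apply: le_trans (expT_le_expR K _); last by rewrite mulr_ge0.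
  rewrite /expT mulr_sumr; apply: ler_sum => j _.
  rewrite exprMn -mulrA ler_wpM2r ?divr_ge0 ?exprn_ge0//.
  by rewrite ler_wiXn2l// ltnW.
have h2 : expT K u <= 2 * expR ((1 - y) * u).
  have := expT_ge0 K u0; move: H b; move: (expT K u) (_ ^+ K) (expR _) => E p X.
  by move=> H b E0; nra.
have -> : expR (- (u / (2 * K%:R))) = expR (- u) * expR ((1 - y) * u) :> R.
  by rewrite -expRD; congr expR; rewrite -/y; ring.
by rewrite mulrCA /poisson ler_wpM2l// expR_ge0.
Qed.

Lemma one_sub_poisson_le K (u : R) : 0 <= u -> 1 - poisson K u <= 2 ^- K * expR u.
Proof.
move=> u0; have h2 : (0 : R) < 1 / 2 by lra.
have h3 : (1 / 2 : R) <= 1 by lra.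
have := expR_tail K u h2 h3; rewrite (ger0_norm u0) => /(le_trans (ler_norm _)) H.
have -> : 1 - poisson K u = expR (- u) * (expR u - expT K u).
  by rewrite /poisson mulrBr -expRD addNr expR0.
have -> : 2 ^- K * expR u = expR (- u) * ((1 / 2) ^+ K * expR (u / (1 / 2))).
  rewrite mulrCA -expRD div1r exprVn; congr (_ * expR _); lra.
by rewrite ler_wpM2l// expR_ge0.
Qed.

Variables (delta : R) (K : nat).
Hypotheses (d0 : 0 < delta) (d1 : delta <= 1 / 2) (K0 : (0 < K)%N).

(** The weights [1 / n] of the series of [1 / L(1, chi)], smoothed by the factor that
    truncating the Taylor series at [1 + delta] after [K] terms creates. *)
Definition weight n : R := npow 1 n * poisson K (delta * ln n%:R).

Let dl n : 0 <= delta * ln n%:R. Proof. by rewrite mulr_ge0 ?ln_nat_ge0 ?ltW. Qed.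

Lemma weight_ge0 n : 0 <= weight n.
Proof. by rewrite mulr_ge0 ?npow_ge0 ?poisson_ge0. Qed.

Lemma weight_le n : weight n <= 2 * npow (1 + delta / (2 * K%:R)) n.
Proof.
rewrite npowD mulrCA ler_wpM2l ?npow_ge0//; apply: (le_trans (poisson_exp_le K0 (dl n))).
by rewrite ler_wpM2l// /npow mulrAC.
Qed.

Lemma weight_sum_le N : dsum weight N <= 2 * (1 + (delta / (2 * K%:R))^-1).
Proof.
have e0 : 0 < delta / (2 * K%:R) by rewrite divr_gt0// mulr_gt0 ?ltr0n.
apply: le_trans (_ : 2 * dsum (npow (1 + delta / (2 * K%:R))) N <= _).
  by rewrite /dsum mulr_sumr; apply: ler_sum => n _; exact: weight_le.
by rewrite ler_wpM2l// npow_sum_le.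
Qed.

Lemma weight_sqr_sum_le N :
  \sum_(1 <= n < N) (n%:R ^- 2 - weight n ^+ 2) <= 6 * 2 ^- K.
Proof.
have i0 : (0 : R) <= 2 ^- K by rewrite invr_ge0 exprn_ge0.
have H : dsum (npow (1 + (1 - delta))) N <= 3.
  have d1' := d1; have dd : 0 < 1 - delta by lra.
  apply: (le_trans (npow_sum_le N dd)); have : (1 - delta)^-1 <= 2.
    by rewrite -[leRHS]invrK lef_pV2 ?posrE ?invr_gt0//; lra.
  by lra.
apply: le_trans (_ : (2 * 2 ^- K) * dsum (npow (1 + (1 - delta))) N <= _).
  rewrite /dsum mulr_sumr big_nat [leRHS]big_nat; apply: ler_sum => n /andP[n0 _].
  have p2 : npow 1 n * npow 1 n = n%:R ^- 2 :> R by rewrite npow_inv// -expr2 exprVn.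
  have -> : npow (1 + (1 - delta)) n = npow 1 n * npow 1 n * expR (delta * ln n%:R).
    by rewrite /npow -!expRD; congr expR; move: (ln _) => y; ring.
  rewrite p2 /weight exprMn [npow 1 n ^+ 2]expr2 p2.
  have p0 := poisson_ge0 K (dl n); have p1 := poisson_le1 K (dl n).
  have := one_sub_poisson_le K (dl n).
  have : (0 : R) <= n%:R ^- 2 by rewrite invr_ge0 exprn_ge0.
  move: p0 p1 i0; move: (n%:R ^- 2) (poisson _ _) (expR _) (2 ^- K) => a p y t p0 p1 t0 a0 h.
  have -> : 2 * t * (a * y) = a * (2 * (t * y)) by ring.
  rewrite -[X in X - _]mulr1 -mulrBr ler_wpM2l//.
  nra.
by nra.
Qed.

End Weight.

Section OffDiagonal.
Variable R : realType.

Lemma sum_inj_le (f : nat -> nat) (g : nat -> R) (I : pred nat) M J :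
  (forall j, 0 <= g j) ->
  (forall n n', (0 < n)%N -> (0 < n')%N -> I n -> I n' -> f n = f n' -> n = n') ->
  (forall n, (0 < n < M)%N -> I n -> (f n < J)%N) ->
  \sum_(1 <= n < M | I n) g (f n) <= \sum_(0 <= j < J) g j.
Proof.
move=> g0 fI fJ; rewrite -big_filter -(big_map f xpredT g).
set s := [seq n <- index_iota 1 M | I n]; set t := map f s.
have sP n : n \in s -> (0 < n)%N && I n && (n < M)%N.
  by rewrite mem_filter mem_index_iota => /and3P[-> -> ->].
have ut : uniq t.
  rewrite map_inj_in_uniq ?filter_uniq ?iota_uniq// => n n'.
  by move=> /sP/andP[/andP[? ?] _] /sP/andP[/andP[? ?] _]; exact: fI.
rewrite [leRHS](bigID (fun j => j \in t)) /= -[leLHS]addr0 lerD ?sumr_ge0//.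
rewrite -[leRHS]big_filter le_eqVlt; apply/orP; left; apply/eqP; apply: perm_big.
apply: uniq_perm => //; first by rewrite filter_uniq// iota_uniq.
move=> j; rewrite [RHS]mem_filter mem_index_iota /=; case jt: (j \in t) => //=.
have /mapP[n /sP/andP[/andP[n0 In] nM] ->] := jt.
by rewrite fJ// n0.
Qed.

(** Two distinct integers of one residue class have distinct quotients by [q]; the condition
    [q <= 2 n] makes the term of quotient 0 harmless. *)
Lemma residue_sum_le (I : pred nat) (eta : R) q M : (0 < q)%N -> 0 < eta ->
  (forall n n', (0 < n)%N -> (0 < n')%N -> I n -> I n' -> n = n' %[mod q]) ->
  (forall n, (0 < n)%N -> I n -> (q <= n.*2)%N) ->
  \sum_(1 <= n < M | I n) npow (1 + eta) n <= (3 + eta^-1) / q%:R.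
Proof.
move=> q0 e0 Iq Iq2; have q0' : (0 : R) < q%:R by rewrite ltr0n.
pose g j : R := if j == 0%N then 2 / q%:R else npow (1 + eta) j / q%:R.
apply: le_trans (_ : \sum_(1 <= n < M | I n) g (n %/ q)%N <= _).
  rewrite big_nat_cond [leRHS]big_nat_cond; apply: ler_sum => n /andP[/andP[n0 _] In].
  have n0' : (0 : R) < n%:R by rewrite ltr0n.
  rewrite /g; case: eqP => [_|/eqP]; last first.
    rewrite -lt0n => j0.
    apply: le_trans (_ : npow (1 + eta) ((n %/ q) * q)%N <= _).
      by rewrite npow_anti ?muln_gt0 ?j0//; [lra | exact: leq_divM].
    rewrite npowM// ler_wpM2l ?npow_ge0// -npow_inv//.
    by rewrite npow_le//; lra.
  apply: le_trans (_ : npow 1 n <= _); first by rewrite npow_le//; lra.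
  rewrite npow_inv// ler_pdivlMr// mulrC ler_pdivrMr//.
  by have := Iq2 _ n0 In; rewrite -(ler_nat R) -mul2n natrM.
apply: le_trans (_ : \sum_(0 <= j < M.+1) g j <= _).
  apply: (@sum_inj_le (fun n => n %/ q)%N g I).
  - by move=> j; rewrite /g; case: ifP => _; rewrite divr_ge0 ?npow_ge0.
  - move=> n n' n0 n0' In In' E.
    by rewrite (divn_eq n q) E (Iq n n')// -divn_eq.
  - move=> n /andP[_ nM] _; apply: leq_ltn_trans (leq_div _ _) _.
    exact: ltn_trans nM _.
rewrite big_nat_recl// {1}/g /=.
have -> : \sum_(0 <= j < M) g j.+1 = dsum (npow (1 + eta)) M.+1 / q%:R.
  by rewrite /dsum big_add1 /= mulr_suml.
rewrite -mulrDl ler_wpM2r ?invr_ge0//.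
by have := npow_sum_le M.+1 e0; lra.
Qed.

(** By symmetry take [m <= n]. For fixed [m] the admissible [n] lie in one residue class and
    are at least [q / 2], so their weights sum to O(1/q) instead of O(1). *)
Lemma off_diagonal_le (P : rel nat) (v : nat -> R) (eta : R) q M : (0 < q)%N -> 0 < eta ->
  (forall n, 0 <= v n) -> (forall n, v n <= 2 * npow (1 + eta) n) -> symmetric P ->
  (forall m n n', P m n -> P m n' -> n = n' %[mod q]) ->
  (forall m n, (m <= n)%N -> P m n -> (q <= n.*2)%N) ->
  \sum_(1 <= m < M) \sum_(1 <= n < M | P m n) v m * v n <=
  4 * ((3 + eta^-1) / q%:R) * dsum v M.
Proof.
move=> q0 e0 v0 vle Ps Pm Pq.
set S := \sum_(1 <= m < M) \sum_(1 <= n < M | P m n && (m <= n)%N) v m * v n.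
apply: le_trans (_ : S + S <= _).
  have -> : \sum_(1 <= m < M) \sum_(1 <= n < M | P m n) v m * v n =
     S + \sum_(1 <= m < M) \sum_(1 <= n < M | P m n && ~~ (m <= n)%N) v m * v n.
    by rewrite -big_split; apply: eq_bigr => m _; rewrite (bigID (fun n => m <= n)%N).
  rewrite lerD2l; under eq_bigr do rewrite big_mkcond /=.
  rewrite exchange_big /=; apply: ler_sum => n _; rewrite -big_mkcond /=.
  rewrite [leLHS]big_mkcond [leRHS]big_mkcond; apply: ler_sum => m _.
  rewrite Ps -ltnNge mulrC; case: (P n m) => //=.
  by case: ltngtP => //= _; rewrite ?lexx ?mulr_ge0.
suff : S <= 2 * ((3 + eta^-1) / q%:R) * dsum v M by lra.
rewrite /S /dsum mulr_sumr; apply: ler_sum => m _.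
rewrite -mulr_sumr [leRHS]mulrC ler_wpM2l//.
apply: le_trans (_ : 2 * (\sum_(1 <= n < M | P m n && (m <= n)%N) npow (1 + eta) n) <= _).
  by rewrite mulr_sumr; apply: ler_sum => n _.
rewrite ler_wpM2l//; apply: residue_sum_le => //.
  by move=> n n' _ _ /andP[h _] /andP[h' _]; exact: Pm h h'.
by move=> n _ /andP[h mn]; exact: Pq mn h.
Qed.

End OffDiagonal.

(** * Approximation of 1 / L(1, chi) and the mean square *)

Section InverseAtOne.
Variable R : realType.
Local Notation C := R[i].
Variable c0 : R.
Hypotheses (c0_gt0 : 0 < c0) (c0_exceptional : exceptional_zero_const c0).
Variable q : nat.
Hypothesis q1 : (1 < q)%N.
Local Notation D := (@dirichlet_char R q).
Local Notation ch := {ffun 'Z_q -> cplx R}.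
Implicit Types (chi psi : ch).
Local Notation L := (@dirichletL R q).

Definition smooth_mobius chi (v : nat -> R) n : C := mobius_chi chi n * (v n)%:C%C.

Lemma smooth_mobius_weight chi (d : R) K N :
  dsum (smooth_mobius chi (weight d K)) N =
  \sum_(k < K) (d ^+ k)%:C%C * dsum (dter (mobius_chi chi) (1 + d) k) N.
Proof.
rewrite /dsum; under [RHS]eq_bigr do rewrite mulr_sumr.
rewrite exchange_big /=; apply: eq_bigr => n _.
under eq_bigr do rewrite /dter mulrCA.
rewrite -mulr_sumr /smooth_mobius; congr (_ * _).
under eq_bigr do rewrite -rmorphM.
rewrite -rmorph_sum; congr (_%:C%C).
rewrite /weight /poisson mulrA -[expR (- _)]/(npow d n) -npowD /expT mulr_sumr.
by apply: eq_bigr => k _; rewrite /lcoef exprMn; ring.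
Qed.

Variables (chi : ch) (r : R).
Hypotheses (Dc : D chi) (np : chi <> principal_char R q) (r0 : 0 < r) (r2 : r <= 1 / 2).
Let d := r / 400.
Hypothesis zero_free : forall w, cabs w < r -> L chi ((1 + d)%:C%C + w) != 0.
Let M := expR 1 * (4 * q%:R) / (d / 2) ^+ 2.

(** The hypotheses of [zero_free_lower]: [L] is at most [4 q] on the disc, and its value at the
    centre [1 + d] is at least [d / 2], comparing with zeta. *)
Lemma inverse_disc_le w : cabs w <= r / 80 -> (cabs (L chi ((1 + d)%:C%C + w)))^-1 <= M.
Proof.
have r0' := r0; have r2' := r2; have d0 : 0 < d by rewrite /d; lra.
have s1 : 1 < 1 + d by lra.
move=> wr; apply: (@zero_free_lower _ (fun w => L chi ((1 + d)%:C%C + w)) r) => //.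
- by rewrite divr_gt0.
- move=> z _; have [l Hl] := dirichletL_cdiff c0_gt0 c0_exceptional q1
    (s := (1 + d)%:C%C + z) Dc (fun E => False_ind _ (np E)).
  by exists l; exact: cdiff_shift.
- move=> z zr; have h1 : cabs z <= 1 / 2 * (1 + d) by lra.
  have h2 : (0 : R) <= 1 / 2 by lra.
  have h3 : (1 / 2 : R) < 1 by lra.
  apply: (le_trans (dirichletL_le c0_gt0 c0_exceptional q1 Dc np s1 h1 h2 h3)).
  have -> : (1 - 1 / 2 : R) = 2^-1 by lra.
  by rewrite invrK; lra.
have := dirichletL_inv_le c0_gt0 c0_exceptional q1 Dc s1; rewrite addr0.
have -> : 1 + d - 1 = d by ring.
have : 0 < cabs (L chi (1 + d)%:C%C).
  by rewrite cabs_gt0 (dirichletL_neq0 c0_gt0 c0_exceptional).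
move: (cabs _) => x x0 h.
have : x^-1 <= (d / 2)^-1.
  apply: le_trans h _; rewrite (invf_div d 2).
  have : 1 <= d^-1 by rewrite invf_ge1// /d; lra.
  by move: (d^-1) => y; lra.
by rewrite lef_pV2 ?posrE// divr_gt0.
Qed.

(** Evaluate the Taylor series of [1 / L] about [1 + d] at the point 1. The coefficients grow at
    most like [(160 / r) ^ k] while the distance is [r / 400], whence the ratio 2/5; the first
    [K] terms are, coefficient by coefficient, absolutely convergent Dirichlet series, and
    together they are the Moebius series with the smoothed weight. *)
Theorem inverse_approx K : exists l,
  clim (dsum (smooth_mobius chi (weight d K))) l /\
  cabs ((L chi 1)^-1 - l) <= 10 / 3 * M * (2 / 5) ^+ K.
Proof.
have r0' := r0; have r2' := r2; have d0 : 0 < d by rewrite /d; lra.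
have s1 : 1 < 1 + d by lra.
pose a := r / 160; have a0 : 0 < a by rewrite /a; lra.
have a2 : 2 * a = r / 80 by rewrite /a; lra.
have da : d < a by rewrite /d /a; lra.
have M0 : 0 <= M by rewrite /M !mulr_ge0 ?invr_ge0 ?sqr_ge0 ?expR_ge0.
have nz w : cabs w < 2 * a -> L chi ((1 + d)%:C%C + w) != 0.
  by rewrite a2 => wa; apply: zero_free; lra.
have dL w : exists l, cdiff (L chi) ((1 + d)%:C%C + w) l.
  by apply: (dirichletL_cdiff c0_gt0 c0_exceptional q1 Dc) => /np.
have [w wa|w wa|c [c1 c2 c3]] := @taylor_bnd _ (fun w => (L chi ((1 + d)%:C%C + w))^-1) a M a0.
- have [l Hl] := dL w; eexists; apply: cdiffV; first exact: nz.
  by apply: cdiff_shift; exact: Hl.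
- by rewrite cabsV inverse_disc_le// -a2 ltW.
have [|w wa|e1 e2] := @taylor_dirichlet _ (fun s => (L chi s)^-1) (mobius_chi chi) (1 + d) a
   (mobius_chi_bnd Dc) s1 a0.
- by move=> x x1; rewrite (dirichletL_inv c0_gt0 c0_exceptional q1 Dc x1).
- by have [l Hl] := dL w; eexists; apply: cdiffV; [exact: nz | exact: Hl].
have cE : c =1 dser (mobius_chi chi) (1 + d).
  apply: (psum_inj a0 a0 c2 e1) => t t0 ta.
  by rewrite c3 ?e2// cabs_real gtr0_norm.
pose al := mobius_chi chi.
pose l := \sum_(k < K) (d ^+ k)%:C%C * dlim (dter al (1 + d) k).
have lE : l = \sum_(k < K) dser al (1 + d) k * (- d)%:C%C ^+ k.
  apply: eq_bigr => k _; rewrite /dser mulrAC -rmorphXn.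
  rewrite -[(-1) ^+ k](rmorph_sign (real_complex R)) -rmorphM -exprMn.
  by rewrite mulrNN mul1r.
exists l; split.
  have H := @clim_sum _ K (fun k N => (d ^+ k)%:C%C * dsum (dter al (1 + d) k) N)
    (fun k => (d ^+ k)%:C%C * dlim (dter al (1 + d) k))
    (fun k => climZ _ (dter_clim k (mobius_chi_bnd Dc) s1)).
  by apply: clim_ext H; exists 0%N => N _; rewrite smooth_mobius_weight.
have cd : cabs (- d)%:C%C < a by rewrite cabs_real normrN gtr0_norm.
have -> : (L chi 1)^-1 = psum (dser al (1 + d)) (- d)%:C%C.
  by rewrite e2// -rmorphD addrK rmorph1.
apply: (clim_dist_le (psum_clim e1 cd)); exists K => n Kn.
rewrite lE -!(big_mkord xpredT (fun k => dser al (1 + d) k * (- d)%:C%C ^+ k)).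
rewrite (big_cat_nat (leq0n K) Kn)/= addrAC subrr add0r.
apply: (le_trans (cabs_sum _ _ _)).
apply: le_trans (_ : \sum_(K <= k < n) (2 * M) * (2 / 5) ^+ k <= _).
  apply: ler_sum => k _; rewrite cabsM cabsX cabs_real normrN gtr0_norm// -cE.
  apply: le_trans (_ : 2 * M / a ^+ k * d ^+ k <= _).
    by rewrite ler_wpM2r ?exprn_ge0// ltW.
  rewrite -mulrA -exprVn -exprMn.
  by have -> : a^-1 * d = 2 / 5 by rewrite /a /d; field; rewrite gt_eqF.
rewrite -mulr_sumr.
have h0 : (0 : R) <= 2 / 5 by lra.
have h1 : (2 / 5 : R) < 1 by lra.
have := geo_tail_le K n h0 h1; have -> : (1 - 2 / 5 : R)^-1 = 5 / 3 by field.
move=> h; apply: le_trans (ler_wpM2l (_ : 0 <= 2 * M) h) _; first by rewrite mulr_ge0.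
by rewrite le_eqVlt; apply/orP; left; apply/eqP; field.
Qed.

End InverseAtOne.

Lemma totient_le n : (totient n <= n)%N.
Proof.
rewrite totient_count_coprime big_mkord.
apply: (@leq_trans (\sum_(i < n) 1)%N); last by rewrite sum1_card card_ord.
by apply: leq_sum => i _; exact: leq_b1.
Qed.

Section MeanSquare.
Variable R : realType.
Local Notation C := R[i].
Variable q : nat.
Hypothesis q1 : (1 < q)%N.
Local Notation D := (@dirichlet_char R q).
Local Notation ch := {ffun 'Z_q -> cplx R}.
Implicit Types (chi psi : ch).

Lemma natr_Zp_eq m n : (m%:R == n%:R :> 'Z_q) = (m == n %[mod q])%N.
Proof. by rewrite -val_eqE /= !val_Zp_nat. Qed.

Lemma natr_Zp_opp_eq m n : (- m%:R == n%:R :> 'Z_q) = (q %| m + n)%N.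
Proof.
by rewrite eq_sym -addr_eq0 -natrD addnC -[0](@mulr0n 'Z_q 1) natr_Zp_eq mod0n.
Qed.

Variables (v : nat -> R) (eta B : R).
Hypotheses (e0 : 0 < eta) (v0 : forall n, 0 <= v n)
  (vle : forall n, v n <= 2 * npow (1 + eta) n) (vB : forall N, dsum v N <= B).

Let x m n := (mu R m * v m) * (mu R n * v n).

Lemma norm_x_le m n : `|x m n| <= v m * v n.
Proof.
rewrite /x !normrM !(ger0_norm (v0 _)).
by rewrite ler_pM ?mulr_ge0// ler_piMl// norm_mu.
Qed.

(** Orthogonality: the even characters detect [m = n] and [m = - n] modulo [q]. *)
Lemma even_mean_square_eq N :
  2 * \sum_(chi <- chars R q | chi (-1) == 1) cabs (dsum (smooth_mobius chi v) N) ^+ 2 =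
  (totient q)%:R * \sum_(1 <= m < N) \sum_(1 <= n < N) x m n *
    (((n%:R : 'Z_q) \is a GRing.unit) && (m == n %[mod q])%N)%:R +
  (totient q)%:R * \sum_(1 <= m < N) \sum_(1 <= n < N) x m n *
    (((n%:R : 'Z_q) \is a GRing.unit) && (q %| m + n)%N)%:R.
Proof.
apply: (@complexI R); rewrite rmorphM rmorph_sum /=.
have E chi m n : smooth_mobius chi v m * (smooth_mobius chi v n)^*%C =
    (x m n)%:C%C * (chi m%:R * (chi n%:R)^*%C).
  rewrite /smooth_mobius /mobius_chi /cnat.
  case: (chi m%:R) => a b; case: (chi n%:R) => a' b'; rewrite /x; apply/eqP.
  by rewrite eq_complex /=; apply/andP; split; apply/eqP; ring.
under eq_bigr => chi _.
  rewrite -mulcJ /dsum rmorph_sum mulr_suml.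
  under eq_bigr => m _.
    rewrite mulr_sumr.
    under eq_bigr => n _ do rewrite E.
    over.
  over.
rewrite exchange_big /=; under eq_bigr do rewrite exchange_big /=.
rewrite mulr_sumr !rmorphD !rmorphM !rmorph_nat !rmorph_sum /= !mulr_sumr -big_split /=.
apply: eq_bigr => m _; rewrite !rmorph_sum !mulr_sumr -big_split /=; apply: eq_bigr => n _.
rewrite -mulr_sumr mulrCA even_orthogonality// natr_Zp_eq natr_Zp_opp_eq.
rewrite !rmorphM !rmorph_nat; ring.
Qed.

(** The diagonal [m = n] gives the main term; the pairs congruent but distinct and those of
    sum divisible by [q] are bounded by [off_diagonal_le]. *)
Theorem even_mean_square N :
  `| 2 * (\sum_(chi <- chars R q | chi (-1) == 1) cabs (dsum (smooth_mobius chi v) N) ^+ 2)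
    - (totient q)%:R * \sum_(1 <= n < N) mu2 R n *
       ((n%:R : 'Z_q) \is a GRing.unit)%:R * v n ^+ 2 | <= 8 * (3 + eta^-1) * B.
Proof.
have q0 : (0 < q)%N by exact: ltnW.
have e0' := e0; have ei : 0 < eta^-1 by rewrite invr_gt0.
pose P1 m n := (m != n) && (m == n %[mod q])%N.
pose P2 m n := [&& 0 < m, 0 < n & q %| m + n]%N.
have S1 : \sum_(1 <= m < N) \sum_(1 <= n < N | P1 m n) v m * v n <=
    4 * ((3 + eta^-1) / q%:R) * dsum v N.
  apply: off_diagonal_le => //.
  - by move=> m n; rewrite /P1 eq_sym [in X in _ && X]eq_sym.
  - by move=> m n n' /andP[_ /eqP <-] /andP[_ /eqP <-].
  - move=> m n mn /andP[mn' /eqP E]; have {mn mn'} mn : (m < n)%N by rewrite ltn_neqAle mn'.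
    have : (q %| n - m)%N by rewrite -eqn_mod_dvd ?(ltnW mn)// E.
    move=> /dvdn_leq; rewrite subn_gt0 => /(_ mn) h; apply: (leq_trans h).
    by rewrite -addnn (leq_trans (leq_subr _ _))// leq_addr.
have S2 : \sum_(1 <= m < N) \sum_(1 <= n < N | P2 m n) v m * v n <=
    4 * ((3 + eta^-1) / q%:R) * dsum v N.
  apply: off_diagonal_le => //.
  - by move=> m n; rewrite /P2 addnC andbCA.
  - move=> m n n' /and3P[_ _ h] /and3P[_ _ h']; apply/eqP.
    by rewrite -(eqn_modDl m) (eqP h) (eqP h').
  - move=> m n mn /and3P[m0 n0 /dvdn_leq h]; rewrite (leq_trans (h _)) ?addn_gt0 ?m0//.
    by rewrite -addnn leq_add2r.
rewrite even_mean_square_eq.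
set u := fun n => (n%:R : 'Z_q) \is a GRing.unit.
have -> : \sum_(1 <= m < N) \sum_(1 <= n < N) x m n *
    (((n%:R : 'Z_q) \is a GRing.unit) && (m == n %[mod q])%N)%:R =
  \sum_(1 <= n < N) mu2 R n * (u n)%:R * v n ^+ 2 +
  \sum_(1 <= m < N) \sum_(1 <= n < N | P1 m n) x m n * (u n)%:R.
  rewrite big_nat [X in _ = X + _]big_nat [X in _ = _ + X]big_nat -big_split /=.
  apply: eq_bigr => m mN; rewrite (bigID (fun n => n == m)) /= big_nat1_eq mN.
  rewrite eqxx andbT -/(u m); congr (_ + _).
    by rewrite /x -sqr_mu; ring.
  rewrite big_mkcond [RHS]big_mkcond; apply: eq_bigr => n _.
  rewrite /P1 eq_sym -/(u n); case: (m == n) => //=.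
  by case: (_ == _ %[mod q])%N; rewrite ?andbT// andbF mulr0.
have -> : \sum_(1 <= m < N) \sum_(1 <= n < N) x m n *
    (((n%:R : 'Z_q) \is a GRing.unit) && (q %| m + n)%N)%:R =
  \sum_(1 <= m < N) \sum_(1 <= n < N | P2 m n) x m n * (u n)%:R.
  rewrite big_nat [RHS]big_nat; apply: eq_bigr => m /andP[m0 _].
  rewrite [RHS]big_mkcond [LHS]big_nat [RHS]big_nat; apply: eq_bigr => n /andP[n0 _].
  by rewrite /P2 m0 n0 -/(u n) /=; case: (q %| _)%N; rewrite ?andbT// andbF mulr0.
set X := \sum_(1 <= n < N) mu2 R n * (u n)%:R * v n ^+ 2.
set Y1 := \sum_(1 <= m < N) \sum_(1 <= n < N | P1 m n) _.
set Y2 := \sum_(1 <= m < N) \sum_(1 <= n < N | P2 m n) _.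
have bd (P : rel nat) : `|\sum_(1 <= m < N) \sum_(1 <= n < N | P m n) x m n * (u n)%:R| <=
    \sum_(1 <= m < N) \sum_(1 <= n < N | P m n) v m * v n.
  apply: (le_trans (ler_norm_sum _ _ _)); apply: ler_sum => m _.
  apply: (le_trans (ler_norm_sum _ _ _)); apply: ler_sum => n _.
  by case: (u n); rewrite ?mulr1 ?norm_x_le// mulr0 normr0 mulr_ge0.
have -> : (totient q)%:R * (X + Y1) + (totient q)%:R * Y2 - (totient q)%:R * X =
   (totient q)%:R * (Y1 + Y2) by ring.
rewrite normrM ger0_norm//.
have q0' : (0 : R) < q%:R by rewrite ltr0n.
have tq : (totient q)%:R <= q%:R :> R.
  by rewrite ler_nat totient_le.
have Y1b : `|Y1| <= 4 * ((3 + eta^-1) / q%:R) * B.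
  apply: le_trans (le_trans (bd P1) S1) _; rewrite ler_wpM2l// mulr_ge0// divr_ge0// ltW//; lra.
have Y2b : `|Y2| <= 4 * ((3 + eta^-1) / q%:R) * B.
  apply: le_trans (le_trans (bd P2) S2) _; rewrite ler_wpM2l// mulr_ge0// divr_ge0// ltW//; lra.
apply: le_trans (_ : q%:R * (8 * ((3 + eta^-1) / q%:R) * B) <= _).
  apply: ler_pM => //; apply: (le_trans (ler_normD _ _)); lra.
by rewrite le_eqVlt; apply/orP; left; apply/eqP; field; rewrite !gt_eqF.
Qed.

End MeanSquare.

(** * Characters with a zero near 1 *)

Section BadCharacter.
Variable R : realType.
Local Notation C := R[i].
Variable c0 : R.
Hypotheses (c0_gt0 : 0 < c0) (c0_exceptional : exceptional_zero_const c0).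
Variable q : nat.
Hypothesis q1 : (1 < q)%N.
Local Notation D := (@dirichlet_char R q).
Local Notation ch := {ffun 'Z_q -> cplx R}.
Implicit Types (chi psi : ch).
Local Notation L := (@dirichletL R q).

Lemma cdiff_prod (I : eqType) (s : seq I) (f : I -> C -> C) z :
  (forall i, i \in s -> exists l, cdiff (f i) z l) ->
  exists l, cdiff (fun w => \prod_(i <- s) f i w) z l.
Proof.
elim: s => [|i s IH] H.
  by exists 0; under eq_fun do rewrite big_nil; exact: cdiff_cst.
have [l Hl] := H i (mem_head _ _).
have [|m Hm] := IH; first by move=> j js; apply: H; rewrite inE js orbT.
by eexists; under eq_fun do rewrite big_cons; exact: cdiffM Hl Hm.
Qed.

Lemma dirichletL_prodE s : dirichletL_prod q s = \prod_(chi <- chars R q) L chi s.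
Proof. by rewrite /dirichletL_prod fsbig_finite//; exact: finite_dirichlet_char. Qed.

(** Two vanishing factors make every term of the product rule vanish. *)
Lemma derive1_double_zero chi psi (s : C) : D chi -> D psi -> chi != psi -> s <> 1 ->
  L chi s = 0 -> L psi s = 0 -> derive1 (@dirichletL_prod R q) s = 0.
Proof.
move=> Dc Dp cp s1 Lc Lp.
have dL xi : D xi -> exists l, cdiff (L xi) s l.
  by move=> Dx; exact: (dirichletL_cdiff c0_gt0 c0_exceptional q1 Dx).
have [l Hl] := dL _ Dc; have [m Hm] := dL _ Dp.
pose rest := rem psi (rem chi (chars R q)).
have pr : psi \in rem chi (chars R q).
  by rewrite (mem_rem_uniq _ (chars_uniq R q)) inE eq_sym cp; exact/charsP.
have [|k Hk] := @cdiff_prod _ rest (fun xi => L xi) s.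
  by move=> xi /mem_rem /mem_rem /charsP; exact: dL.
have := cdiffM Hl (cdiffM Hm Hk); rewrite Lc Lp !(mul0r, mulr0, addr0) => H.
have {}H : cdiff (@dirichletL_prod R q) s 0.
  move: H; congr cdiff; apply/funext => w; rewrite dirichletL_prodE.
  by rewrite (perm_big _ (perm_to_rem (introT (charsP _) Dc))) big_cons
    (perm_big _ (perm_to_rem pr)) big_cons.
by rewrite derive1E; exact: derive_val.
Qed.

Variable r : R.
Hypotheses (r0 : 0 < r) (r2 : r <= 1 / 2) (rc : r <= c0 / (2 * ln q%:R)).

Definition disc_zero chi w := cabs w < r /\ L chi ((1 + r / 400)%:C%C + w) = 0.

Lemma disc_zero_region w : cabs w < r -> zero_region c0 q ((1 + r / 400)%:C%C + w).
Proof.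
move=> wr; have r0' := r0; have r2' := r2; have lq := ln_q_gt0 R q1.
have q0 : (0 : R) < q%:R by rewrite ltr0n ltnW.
have q2 : (2 : R) <= q%:R by rewrite ler_nat.
rewrite /zero_region ReD ImD /= add0r.
have h1 := cabs_Re w; have h2 := cabs_Im w.
move: h1; rewrite ler_norml => /andP[h1 _].
set y := `|Im w| in h2 *; have y0 : 0 <= y by exact: normr_ge0.
have z1 : q%:R <= q%:R * (y + 1) by rewrite ler_peMr; lra.
have z0 : 0 < q%:R * (y + 1) by apply: lt_le_trans z1.
have l1 : ln q%:R <= ln (q%:R * (y + 1)) by rewrite ler_ln ?posrE.
have l2 : ln (q%:R * (y + 1)) <= 2 * ln q%:R.
  rewrite (_ : 2 * ln q%:R = ln (q%:R * q%:R)); last by rewrite lnM ?posrE//; lra.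
  rewrite ler_ln ?posrE ?z0//; last exact: mulr_gt0.
  by apply: ler_wpM2l; [exact: ltW | lra].
have : r <= c0 / ln (q%:R * (y + 1)).
  apply: (le_trans rc); rewrite ler_pM2l// lef_pV2 ?posrE// ?mulr_gt0//.
  exact: lt_le_trans l1.
lra.
Qed.

(** Beyond 1 no [L] vanishes, by the Moebius series. *)
Lemma exceptional_lt1 beta : exceptional_zero c0 q beta -> beta < 1.
Proof.
move=> [reg [b1 b0]]; have [_ /(_ _ reg (conj b1 b0))[_ _ [chi [Dc _ _ Lb]]]] := c0_exceptional q1.
case: ltgtP => // [b|E]; last by case: b1; rewrite E.
by have := dirichletL_neq0 c0_gt0 c0_exceptional q1 Dc b; rewrite Lb eqxx.
Qed.

(** The zero must belong to the real character that the exceptional zero comes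
    from: two characters vanishing there would make it a double zero of the product. *)
Lemma disc_zero_exceptional chi w : D chi -> chi <> principal_char R q -> disc_zero chi w ->
  exists beta : R, [/\ (1 + r / 400)%:C%C + w = beta%:C%C, exceptional_zero c0 q beta,
    real_char chi, 1 - r < beta & L chi beta%:C%C = 0].
Proof.
move=> Dc np [wr Lz]; have r0' := r0; set s : C := _ + w in Lz *.
have reg : zero_region c0 q s := disc_zero_region wr.
have s1 : s <> 1.
  by move=> E; have := nonprincipal_neq0 c0_gt0 c0_exceptional q1 Dc np; rewrite -E Lz eqxx.
have pz : dirichletL_prod_zero q s.
  by split=> //; exact: dirichletL_prod_factor Dc Lz.
have [_ /(_ _ reg pz)[Ims d1 [psi [Dp npp rp Lp]]]] := c0_exceptional q1.
have sE : s = (Re s)%:C%C by apply: complexP.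
have cE : chi = psi.
  by apply/eqP; apply: contra_notT d1 => cp; exact: derive1_double_zero Dc Dp cp s1 Lz Lp.
exists (Re s); rewrite -sE; split=> //.
- by rewrite /exceptional_zero -sE.
- by rewrite cE.
rewrite /s ReD /=; have := cabs_Re w; rewrite ler_norml => /andP[h _]; lra.
Qed.

Lemma disc_zero_unique chi psi w w' : D chi -> D psi -> chi <> principal_char R q ->
  psi <> principal_char R q -> disc_zero chi w -> disc_zero psi w' -> chi = psi.
Proof.
move=> Dc Dp nc np zc zp.
have [b [bE eb _ _ Lb]] := disc_zero_exceptional Dc nc zc.
have [b' [bE' eb' _ _ Lb']] := disc_zero_exceptional Dp np zp.
have [uz sz] := c0_exceptional q1.
case: (eb) => rb pb; case: (eb') => rb' pb'.
have E := uz _ _ rb pb rb' pb'; rewrite -E in Lb'.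
have [_ d1 _] := sz _ rb pb; apply/eqP; apply: contra_notT d1 => cp.
by case: (pb) => s1 _; exact: derive1_double_zero Dc Dp cp s1 Lb Lb'.
Qed.

Lemma real_char_sqr chi : D chi -> real_char chi -> mul_char chi chi = principal_char R q.
Proof.
move=> Dc rchi; apply/ffunP => a; rewrite !ffunE.
case: (boolP (a \is a GRing.unit)) => ua; last by rewrite char_nunit ?mul0r.
rewrite -[RHS](char_conjK Dc ua); congr (_ * _).
by have := rchi a; case: (chi a) => x y /= ->; rewrite oppr0.
Qed.

(** Estermann's inequality for the real character, with [2 - beta <= 1 + r <= exp r]. *)
Lemma disc_zero_inv_le chi w beta K : D chi -> chi <> principal_char R q -> disc_zero chi w ->
  (0 < K)%N -> 200 * q%:R * (3 / 4) ^+ K <= 1 :> R -> r <= 1 / 4 -> exceptional_zero c0 q beta ->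
  (cabs (L chi 1) ^+ 2)^-1 <= (2 * expR (K%:R * r)) ^+ 2 * (1 - beta) ^- 2.
Proof.
move=> Dc np zc K0 Kq r4 eb.
have [b [bE eb' rchi br Lb]] := disc_zero_exceptional Dc np zc.
have [uz _] := c0_exceptional q1; case: (eb) => rb pb; case: (eb') => rb' pb'.
have := uz _ _ rb pb rb' pb' => /complexI E; subst b.
have b1 := exceptional_lt1 eb.
have b34 : 3 / 4 <= beta by lra.
have H := real_char_lower c0_gt0 c0_exceptional q1 Dc np (real_char_sqr Dc rchi) K0 b34 b1 Lb Kq.
have e0 := expR_gt0 (K%:R * r).
have h : (2 - beta) ^+ K <= expR (K%:R * r).
  rewrite expRM_natl lerXn2r ?nnegrE ?expR_ge0//; first lra.
  by apply: le_trans (expR_ge1Dx r); lra.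
have L0 : 0 < cabs (L chi 1).
  by rewrite cabs_gt0 (nonprincipal_neq0 c0_gt0 c0_exceptional).
have H2 : 1 - beta <= 2 * expR (K%:R * r) * cabs (L chi 1).
  by apply: (le_trans H); rewrite ler_wpM2r ?cabs_ge0// ler_wpM2l.
have bb : 0 < 1 - beta by lra.
rewrite -exprVn -[(1 - beta) ^- 2]exprVn -exprMn lerXn2r ?nnegrE ?invr_ge0 ?cabs_ge0//.
  by rewrite mulr_ge0 ?invr_ge0 ?(ltW bb)// mulr_ge0// ltW.
by rewrite ler_pdivlMr// mulrC ler_pdivrMr.
Qed.

End BadCharacter.

(** * The smoothed mean square *)

Section Constants.
Variable R : realType.

Lemma nat_above (x : R) : 0 < x -> exists K, [/\ (0 < K)%N, x <= K%:R & K%:R <= x + 1].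
Proof.
move=> x0; have [h1 h2] := andP (truncn_itv (ltW x0)).
by exists (Num.trunc x).+1; split=> //; [exact: ltW | rewrite -natr1 lerD2r].
Qed.

Lemma ln3_gt1 (q : nat) : (3 <= q)%N -> 1 < ln q%:R :> R.
Proof.
move=> q3; rewrite -[ltLHS](expRK (1 : R)) ltr_ln ?posrE ?expR_gt0 ?ltr0n ?(leq_trans _ q3)//.
by apply: lt_le_trans (expR1_lt3 R) _; rewrite ler_nat.
Qed.

(** It suffices that [e ^ (1/2) <= 2]. *)
Lemma pow2_inv_le (q K : nat) : (0 < q)%N -> 6 * ln q%:R <= K%:R :> R ->
  2 ^- K <= q%:R ^- 3 :> R.
Proof.
move=> q0 Kq; have e2 : expR (1 / 2) <= 2 :> R.
  rewrite -(@ler_pXn2r _ 2)// ?nnegrE ?expR_ge0// -expRM_natl.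
  have -> : 2 * (1 / 2) = 1 :> R by lra.
  by apply: ltW; apply: lt_le_trans (expR1_lt3 R) _; lra.
rewrite lef_pV2 ?posrE ?exprn_gt0 ?ltr0n//.
rewrite -[q%:R in leLHS](@lnK R) ?posrE ?ltr0n// -expRM_natl.
apply: le_trans (_ : expR (1 / 2) ^+ K <= _).
  by rewrite -expRM_natl ler_expR; lra.
by rewrite lerXn2r ?nnegrE ?expR_ge0.
Qed.

(** It suffices that [3/4 <= e ^ (- 1/4)] and [200 <= 2 ^ 8 <= e ^ 8]. *)
Lemma pow34_le (q K : nat) : (0 < q)%N -> 4 * ln q%:R + 32 <= K%:R :> R ->
  200 * q%:R * (3 / 4) ^+ K <= 1 :> R.
Proof.
move=> q0 Kq; have q0' : (0 : R) < q%:R by rewrite ltr0n.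
have e34 : 3 / 4 <= expR (- (1 / 4)) :> R by have := expR_ge1Dx (- (1 / 4) : R); lra.
have h1 : (3 / 4) ^+ K <= expR (- (ln q%:R + 8)) :> R.
  apply: le_trans (_ : expR (- (1 / 4)) ^+ K <= _).
    by rewrite lerXn2r ?nnegrE ?expR_ge0//; lra.
  by rewrite -expRM_natl ler_expR; lra.
have h2 : (200 : R) <= expR 8.
  have -> : expR 8 = expR 1 ^+ 8 :> R by rewrite -expRM_natl mulr1.
  apply: le_trans (_ : 2 ^+ 8 <= _); first by rewrite -natrX ler_nat.
  by rewrite lerXn2r ?nnegrE ?expR_ge0//; have := expR_ge1Dx (1 : R); lra.
apply: le_trans (_ : 200 * q%:R * expR (- (ln q%:R + 8)) <= _).
  by rewrite ler_wpM2l// mulr_ge0// ltW.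
rewrite expRN expRD lnK ?posrE// ler_pdivrMr ?mulr_gt0 ?expR_gt0// mul1r [leRHS]mulrC.
by rewrite ler_wpM2r// ltW.
Qed.

(** Taking logarithms, [(log l) ^ 2 <= 4 l], which follows from [1 + x <= e ^ x] at
    [x = (log l) / 2]. *)
Lemma pow4_le_expR (l : R) : 1 < l -> l ^+ 4 <= expR (16 * (l / ln l)).
Proof.
move=> l1; have l0 : 0 < l by lra.
have y0 : 0 < ln l by rewrite ln_gt0.
have -> : l ^+ 4 = expR (4 * ln l) by rewrite expRM_natl lnK.
rewrite ler_expR mulrA ler_pdivlMr// -mulrA.
have : (ln l / 2) ^+ 2 <= l.
  rewrite -[leRHS](lnK (_ : l \in Num.pos)) ?posrE//.
  have -> : expR (ln l) = expR (ln l / 2) ^+ 2 by rewrite -expRM_natl; congr expR; lra.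
  rewrite lerXn2r ?nnegrE ?expR_ge0 ?divr_ge0 ?(ltW y0)//.
  by have := expR_ge1Dx (ln l / 2); lra.
by rewrite expr2; move: (ln l) => y; lra.
Qed.

Lemma sum_le_single (I : eqType) (s : seq I) (P : pred I) (F : I -> R) (X : R) :
  uniq s -> 0 <= X -> (forall i, i \in s -> P i -> 0 <= F i <= X) ->
  (forall i j, i \in s -> j \in s -> P i -> P j -> i = j) ->
  0 <= \sum_(i <- s | P i) F i <= X.
Proof.
move=> us X0 FX PP; rewrite big_seq_cond sumr_ge0/=; last first.
  by move=> i /andP[si Pi]; case/andP: (FX i si Pi).
rewrite -big_seq_cond.
case: (boolP (has P s)) => [/hasP[i si Pi]|/hasPn H].
  rewrite (perm_big _ (perm_to_rem si)) big_cons Pi big_seq_cond big1.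
    by case/andP: (FX i si Pi) => _; rewrite /= addr0.
  move=> j /andP[jr Pj]; have := jr; rewrite (mem_rem_uniq _ us) inE => /andP[/eqP ji js].
  by case: ji; exact: PP.
by rewrite big_seq_cond big1// => i /andP[/H/negP].
Qed.

Lemma cvg_sum_seq (I : eqType) (s : seq I) (P : pred I) (f : I -> nat -> R) (l : I -> R) :
  (forall i, i \in s -> f i @ \oo --> l i) ->
  (fun N => \sum_(i <- s | P i) f i N) @ \oo --> \sum_(i <- s | P i) l i.
Proof.
elim: s => [|i s IH] H.
  by rewrite big_nil; under eq_fun do rewrite big_nil; exact: cvg_cst.
have HS := IH (fun j js => H j (mem_behead (s := i :: s) js)).
rewrite big_cons; under eq_fun do rewrite big_cons.
by case: (P i) => //; apply: cvgD HS; exact: H (mem_head _ _).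
Qed.

Lemma sqr_dist_le (x y e B : R) : 0 <= x -> 0 <= y -> y <= B -> `|x - y| <= e ->
  `|x ^+ 2 - y ^+ 2| <= e * (2 * B + e).
Proof.
move=> x0 y0 yB; rewrite ler_norml => /andP[h1 h2].
by rewrite ler_norml !expr2; apply/andP; split; nra.
Qed.

End Constants.

Section SmoothedMeanSquare.
Variable R : realType.
Local Notation C := R[i].
Variable q : nat.
Hypothesis q1 : (1 < q)%N.
Local Notation D := (@dirichlet_char R q).
Local Notation ch := {ffun 'Z_q -> cplx R}.
Implicit Types (chi psi : ch).
Variables (d : R) (K : nat).
Hypotheses (d0 : 0 < d) (d2 : d <= 1 / 2) (K0 : (0 < K)%N).
Let eta := d / (2 * K%:R).
Let B := 2 * (1 + eta^-1).
Let v := weight d K.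
Let main := zeta_nat R 2 / zeta_nat R 4 * \prod_(p <- primes q) (1 + p%:R ^- 2)^-1.

Let eta0 : 0 < eta. Proof. by rewrite /eta divr_gt0// mulr_gt0 ?ltr0n. Qed.

Lemma smooth_mobius_bnd chi N : D chi -> dsum (fun n => cabs (smooth_mobius chi v n)) N <= B.
Proof.
move=> Dc; apply: (le_trans _ (weight_sum_le d0 K0 N)); apply: ler_sum => n _.
rewrite cabsM cabs_real ger0_norm ?weight_ge0//.
by rewrite ler_piMl ?weight_ge0//; exact: mobius_chi_bnd.
Qed.

Lemma smooth_mobius_clim chi : D chi ->
  clim (dsum (smooth_mobius chi v)) (dlim (smooth_mobius chi v)).
Proof. by move=> Dc; apply: dlimP => N; exact: smooth_mobius_bnd. Qed.

Lemma smooth_mobius_le chi : D chi -> cabs (dlim (smooth_mobius chi v)) <= B.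
Proof. by move=> Dc; apply: dlim_le => N; exact: smooth_mobius_bnd. Qed.

Lemma unit_rough n : (0 < n)%N -> ((n%:R : 'Z_q) \is a GRing.unit) = rough (primes q) n.
Proof.
move=> n0; have q0 : (0 < q)%N by exact: ltnW.
rewrite unitZpE// coprime_has_primes// /rough; apply/hasPn/allP => H p ph.
  apply/negP => pn; have := ph; rewrite mem_primes => /and3P[p_pr _ _].
  by have /H/negP[] : p \in primes n by rewrite mem_primes p_pr n0.
apply/negP => pq; move: ph; rewrite mem_primes => /and3P[_ _ pn].
by have := H p pq; rewrite pn.
Qed.

(** The limit of [even_mean_square] in the length of the sums; removing the weights from the
    diagonal costs only [2 ^ (- K)]. *)
Theorem smoothed_mean_square :
  `|2 * (\sum_(chi <- chars R q | chi (-1) == 1) cabs (dlim (smooth_mobius chi v)) ^+ 2) -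
    (totient q)%:R * main| <= 8 * (3 + eta^-1) * B + (totient q)%:R * (6 * 2 ^- K).
Proof.
have q0 : (0 < q)%N by exact: ltnW.
pose w N := \sum_(1 <= n < N) mu2 R n * ((n%:R : 'Z_q) \is a GRing.unit)%:R * n%:R ^- 2.
have wE N : (w N)%:C%C = dsum (fun n => (mu2 R n)%:C%C * zterm R (primes q) 2 n) N.
  rewrite /w /dsum rmorph_sum big_nat [RHS]big_nat; apply: eq_bigr => n /andP[n0 _].
  rewrite unit_rough// /zterm; case: rough; last by rewrite !(mulr0, mul0r) rmorph0.
  by rewrite mulr1 rmorphM.
have w_cvg : w @ \oo --> main.
  by have := clim_Re (@mu2_zterm_clim R q q0); under eq_fun do rewrite -wE.
pose u N := \sum_(chi <- chars R q | chi (-1) == 1) cabs (dsum (smooth_mobius chi v) N) ^+ 2.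
have u_cvg : u @ \oo --> \sum_(chi <- chars R q | chi (-1) == 1)
    cabs (dlim (smooth_mobius chi v)) ^+ 2.
  apply: cvg_sum_seq => chi /charsP Dc.
  rewrite expr2; under eq_fun do rewrite expr2.
  by apply: cvgM; apply: clim_cvg_cabs; exact: smooth_mobius_clim.
have l_cvg : (fun N => 2 * u N - (totient q)%:R * w N) @ \oo -->
  2 * (\sum_(chi <- chars R q | chi (-1) == 1) cabs (dlim (smooth_mobius chi v)) ^+ 2) -
    (totient q)%:R * main.
  by apply: cvgB; apply: cvgMr.
rewrite -[X in `|X|]subr0; apply: (lim_dist_le l_cvg); exists 0%N => N _; rewrite subr0.
have H := @even_mean_square R q q1 v eta B eta0 (weight_ge0 K d0) (weight_le d0 K0)
   (weight_sum_le d0 K0) N.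
set X := \sum_(1 <= n < N) mu2 R n * _ * v n ^+ 2 in H.
have -> : 2 * u N - (totient q)%:R * w N =
  (2 * u N - (totient q)%:R * X) + (totient q)%:R * (X - w N) by ring.
apply: (le_trans (ler_normD _ _)); apply: lerD; first exact: H.
rewrite normrM ger0_norm// ler_wpM2l//.
apply: le_trans (weight_sqr_sum_le K d0 d2 N).
rewrite /X /w -sumrB; apply: (le_trans (ler_norm_sum _ _ _)).
rewrite big_nat [leRHS]big_nat; apply: ler_sum => n /andP[n0 _].
have vn : 0 <= v n by exact: weight_ge0.
have vi : v n <= n%:R^-1.
  rewrite -npow_inv// /v /weight ler_piMr ?npow_ge0// poisson_le1//.
  by rewrite mulr_ge0 ?ln_nat_ge0 ?ltW.
have vv : v n ^+ 2 <= n%:R ^- 2.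
  by rewrite -exprVn lerXn2r ?nnegrE ?invr_ge0.
rewrite -mulrBr normrM distrC (ger0_norm (_ : 0 <= n%:R ^- 2 - v n ^+ 2)) ?subr_ge0//.
rewrite ler_piMl ?subr_ge0// /mu2.
by case: sqf; case: (_ \is a _); rewrite ?(mulr0, mul0r, mulr1, normr0, normr1).
Qed.

End SmoothedMeanSquare.

(** * Assembling the two error terms *)

Lemma size_chars (R : realType) q : (1 < q)%N -> size (chars R q) = totient q.
Proof.
move=> q1; apply/eqP; rewrite -(eqr_nat R[i]) -(sum_chars_1 R q1) [X in _ == X]big_seq.
rewrite (eq_bigr (fun=> 1)); last by move=> chi /charsP; exact: char1.
by rewrite -big_seq big_const_seq count_predT iter_addr_0.
Qed.

Section Assembly.
Variable R : realType.
Local Notation C := R[i].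
Variable c0 : R.
Hypotheses (c0_gt0 : 0 < c0) (c0_exceptional : exceptional_zero_const c0).
Variable q : nat.
Hypothesis q3 : (3 <= q)%N.
Local Notation D := (@dirichlet_char R q).
Local Notation ch := {ffun 'Z_q -> cplx R}.
Implicit Types (chi psi : ch).
Local Notation L := (@dirichletL R q).
Let l : R := ln q%:R.
Let c1 := Num.min (c0 / 2) (1 / 4).
Let r := c1 / l.
Let F chi := (cabs (L chi 1) ^+ 2)^-1.

Let q1 : (1 < q)%N. Proof. exact: ltnW. Qed.
Let l1 : 1 < l. Proof. exact: ln3_gt1. Qed.
Let l0 : 0 < l. Proof. exact: lt_trans l1. Qed.
Let c10 : 0 < c1. Proof. by rewrite /c1 lt_min divr_gt0//= divr_gt0. Qed.
Let r0 : 0 < r. Proof. exact: divr_gt0. Qed.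
Let r4 : r <= 1 / 4.
Proof.
rewrite /r ler_pdivrMr//; apply: (@le_trans _ _ (1 / 4)); first by rewrite ge_min lexx orbT.
by rewrite ler_peMr ?divr_ge0// ltW.
Qed.
Let r2 : r <= 1 / 2. Proof. by have := r4; lra. Qed.
Let rc : r <= c0 / (2 * l).
Proof. by rewrite invfM mulrA ler_pM2r ?invr_gt0// ge_min lexx. Qed.

(** The radius of the disc is a small multiple of [1 / log q], so that a zero in it lies in the
    region where at most the exceptional zero occurs. *)
Definition bad chi := `[< exists w, disc_zero r chi w >].
Definition even_np chi := (chi (-1) == 1) && (chi != principal_char R q).

Lemma bad_unique chi psi : chi \in chars R q -> psi \in chars R q ->
  even_np chi && bad chi -> even_np psi && bad psi -> chi = psi.
Proof.
move=> /charsP Dc /charsP Dp /andP[/andP[_ /eqP nc] /asboolP[w zc]].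
move=> /andP[/andP[_ /eqP np] /asboolP[w' zp]].
exact: (disc_zero_unique c0_gt0 c0_exceptional q1 r0 r2 rc Dc Dp nc np zc zp).
Qed.

(** At most one character is bad, and Estermann's inequality, with a truncation [K] of order
    [log q], bounds its term; the factor [exp (K r)] is bounded because [r] is of order
    [1 / log q]. *)
Lemma sum_bad_le beta : exceptional_zero c0 q beta ->
  `|\sum_(chi <- chars R q | even_np chi && bad chi) F chi| <=
  (2 * expR (37 * c1)) ^+ 2 * ((1 - beta)^-1 * (l ^+ 2 + (1 - beta)^-1)).
Proof.
move=> eb; have b1 := exceptional_lt1 c0_gt0 c0_exceptional q1 eb.
have l1' := l1; have c10' := c10.
have [|K [K0 Kl Ku]] := @nat_above R (4 * l + 32); first by lra.
have i0 : 0 < (1 - beta)^-1 by rewrite invr_gt0 subr_gt0.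
have e0 := expR_gt0 (37 * c1).
have X0 : 0 <= (2 * expR (37 * c1)) ^+ 2 * (1 - beta) ^- 2.
  by rewrite mulr_ge0 ?sqr_ge0// invr_ge0 sqr_ge0.
have Kr : K%:R * r <= 37 * c1.
  rewrite /r mulrA ler_pdivrMr// mulrAC ler_wpM2r ?(ltW c10)//; lra.
have FX chi : chi \in chars R q -> even_np chi && bad chi ->
    0 <= F chi <= (2 * expR (37 * c1)) ^+ 2 * (1 - beta) ^- 2.
  move=> /charsP Dc /andP[/andP[_ /eqP np] /asboolP[w zc]].
  rewrite invr_ge0 sqr_ge0 /=.
  have q0 : (0 < q)%N by exact: ltnW.
  apply: (le_trans (disc_zero_inv_le c0_gt0 c0_exceptional q1 r0 r2 rc Dc np zc K0
    (pow34_le q0 Kl) r4 eb)).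
  rewrite ler_wpM2r ?invr_ge0 ?sqr_ge0// lerXn2r ?nnegrE ?mulr_ge0 ?expR_ge0//.
  by rewrite ler_wpM2l// ler_expR.
have /andP[h1 h2] := sum_le_single (chars_uniq R q) X0 FX bad_unique.
rewrite ger0_norm//; apply: (le_trans h2); rewrite ler_wpM2l ?sqr_ge0//.
rewrite -exprVn expr2 ler_pM2l// lerDr; exact: sqr_ge0.
Qed.

Lemma bad_exceptional chi : chi \in chars R q -> even_np chi && bad chi ->
  exceptional_delta c0 q = 1.
Proof.
move=> /charsP Dc /andP[/andP[_ /eqP np] /asboolP[w zc]].
have [beta [_ eb _ _ _]] :=
  disc_zero_exceptional c0_gt0 c0_exceptional q1 r0 r2 rc Dc np zc.
rewrite /exceptional_delta; case: asboolP => // -[]; by exists beta.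
Qed.

Lemma delta_sum_bad :
  exceptional_delta c0 q * (\sum_(chi <- chars R q | even_np chi && bad chi) F chi) =
  \sum_(chi <- chars R q | even_np chi && bad chi) F chi.
Proof.
case: (boolP (has (fun chi => even_np chi && bad chi) (chars R q))) => [/hasP[chi cs cb]|/hasPn H].
  by rewrite (bad_exceptional cs cb) mul1r.
by rewrite big_seq_cond big1 ?mulr0// => chi /andP[/H/negP].
Qed.

Lemma sum_even_np :
  \sum_(chi \in @even_nonprincipal_char R q) F chi = \sum_(chi <- chars R q | even_np chi) F chi.
Proof.
have fE : finite_set (@even_nonprincipal_char R q).
  by apply: sub_finite_set (finite_dirichlet_char R q) => chi [].
rewrite fsbig_finite// -[RHS]big_filter; apply: perm_big; apply: uniq_perm.
- exact: finmap.fset_uniq.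
- by rewrite filter_uniq// chars_uniq.
move=> chi; rewrite [RHS]mem_filter.
have -> : (chi \in finmap.enum_fset (fset_set (@even_nonprincipal_char R q))) =
  (chi \in @even_nonprincipal_char R q) := in_fset_set fE chi.
apply/idP/idP => [|/andP[/andP[/eqP ce /eqP np] /charsP Dc]]; last by rewrite inE.
rewrite inE => -[Dc np ce]; rewrite /even_np ce eqxx.
by apply/andP; split; [exact/eqP | exact/charsP].
Qed.

Let main := zeta_nat R 2 / zeta_nat R 4 * \prod_(p <- primes q) (1 + p%:R ^- 2)^-1.
Let t := 800 / c1.
Let a1 := 2 + 14 * t.
Let a2 := 40 * t ^+ 2.

(** With [K] about [6 log q] the approximation error is O((log q) ^ 2 / q ^ 2), and the sums of
    the weights are O((log q) ^ 2). The completed mean square differs from the sum over good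
    characters by the principal and at most one bad character, at a cost of O((log q) ^ 4). *)
Lemma sum_good_dist :
  `|\sum_(chi <- chars R q | even_np chi && ~~ bad chi) F chi - main / 2 * (totient q)%:R| <=
  (a2 * (2 * a1 + a2) + 8 * a1 ^+ 2 + 3) * l ^+ 4.
Proof.
have l1' := l1; have l0' := l0; have c10' := c10; have r0' := r0; have r4' := r4.
have [|K [K0 Kl Ku]] := @nat_above R (6 * l); first by lra.
have q0 : (0 < q)%N by exact: ltnW.
have q0' : (0 : R) < q%:R by rewrite ltr0n.
have q1' : (1 : R) <= q%:R by rewrite ler1n.
have K0' : (0 : R) < K%:R by rewrite ltr0n.
have p2 := pow2_inv_le q0 Kl.
have tq : (totient q)%:R <= q%:R :> R by rewrite ler_nat totient_le.
pose d := r / 400; have d0 : 0 < d by rewrite /d; lra.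
have d2 : d <= 1 / 2 by rewrite /d; lra.
pose eta := d / (2 * K%:R); pose B := 2 * (1 + eta^-1).
have t0 : 0 < t by apply: divr_gt0 c10; rewrite ltr0n.
have tl0 : 0 < t * l by exact: mulr_gt0.
have dE : d / 2 = (t * l)^-1 by rewrite /d /r /t; field; rewrite !gt_eqF.
have etaE : eta^-1 = K%:R * (t * l).
  have E : d / (2 * K%:R) = (t * l)^-1 / K%:R by rewrite -dE -[RHS]mulrA -(invfM 2 K%:R).
  by rewrite -[LHS]/((d / (2 * K%:R))^-1) E (invf_div _ K%:R) invrK.
have eta_ge0 : 0 <= eta^-1 by rewrite etaE; apply: mulr_ge0 => //; exact: ltW.
have eta_le : eta^-1 <= 7 * t * l ^+ 2.
  have -> : 7 * t * l ^+ 2 = 7 * l * (t * l) by ring.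
  by rewrite etaE; apply: ler_wpM2r; [exact: ltW | lra].
have ll : 1 <= l ^+ 2 by rewrite exprn_ege1// ltW.
have B0 : 0 <= B by rewrite /B; lra.
have a10 : 0 <= a1 by rewrite /a1; lra.
have a20 : 0 <= a2 by apply: mulr_ge0 => //; exact: sqr_ge0.
have B_le : B <= a1 * l ^+ 2.
  have -> : a1 * l ^+ 2 = 2 * l ^+ 2 + 2 * (7 * t * l ^+ 2) by rewrite /a1; ring.
  by rewrite /B; lra.
pose M := expR 1 * (4 * q%:R) / (d / 2) ^+ 2.
pose e := 10 / 3 * M * (2 / 5) ^+ K.
have M0 : 0 <= M.
  apply: mulr_ge0; last by rewrite invr_ge0 sqr_ge0.
  by apply: mulr_ge0 (expR_ge0 _) _; apply: mulr_ge0 => //; exact: ltW.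
have tl2 : 0 <= q%:R * (t * l) ^+ 2 by apply: mulr_ge0 (sqr_ge0 _); exact: ltW.
have M_le : M <= 12 * (q%:R * (t * l) ^+ 2).
  have -> : M = expR 1 * 4 * (q%:R * (t * l) ^+ 2).
    by rewrite /M dE exprVn invrK; ring.
  have h : expR 1 * 4 <= 12 :> R by have := expR1_lt3 R; lra.
  exact: (ler_wpM2r tl2 h).
have e_le : q%:R * e <= a2 * l ^+ 2.
  have h25 : (2 / 5) ^+ K <= q%:R ^- 3 :> R.
    by apply: le_trans p2; rewrite -exprVn lerXn2r ?nnegrE//; lra.
  have e1 : e <= 40 * (q%:R * (t * l) ^+ 2) * q%:R ^- 3.
    apply: le_trans (_ : 10 / 3 * M * q%:R ^- 3 <= _).
      have h : 0 <= 10 / 3 * M by apply: mulr_ge0 M0; lra.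
      exact: (ler_wpM2l h h25).
    by apply: ler_wpM2r; [rewrite invr_ge0 exprn_ge0 | lra].
  have := ler_wpM2l (ltW q0') e1.
  have -> : q%:R * (40 * (q%:R * (t * l) ^+ 2) * q%:R ^- 3) = a2 * l ^+ 2 * q%:R^-1.
    by rewrite /a2; move: q0'; move: (q%:R : R) t l => x y z x0; field; rewrite gt_eqF.
  move=> h; apply: (le_trans h); apply: ler_piMr; last by rewrite invf_le1.
  by apply: mulr_ge0 => //; exact: sqr_ge0.
have e0 : 0 <= e.
  apply: mulr_ge0; last by rewrite exprn_ge0.
  by apply: mulr_ge0 M0; lra.
have e_le' : e <= a2 * l ^+ 2 by apply: le_trans e_le; rewrite ler_peMl.
pose A chi := cabs (dlim (smooth_mobius chi (weight d K))).
have A0 chi : 0 <= A chi by exact: cabs_ge0.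
have AB chi : D chi -> A chi <= B by exact: smooth_mobius_le.
have A2 chi : D chi -> 0 <= A chi ^+ 2 <= B ^+ 2.
  by move=> Dc; rewrite sqr_ge0 lerXn2r ?nnegrE ?A0 ?AB.
have good chi : D chi -> even_np chi && ~~ bad chi -> `|F chi - A chi ^+ 2| <= e * (2 * B + e).
  move=> Dc /andP[/andP[_ /eqP np] /asboolPn nz].
  have [|z [z1 z2]] := @inverse_approx R c0 c0_gt0 c0_exceptional q q1 chi r Dc np r0 r2 _ K.
    by move=> w wr; apply/eqP => E; apply: nz; exists w.
  rewrite /F /A -exprVn -cabsV; apply: sqr_dist_le; rewrite ?cabs_ge0 ?AB//.
  rewrite -/d (dlimE z1); apply: le_trans (_ : _ <= cabs ((L chi 1)^-1 - z)) z2.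
  by rewrite ler_norml lerNl opprB [X in _ && X]ler_cabsB andbT cabsBC ler_cabsB.
have := smoothed_mean_square q1 d0 d2 K0; rewrite -/main -/eta -/B.
set S := \sum_(chi <- chars R q | chi (-1) == 1) _ => HS.
pose Sg := \sum_(chi <- chars R q | even_np chi && ~~ bad chi) A chi ^+ 2.
have Sdist : 0 <= S - Sg <= 2 * B ^+ 2.
  have -> : S - Sg = \sum_(chi <- chars R q | (chi (-1) == 1) && (chi == principal_char R q))
      A chi ^+ 2 + \sum_(chi <- chars R q | even_np chi && bad chi) A chi ^+ 2.
    rewrite /S (bigID (fun chi => chi == principal_char R q)) /=.
    by rewrite -/(even_np _) [X in _ + X - _](bigID bad) /= /Sg addrA addrK.
  have BB : 0 <= B ^+ 2 by exact: sqr_ge0.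
  have /andP[h1 h2] := @sum_le_single R _ (chars R q)
    (fun chi => (chi (-1) == 1) && (chi == principal_char R q)) (fun chi => A chi ^+ 2) _
    (chars_uniq R q) BB (fun chi cs _ => A2 chi (elimT (charsP _) cs))
    (fun chi psi _ _ hc hp => etrans (eqP (proj2 (andP hc))) (esym (eqP (proj2 (andP hp))))).
  have /andP[h3 h4] := @sum_le_single R _ (chars R q)
    (fun chi => even_np chi && bad chi) (fun chi => A chi ^+ 2) _
    (chars_uniq R q) BB (fun chi cs _ => A2 chi (elimT (charsP _) cs)) bad_unique.
  by apply/andP; split; lra.
have Fdist : `|\sum_(chi <- chars R q | even_np chi && ~~ bad chi) F chi - Sg| <=
    q%:R * (e * (2 * B + e)).
  rewrite /Sg -sumrB; apply: (le_trans (ler_norm_sum _ _ _)).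
  have X0 : 0 <= e * (2 * B + e) by rewrite mulr_ge0// addr_ge0// mulr_ge0.
  apply: le_trans (_ : \sum_(chi <- chars R q) e * (2 * B + e) <= _).
    rewrite big_mkcond big_seq [leRHS]big_seq; apply: ler_sum => chi /charsP Dc.
    by case: ifP => // /(good _ Dc).
  rewrite big_const_seq count_predT iter_addr_0 -[leLHS]mulr_natl size_chars//.
  exact: (ler_wpM2r X0 tq).
set X := \sum_(chi <- _ | _) F chi in Fdist *.
have eB : q%:R * (e * (2 * B + e)) <= a2 * (2 * a1 + a2) * l ^+ 4.
  have -> : a2 * (2 * a1 + a2) * l ^+ 4 = a2 * l ^+ 2 * (2 * (a1 * l ^+ 2) + a2 * l ^+ 2) by ring.
  rewrite mulrA; apply: (ler_pM (mulr_ge0 (ltW q0') e0) _ e_le); lra.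
have BB : B ^+ 2 <= a1 ^+ 2 * l ^+ 4.
  have -> : a1 ^+ 2 * l ^+ 4 = (a1 * l ^+ 2) ^+ 2 by ring.
  by rewrite lerXn2r ?nnegrE// mulr_ge0 ?sqr_ge0.
have eta3 : 8 * (3 + eta^-1) * B <= 12 * B ^+ 2.
  rewrite (_ : 12 * B ^+ 2 = 12 * B * B); last by ring.
  by rewrite ler_wpM2r// /B; lra.
have t2 : (totient q)%:R * (6 * 2 ^- K) <= 6 :> R.
  have h6 : 6 * 2 ^- K <= 6 * q%:R ^- 3 :> R by rewrite ler_pM2l.
  apply: le_trans (_ : q%:R * (6 * q%:R ^- 3) <= _).
    by apply: ler_pM tq h6; rewrite // mulr_ge0// invr_ge0 exprn_ge0.
  have -> : q%:R * (6 * q%:R ^- 3) = 6 * (q%:R ^- 2) :> R by field; rewrite gt_eqF.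
  by rewrite ler_piMr// invf_le1 ?exprn_gt0// exprn_ege1.
have l4 : 1 <= l ^+ 4 by rewrite exprn_ege1// ltW.
move: HS Fdist Sdist; rewrite !ler_norml => /andP[h1 h2] /andP[h3 h4] /andP[h5 h6].
have mE : 2 * (main / 2 * (totient q)%:R) = (totient q)%:R * main by field.
move: mE h1 h2; set m := main / 2 * _ => <-.
move: eB BB eta3 t2 h3 h4 h5 h6 l4.
have -> : (a2 * (2 * a1 + a2) + 8 * a1 ^+ 2 + 3) * l ^+ 4 =
  a2 * (2 * a1 + a2) * l ^+ 4 + 8 * (a1 ^+ 2 * l ^+ 4) + 3 * l ^+ 4 by ring.
move: (a2 * (2 * a1 + a2) * l ^+ 4) => y1; move: (a1 ^+ 2 * l ^+ 4) => y2.
move: (totient q)%:R => f; move: (f * (6 * 2 ^- K)) (8 * (3 + eta^-1) * B) => y3 y4.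
move: (q%:R * (e * (2 * B + e))) (l ^+ 4) (B ^+ 2) => y5 y6 y7 *.
by apply/andP; split; lra.
Qed.

End Assembly.

Theorem theorem1p2 (R : realType) (c0 : R) (c0_gt0 : 0 < c0)
    (c0_exceptional : exceptional_zero_const c0) :
  exists C K1 K2 : R, [/\ 0 < C, 0 < K1, 0 < K2 &
    forall q : nat, (3 <= q)%N ->
    exists E1 E2 : R,
    [/\ \sum_(chi \in @even_nonprincipal_char R q)
          (ComplexField.Normc.normc (dirichletL chi 1) ^+ 2)^-1 =
        zeta_nat R 2 / (2 * zeta_nat R 4) *
          (\prod_(p <- primes q) (1 + p%:R ^- 2)^-1) * (totient q)%:R
        + E1 + exceptional_delta c0 q * E2,
        `|E1| <= K1 * expR (C * (ln q%:R / ln (ln q%:R))) &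
        forall beta1 : R, exceptional_zero c0 q beta1 ->
          `|E2| <= K2 * ((1 - beta1)^-1 *
                         (ln q%:R ^+ 2 + (1 - beta1)^-1))]].
Proof.
pose c1 : R := Num.min (c0 / 2) (1 / 4).
have c10 : 0 < c1 by rewrite /c1 lt_min divr_gt0//= divr_gt0.
have [t tE t0] : exists2 t : R, t = 800 / c1 & 0 < t.
  by apply: (ex_intro2 _ _ (800 / c1) erefl); apply: divr_gt0 c10; rewrite ltr0n.
pose a1 : R := 2 + 14 * t; pose a2 : R := 40 * t ^+ 2.
have a10 : 0 <= a1 by rewrite /a1; lra.
have a20 : 0 <= a2 by apply: mulr_ge0 => //; exact: sqr_ge0.
exists 16, (a2 * (2 * a1 + a2) + 8 * a1 ^+ 2 + 3), ((2 * expR (37 * c1)) ^+ 2).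
have K10 : 0 < a2 * (2 * a1 + a2) + 8 * a1 ^+ 2 + 3.
  have h1 : 0 <= a2 * (2 * a1 + a2) by apply: mulr_ge0 => //; lra.
  by have := sqr_ge0 a1; lra.
split=> //; first by apply: exprn_gt0; apply: mulr_gt0 (expR_gt0 _).
move=> q q3; pose F chi : R := (cabs (@dirichletL R q chi 1) ^+ 2)^-1.
pose P := fun chi => @even_np R q chi && bad c0 chi.
pose main := zeta_nat R 2 / zeta_nat R 4 * \prod_(p <- primes q) (1 + p%:R ^- 2)^-1.
exists (\sum_(chi <- chars R q | even_np chi && ~~ bad c0 chi) F chi -
  main / 2 * (totient q)%:R), (\sum_(chi <- chars R q | P chi) F chi); split.
- rewrite (sum_even_np R q) (bigID (@bad R c0 q)) /=.
  rewrite (delta_sum_bad c0_gt0 c0_exceptional q3) -/F /P /main.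
  by rewrite invfM; ring.
- have := sum_good_dist c0_gt0 c0_exceptional q3; rewrite -/c1 -tE => h; apply: (le_trans h).
  apply: (ler_wpM2l (ltW K10)).
  exact: pow4_le_expR (ln3_gt1 R q3).
- by move=> beta; exact: sum_bad_le.
Qed.
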